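(* Let $A$ be a non-special rational function of degree at least two. Then there exist a rational function $X_A$ which is a Galois covering and a rational function $B$ such that $$A\circ X_A = X_A\circ B,$$ and for every rational function $U$ of degree at least two the sequence $g_d(A,U)$, $d\ge 1$, is bounded if and only if $U$ is a compositional left factor of $A^{\circ l}\circ X_A$ for some $l\ge 0$. Moreover, if $A$ is not a generalized Latt\`es map, then for every rational function $U$ of degree at least two the sequence $g_d(A,U)$, $d\geq 1$, is bounded if and only if $U$ is a compositional left factor of $A^{\circ l}$ for some $l\ge 1$.
   Context: All functions are complex rational functions, viewed as holomorphic self-maps of $\mathbb{CP}^1$; $A^{\circ d}$ denotes the $d$-th iterate. For rational functions $A,U$ and $d\ge1$, $g_d(A,U)$ is the minimal genus of (the desingularization of) an irreducible component of the algebraic curve $A^{\circ d}(x)-U(y)=0$. A rational function $U$ is a compositional left factor of a rational function $f$ if $f=U\circ V$ for some rational function $V$. A rational function $X$ is a Galois covering if the field extension $\mathbb C(z)/\mathbb C(X)$ is Galois. An orbifold on $\mathbb{CP}^1$ is a function $\nu:\mathbb{CP}^1\to\mathbb N$ equal to $1$ except at finitely many points; orbifolds are assumed good, i.e. it is forbidden to have exactly one point with $\nu>1$, or exactly two such points $z_1,z_2$ with $\nu(z_1)\neq\nu(z_2)$. The non-ramified sphere is $\nu\equiv 1$. A rational function $A$ of degree $\ge2$ is a Latt\`es map if there is an orbifold $\nu$ with $\nu(A(z))=\nu(z)\deg_zA$ for all $z$ ($\deg_z A$ the local degree). $A$ is a generalized Latt\`es map if there is an orbifold $\nu$ distinct from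 the non-ramified sphere with $\nu(A(z))=\nu(z)\,\gcd(\deg_zA,\nu(A(z)))$ for all $z\in\mathbb{CP}^1$. $A$ is special if it is a Latt\`es map or is conjugate by a M\''obius transformation to $z^{\pm n}$ or $\pm T_n$, where $T_n$ is the Chebyshev polynomial. *)

(* Defs.v *)
(* Complex rational functions, viewed as elements of the
   rational function field C(z) = {fraction {poly C}}, where C = R[i] for an
   arbitrary realType R (every realType is isomorphic to the reals, so R[i]
   is the field of complex numbers). *)
From HB Require Import structures.
From mathcomp Require Import all_boot all_order all_algebra.
From mathcomp Require Import separable.
From mathcomp Require Import complex.
From mathcomp Require Import reals.
From Stdlib Require List.

Set Implicit Arguments.
Unset Strict Implicit.
Unset Printing Implicit Defensive.

Import Order.TTheory GRing.Theory Num.Theory.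
Local Open Scope ring_scope.

Section Defs.
Variable R : realType.
Local Notation C := R[i].

Definition ratf : Type := {fraction {poly C}}.

Definition rnum (f : ratf) : {poly C} :=
  let r := repr f in \n_r %/ gcdp \n_r \d_r.
Definition rden (f : ratf) : {poly C} :=
  let r := repr f in \d_r %/ gcdp \n_r \d_r.

Definition rdeg (f : ratf) : nat := (maxn (size (rnum f)) (size (rden f))).-1.

Definition idr : ratf := FracField.tofrac 'X.

Definition rcomp (f g : ratf) : ratf :=
  (map_poly (fun a : C => FracField.tofrac (a%:P)) (rnum f)).[g]
  / (map_poly (fun a : C => FracField.tofrac (a%:P)) (rden f)).[g].

Definition iterc (A : ratf) (d : nat) : ratf := iter d (rcomp A) idr.

Definition lfactor (U f : ratf) : Prop := exists V : ratf, f = rcomp U V.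

(* Rational functions as self-maps of CP^1 = option C (None = infinity)    *)

Definition evalr (f : ratf) (z : option C) : option C :=
  let p := rnum f in let q := rden f in
  match z with
  | Some z0 => if q.[z0] == 0 then None else Some (p.[z0] / q.[z0])
  | None => if (size q < size p)%N then None
            else if (size p < size q)%N then Some 0
            else Some (lead_coef p / lead_coef q)
  end.

(* polynomial whose zeros (in C) are the finite points of f^{-1}(w) *)
Definition fib_poly (f : ratf) (w : option C) : {poly C} :=
  match w with
  | Some w0 => rnum f - w0 *: rden f
  | None => rden f
  end.

Definition locdeg (f : ratf) (z : option C) : nat :=
  match z with
  | Some z0 => mup z0 (fib_poly f (evalr f (Some z0)))
  | None => (rdeg f - (size (fib_poly f (evalr f None))).-1)%N
  end.

Definition orbifold (nu : option C -> nat) : Prop :=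
  (forall z, (0 < nu z)%N) /\
  exists S : seq (option C), forall z, z \notin S -> nu z = 1%N.

Definition good_orbifold (nu : option C -> nat) : Prop :=
  orbifold nu /\
  ~ (exists z1, forall z, (1 < nu z)%N <-> z = z1) /\
  ~ (exists z1 z2, z1 <> z2 /\ (forall z, (1 < nu z)%N <-> z = z1 \/ z = z2)
                   /\ nu z1 <> nu z2).

Definition lattes (A : ratf) : Prop :=
  (2 <= rdeg A)%N /\
  exists nu, good_orbifold nu /\
    forall z, nu (evalr A z) = (nu z * locdeg A z)%N.

Definition gen_lattes (A : ratf) : Prop :=
  (2 <= rdeg A)%N /\
  exists nu, good_orbifold nu /\ (exists z, nu z <> 1%N) /\
    forall z, nu (evalr A z) = (nu z * gcdn (locdeg A z) (nu (evalr A z)))%N.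

Fixpoint cheb_pair (n : nat) : {poly C} * {poly C} :=
  match n with
  | 0 => (1, 'X)
  | n'.+1 => let (a, b) := cheb_pair n' in (b, 'X * b *+ 2 - a)
  end.
Definition cheb (n : nat) : {poly C} := (cheb_pair n).1.

Definition mobius (mu : ratf) : Prop := rdeg mu = 1%N.

Definition conj_to (A F : ratf) : Prop :=
  exists mu, mobius mu /\ rcomp A mu = rcomp mu F.

Definition special (A : ratf) : Prop :=
  lattes A \/
  exists n : nat,
    conj_to A (FracField.tofrac ('X ^+ n)) \/
    conj_to A (FracField.tofrac ('X ^+ n))^-1 \/
    conj_to A (FracField.tofrac (cheb n)) \/
    conj_to A (- FracField.tofrac (cheb n)).

(* Galois coverings: C(z)/C(X) is a Galois extension                        *)

(* membership in the subfield C(X) = { h o X } *)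
Definition inK (X f : ratf) : Prop := exists h : ratf, f = rcomp h X.
Definition polyK (X : ratf) (P : {poly ratf}) : Prop := forall i, inK X P`_i.
Definition irredK (X : ratf) (P : {poly ratf}) : Prop :=
  polyK X P /\ (1 < size P)%N /\
  forall P1 P2, polyK X P1 -> polyK X P2 -> P = P1 * P2 ->
    size P1 = 1%N \/ size P2 = 1%N.

(* algebraic, normal and separable *)
Definition galois_cov (X : ratf) : Prop :=
  (forall a : ratf, exists P, polyK X P /\ P != 0 /\ root P a) /\
  (forall P, irredK X P -> (exists a, root P a) ->
     exists rs : seq ratf, P = lead_coef P *: \prod_(r <- rs) ('X - r%:P)) /\
  (forall P, irredK X P -> (exists a, root P a) -> separable_poly P).

(* Bivariate polynomials: {poly {poly C}}, outer variable y, inner x.      *)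

Definition curve (F U : ratf) : {poly {poly C}} :=
  (rnum F)%:P * map_poly polyC (rden U) - (rden F)%:P * map_poly polyC (rnum U).

Definition bconst (Q : {poly {poly C}}) : Prop := exists c : C, Q = (c%:P)%:P.

Definition component (P Q : {poly {poly C}}) : Prop :=
  ~ bconst Q /\ (exists S, P = Q * S) /\
  forall A B, Q = A * B -> bconst A \/ bconst B.

(* Genus of (the desingularization of) an irreducible plane curve          *)
(* Q(x,y) = 0, via the Riemann-Hurwitz formula for the projection to x,    *)
(* of degree n = deg_y Q; places above x = c are read off from Puiseux     *)
(* expansions.                                                             *)

Definition pser := nat -> C.
Definition ps_mul (a b : pser) : pser :=
  fun k => \sum_(i < k.+1) a i * b (k - i)%N.
Definition ps_one : pser := fun k => (k == 0%N)%:R.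
Definition ps_pow (a : pser) (j : nat) : pser := iter j (ps_mul a) ps_one.
Definition ps_shift (m : nat) (a : pser) : pser :=
  fun k => if (m <= k)%N then a (k - m)%N else 0.
Definition ps_of_poly (p : {poly C}) : pser := fun k => p`_k.

Definition xdeg (Q : {poly {poly C}}) : nat := (\max_(j < size Q) (size (Q`_j)%R).-1)%N.
(* coefficient of y^j of x^{xdeg Q} Q(1/x, y) *)
Definition xrev (Q : {poly {poly C}}) (j : nat) : {poly C} :=
  \poly_(i < (xdeg Q).+1) (Q`_j)`_(xdeg Q - i).

(* coefficient of y^j of Q(x(s), y) where x(s) = c + s^e (c finite) or
   x(s) = s^{-e} (c = infinity, after clearing denominators) *)
Definition xsub (Q : {poly {poly C}}) (c : option C) (e j : nat) : {poly C} :=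
  match c with
  | Some c0 => Q`_j \Po (c0%:P + 'X ^+ e)
  | None => xrev Q j \Po ('X ^+ e)
  end.

(* a formal Laurent series y(s) = s^{-m} w(s), normalized so that the
   representation is unique *)
Definition normalized (y : nat * pser) : Prop := y.1 = 0%N \/ y.2 0%N != 0.

(* Q(x(s), y(s)) = 0 in C((s)) *)
Definition is_root (Q : {poly {poly C}}) (c : option C) (e : nat)
    (y : nat * pser) : Prop :=
  let n := (size Q).-1 in
  forall k, \sum_(j < size Q)
    ps_mul (ps_of_poly (xsub Q c e j))
           (ps_shift (y.1 * (n - j))%N (ps_pow y.2 j)) k = 0.

(* y(s) does not lie in C((s^k)) for any divisor k > 1 of e *)
Definition primitive (e : nat) (y : nat * pser) : Prop :=
  forall k, (1 < k)%N -> (k %| e)%N ->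
    ~ (forall j, y.2 j != 0 -> j = y.1 %[mod k]).

(* there are exactly cnt primitive Puiseux roots with parameter e above c;
   cnt = e * (number of places above c with ramification index e) *)
Definition prim_count (Q : {poly {poly C}}) (c : option C) (e cnt : nat) : Prop :=
  exists l : seq (nat * pser), size l = cnt /\ List.NoDup l /\
    forall y, List.In y l <-> normalized y /\ is_root Q c e y /\ primitive e y.

(* sum over the places P above c of (e_P - 1) *)
Definition loc_defect (cnt : option C -> nat -> nat) (c : option C) (n : nat) : nat :=
  \sum_(e < n.+1) ((e.-1) * (cnt c e %/ e))%N.

Definition has_genus (Q : {poly {poly C}}) (g : nat) : Prop :=
  let n := (size Q).-1 in
  if n == 0%N then g = 0%N else
  exists cnt : option C -> nat -> nat,
    (forall c e, (0 < e <= n)%N -> prim_count Q c e (cnt c e)) /\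
    exists S : seq (option C), uniq S /\
      (forall c, c \notin S -> loc_defect cnt c n = 0%N) /\
      (2 * g + 2 * n = 2 + \sum_(c <- S) loc_defect cnt c n)%N.

(* the sequence g_d(A,U) = minimal genus of a component of A^{od}(x) = U(y),
   d >= 1, is bounded *)
Definition gd_bounded (A U : ratf) : Prop :=
  exists M : nat, forall d : nat, (0 < d)%N ->
    exists Q g, component (curve (iterc A d) U) Q /\ has_genus Q g /\ (g <= M)%N.

End Defs.

(* Main.v *)
(* For a polynomial Q over C(x) and a point w of the sphere, let nu_Q(w) be the
   least k such that Q splits over C((s)) after x = w + s^k (x = s^-k if w is
   infinite). Substituting A(z) for x divides nu_Q(A(z)) by its gcd with the local
   degree of A at z, and the simple connectedness of the sphere appears as: if
   nu_Q = 1 on C, then Q splits over C(x).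

   If g_d(A, U) is bounded, some component of A^d(x) = U(y) stays irreducible under
   all further pullbacks by A and has bounded genus infinitely often. Its ramified
   points are then bounded in number, hence lie in finitely many forward images of
   critical values, and its ramification indices are eventually periodic; their lcm
   is an orbifold fixed by A. If A is not a generalized Lattes map, this orbifold is
   trivial, so the component splits and U is a left factor of A^d. In general, the
   Riemann-Hurwitz inequality and the classification of spherical orbifolds give a
   largest orbifold fixed by a non-special A. It is uniformized by one of Klein's
   explicit Galois coverings X_A; A o X_A lifts through X_A, and pulling the
   component back by X_A removes its ramification.

   Conversely, if A^d o X = U o V, then Lueroth's theorem yields a component of
   A^d(x) = U(y) parametrized by the sphere, whose places over x = c are the points
   of a fibre of a rational function, so that its genus is 0. *)

Require Import Defs.
From HB Require Import structures.
From mathcomp Require Import all_boot all_order all_algebra.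
From mathcomp Require Import cyclic cyclotomic.
From mathcomp Require Import polyXY separable boolp complex reals.
From mathcomp Require Import ring lra zify.
From Stdlib Require List.

Set Implicit Arguments.
Unset Strict Implicit.
Unset Printing Implicit Defensive.
Import Order.TTheory GRing.Theory Num.Theory.
Local Open Scope ring_scope.

(** Topology is replaced by algebra over C((s)): a point near w is an embedding of C(z) given by the
    image of z, and ramification of Q is read off from the exponents k for which Q splits after x =
    w + s^k. These exponents are closed under multiples and gcds, a product of polynomials has the
    lcm of the indices, and pulling back by A multiplies exponents by local degrees. The equation
    nu(A(z)) = nu(z) gcd(deg_z A, nu(A(z))) thus becomes the equivalence: nu(z) divides k iff
    nu(A(z)) divides k deg_z A. In this form it visibly survives lcms, which is why a largest fixed
    orbifold exists as soon as the indices are bounded. Non-specialness supplies the bound, because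
    the cyclic and dihedral families are the only spherical ones with unbounded indices. In the
    converse the obstacle is that z -> (X(z), V(z)) need not be birational onto its image. Dividing
    X and V on the right by a generator W of the field C(X, V) repairs this; the new pair separates
    points over C((s)), and both the irreducibility of the component and the primitivity of its
    Puiseux roots rest on that separation. *)

Local Notation "x %:F" := (@FracField.tofrac _ x).

(** * Formal power series *)

Section Triangular.
Variable F : fieldType.

(* The n-th equation determines f n from the previous values. *)
Lemma triangular_solve (G : (nat -> F) -> nat -> F) (a u : nat -> F) :
  (forall n, a n != 0) ->
  (forall n (f g : nat -> F), (forall i, (i < n)%N -> f i = g i) ->
     G f n - a n * f n = G g n - a n * g n) ->
  exists f, forall n, G f n = u n.
Proof.
move=> a0 HG.
pose fix sol (k : nat) : seq F := match k with
  | 0 => [::]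
  | k'.+1 => rcons (sol k')
      ((u k' - (G (nth 0 (sol k')) k' - a k' * nth 0 (sol k') k')) / a k') end.
have sz k : size (sol k) = k by elim: k => //= k IH; rewrite size_rcons IH.
have st k j i : (i < k)%N -> nth 0 (sol (k + j)%N) i = nth 0 (sol k) i.
  move=> ik; elim: j => [|j IH]; first by rewrite addn0.
  by rewrite addnS /= nth_rcons sz ifT ?IH //; apply: ltn_addr.
exists (fun n => nth 0 (sol n.+1) n) => n.
set f := fun n => _.
have fE i : (i < n)%N -> f i = nth 0 (sol n) i.
  by move=> ni; rewrite /f -(subnKC ni) st.
apply: (@addIr _ (- (a n * f n))); rewrite (HG n f (nth 0 (sol n))) //.
have fnE : f n = (u n - (G (nth 0 (sol n)) n - a n * nth 0 (sol n) n)) / a n.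
  by rewrite /f /= nth_rcons sz ltnn eqxx.
rewrite fnE [a n * (_ / _)]mulrC divfK //; move: (G _ n) (a n * _) => x y; ring.
Qed.
End Triangular.

Section PowerSeries.
Variable F : fieldType.

Record ps := Ps { pco : nat -> F }.
HB.instance Definition _ := gen_eqMixin ps.
HB.instance Definition _ := gen_choiceMixin ps.

Implicit Types f g h : ps.

Lemma psP f g : (forall n, pco f n = pco g n) -> f = g.
Proof. by case: f g => [f] [g] /= fg; congr Ps; apply/funext. Qed.

Definition ps_add f g := Ps (fun n => pco f n + pco g n).
Definition ps_opp f := Ps (fun n => - pco f n).
Definition ps_zero := Ps (fun _ => 0).
Definition ps_unit1 := Ps (fun n => (n == 0%N)%:R).
Definition ps_prod f g := Ps (fun n => \sum_(i < n.+1) pco f i * pco g (n - i)%N).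

Definition ps_trunc N f : {poly F} := \poly_(i < N.+1) pco f i.

Lemma ps_prodE N n f g : (n <= N)%N ->
  pco (ps_prod f g) n = (ps_trunc N f * ps_trunc N g)`_n.
Proof.
move=> nN; rewrite coefM; apply: eq_bigr => i _.
rewrite !coef_poly !ifT //; first by rewrite ltnS (leq_trans _ nN) ?leq_subr.
by rewrite (leq_trans (ltn_ord i)).
Qed.

Lemma coef_trunc N f n : (n <= N)%N -> (ps_trunc N f)`_n = pco f n.
Proof. by move=> nN; rewrite coef_poly ltnS nN. Qed.

Lemma coefM_eq (p p' q q' : {poly F}) n :
  (forall i, (i <= n)%N -> p`_i = p'`_i) -> (forall i, (i <= n)%N -> q`_i = q'`_i) ->
  (p * q)`_n = (p' * q')`_n.
Proof.
move=> pp qq; rewrite !coefM; apply: eq_bigr => i _.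
by rewrite pp -1?ltnS // qq // leq_subr.
Qed.

Fact ps_addA : associative ps_add.
Proof. by move=> f g h; apply: psP => n /=; rewrite addrA. Qed.
Fact ps_addC : commutative ps_add.
Proof. by move=> f g; apply: psP => n /=; rewrite addrC. Qed.
Fact ps_add0 : left_id ps_zero ps_add.
Proof. by move=> f; apply: psP => n /=; rewrite add0r. Qed.
Fact ps_addN : left_inverse ps_zero ps_opp ps_add.
Proof. by move=> f; apply: psP => n /=; rewrite addNr. Qed.
HB.instance Definition _ := GRing.isZmodule.Build ps ps_addA ps_addC ps_add0 ps_addN.

Fact ps_mulA : associative ps_prod.
Proof.
move=> f g h; apply: psP => n.
rewrite !(@ps_prodE n) //.
rewrite (@coefM_eq _ (ps_trunc n f) _ (ps_trunc n g * ps_trunc n h)) //; last first.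
  by move=> i ni; rewrite coef_trunc // (@ps_prodE n).
rewrite mulrA; apply: coefM_eq => // i ni.
by rewrite coef_trunc // (@ps_prodE n).
Qed.
Fact ps_mulC : commutative ps_prod.
Proof. by move=> f g; apply: psP => n; rewrite !(@ps_prodE n) // mulrC. Qed.
Fact ps_mul1 : left_id ps_unit1 ps_prod.
Proof.
move=> f; apply: psP => n /=; rewrite big_ord_recl /= subn0 mul1r big1 ?addr0 //.
by move=> i _; rewrite /= mul0r.
Qed.
Fact ps_mulDl : left_distributive ps_prod ps_add.
Proof.
move=> f g h; apply: psP => n /=; rewrite -big_split /=.
by apply: eq_bigr => i _; rewrite mulrDl.
Qed.
Fact ps_1neq0 : ps_unit1 != 0 :> ps.
Proof. by apply/eqP => /(congr1 (fun f => pco f 0)) /= /eqP; rewrite oner_eq0. Qed.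
HB.instance Definition _ := GRing.Zmodule_isComNzRing.Build ps
  ps_mulA ps_mulC ps_mul1 ps_mulDl ps_1neq0.

Lemma pcoD f g n : pco (f + g) n = pco f n + pco g n. Proof. by []. Qed.
Lemma pcoB f g n : pco (f - g) n = pco f n - pco g n. Proof. by []. Qed.
Lemma pco0 n : pco 0 n = 0. Proof. by []. Qed.
Lemma pco1 n : pco 1 n = (n == 0%N)%:R. Proof. by []. Qed.
Lemma pcoM f g n : pco (f * g) n = \sum_(i < n.+1) pco f i * pco g (n - i)%N.
Proof. by []. Qed.
Lemma pcoM0 f g : pco (f * g) 0 = pco f 0 * pco g 0.
Proof. by rewrite pcoM big_ord1. Qed.
Lemma pcoX0 f n : pco (f ^+ n) 0 = pco f 0 ^+ n.
Proof. by elim: n => [|n IH]; rewrite ?expr0 // !exprS pcoM0 IH. Qed.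

Lemma psM_trunc N n f g : (n <= N)%N ->
  pco (f * g) n = (ps_trunc N f * ps_trunc N g)`_n.
Proof. exact: ps_prodE. Qed.

Lemma ps_neq0 f n : pco f n != 0 -> f != 0.
Proof. by apply: contraNneq => ->. Qed.

Definition psC (a : F) : ps := Ps (fun n => if n == 0%N then a else 0).
Fact psC_zmod : zmod_morphism psC.
Proof. by move=> a b; apply: psP => -[|n] /=; rewrite ?pcoB /= ?subrr. Qed.
HB.instance Definition _ := GRing.isZmodMorphism.Build F ps psC psC_zmod.
Lemma pco_psCM a f n : pco (psC a * f) n = a * pco f n.
Proof.
rewrite pcoM big_ord_recl /= subn0 big1 ?addr0 //.
by move=> i _; rewrite mul0r.
Qed.
Fact psC_monoid : monoid_morphism psC.
Proof.
split; first by apply: psP => -[|n].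
by move=> a b; apply: psP => n; rewrite pco_psCM /=; case: (n == 0%N); rewrite ?mulr0.
Qed.
HB.instance Definition _ := GRing.isMonoidMorphism.Build F ps psC psC_monoid.

Definition psX : ps := Ps (fun n => (n == 1%N)%:R).
Lemma pco_psXnM k f n :
  pco (psX ^+ k * f) n = if (k <= n)%N then pco f (n - k)%N else 0.
Proof.
elim: k n => [|k IH] n; first by rewrite expr0 mul1r subn0.
have X1 g m : pco (psX * g) m = if m is m'.+1 then pco g m' else 0.
  rewrite pcoM; case: m => [|m]; first by rewrite big_ord1 /= mul0r.
  rewrite big_ord_recl /= mul0r add0r big_ord_recl /= /bump /= subSS subn0 mul1r.
  by rewrite big1 ?addr0 // => i _; rewrite mul0r.
by rewrite exprS -mulrA X1; case: n => [|n] //; rewrite IH subSS.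
Qed.
Lemma pco_psXn k n : pco (psX ^+ k) n = (n == k)%:R.
Proof.
rewrite -[psX ^+ k]mulr1 pco_psXnM pco1 subn_eq0 eqn_leq.
by case: (k <= n)%N; rewrite ?andbT ?andbF.
Qed.
Lemma psX_neq0 : psX != 0.
Proof. by apply: (@ps_neq0 _ 1); rewrite /= oner_eq0. Qed.

Lemma ps_factor f : f != 0 -> exists k g, pco g 0 != 0 /\ f = psX ^+ k * g.
Proof.
move=> f0; have [n Hn] : exists n, pco f n != 0.
  apply: contrapT => H; move/eqP: f0; apply; apply: psP => n.
  by apply: contrapT => /eqP Hn; apply: H; exists n.
have [k kP kmin] := ex_minnP (ex_intro (fun n => pco f n != 0) n Hn).
exists k, (Ps (fun i => pco f (i + k)%N)); split; first by [].
apply: psP => i; rewrite pco_psXnM; case: leqP => [ki|ki] /=; first by rewrite subnK.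
by apply/eqP; apply: contraLR ki => fi; rewrite -leqNgt kmin.
Qed.

Lemma ps_inv_ex f : pco f 0 != 0 -> exists g, g * f = 1.
Proof.
move=> f0.
have [||g gP] := @triangular_solve F (fun (a : nat -> F) n => pco (Ps a * f) n) (fun=> pco f 0)
   (fun n => (n == 0%N)%:R).
- by [].
- move=> n g h gh; rewrite !pcoM !big_ord_recr /= subnn ![_ * pco f 0]mulrC !addrK.
  by apply: eq_bigr => i _; rewrite gh.
by exists (Ps g); apply: psP => n; rewrite gP.
Qed.

Lemma ps_mulf_eq0 f g : f * g = 0 -> (f == 0) || (g == 0).
Proof.
move=> fg; apply/norP => -[/ps_factor [k [f1 [f10 fE]]] /ps_factor [l [g1 [g10 gE]]]].
have : pco (f * g) (k + l) = 0 by rewrite fg.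
rewrite fE gE mulrACA -exprD pco_psXnM leqnn subnn pcoM0 => /eqP.
by rewrite mulf_eq0 (negPf f10) (negPf g10).
Qed.

Definition ps_unit : {pred ps} := fun f => pco f 0 != 0.
Definition ps_inv f : ps :=
  if pselect (exists g, g * f = 1) is left H then sval (cid H) else f.
Fact ps_mulV : {in ps_unit, left_inverse 1 ps_inv *%R}.
Proof.
move=> f /ps_inv_ex H; rewrite /ps_inv; case: pselect => // H'.
by case: cid.
Qed.
Fact ps_unitP f g : g * f = 1 -> f \in ps_unit.
Proof.
move=> /(congr1 (fun h => pco h 0)); rewrite pcoM0 => H.
apply/negP => /eqP f0; move: H; rewrite f0 mulr0 => /esym/eqP.
by rewrite pco1 oner_eq0.
Qed.
Fact ps_inv_out : {in [predC ps_unit], ps_inv =1 id}.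
Proof.
move=> f /= nf; rewrite /ps_inv; case: pselect => // -[g gf].
by move: nf; rewrite inE (ps_unitP gf).
Qed.
HB.instance Definition _ := GRing.ComNzRing_hasMulInverse.Build ps
  ps_mulV ps_unitP ps_inv_out.
HB.instance Definition _ := GRing.ComUnitRing_isIntegral.Build ps ps_mulf_eq0.

Lemma unit_psE f : (f \is a GRing.unit) = (pco f 0 != 0). Proof. by []. Qed.

Lemma pcoV0 f : pco f 0 != 0 -> pco (f^-1) 0 = (pco f 0)^-1.
Proof.
move=> f0; apply: (mulfI f0); rewrite mulfV // -pcoM0 divrr //.
Qed.

Definition ps_eqmod N f g := forall i, (i <= N)%N -> pco f i = pco g i.
Lemma ps_eqmodM N f f' g g' :
  ps_eqmod N f f' -> ps_eqmod N g g' -> ps_eqmod N (f * g) (f' * g').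
Proof.
move=> ff gg i iN; rewrite !pcoM; apply: eq_bigr => j _.
by have := ltn_ord j => ji; rewrite ff ?gg //; lia.
Qed.
Lemma ps_eqmodX N f f' k : ps_eqmod N f f' -> ps_eqmod N (f ^+ k) (f' ^+ k).
Proof. by move=> ff; elim: k => [|k IH]; rewrite ?expr0 // !exprS; apply: ps_eqmodM. Qed.

Lemma pco_exp_low f k n : pco f 0 = 0 -> (n < k)%N -> pco (f ^+ k) n = 0.
Proof.
move=> f0; elim: k n => // k IH n nk; rewrite exprS pcoM big_ord_recl f0 mul0r add0r.
by rewrite big1 // => i _; rewrite IH ?mulr0 //= /bump; have := ltn_ord i; lia.
Qed.

(* The composition f(g), meaningful only when g has no constant term. *)
Definition ps_comp f g : ps := Ps (fun n => \sum_(i < n.+1) pco f i * pco (g ^+ i) n).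

Lemma pco_compE N n f g : pco g 0 = 0 -> (n <= N)%N ->
  pco (ps_comp f g) n = pco (map_poly psC (ps_trunc N f)).[g] n.
Proof.
move=> g0 nN; rewrite (@horner_coef_wide _ N.+1); last first.
  by rewrite (leq_trans (size_poly _ _)) // size_poly.
rewrite (big_morph (fun h => pco h n) (fun a b => pcoD a b n) (pco0 n)).
rewrite [LHS]/= (big_ord_widen N.+1 (fun i => pco f i * pco (g ^+ i) n)) //.
rewrite [LHS]big_mkcond; apply: eq_bigr => i _.
rewrite ltnS coef_map [pco (_ * _) n]pco_psCM coef_trunc -1?ltnS //.
by case: leqP => // ni; rewrite pco_exp_low // mulr0.
Qed.

Lemma horner_eqmod N (p q : {poly F}) g : pco g 0 = 0 ->
  (forall i, (i <= N)%N -> p`_i = q`_i) ->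
  ps_eqmod N (map_poly psC p).[g] (map_poly psC q).[g].
Proof.
move=> g0 pq n nN.
have H (r : {poly F}) : pco (map_poly psC r).[g] n = \sum_(i < n.+1) r`_i * pco (g ^+ i) n.
  rewrite (@horner_coef_wide _ (maxn n.+1 (size r))); last first.
    by rewrite (leq_trans (size_poly _ _)) // leq_maxr.
  rewrite (big_morph (fun h => pco h n) (fun a b => pcoD a b n) (pco0 n)).
  rewrite (big_ord_widen (maxn n.+1 (size r)) (fun i => r`_i * pco (g ^+ i) n)) ?leq_maxl //.
  rewrite [RHS]big_mkcond; apply: eq_bigr => i _; rewrite coef_map [pco (_ * _) n]pco_psCM ltnS.
  by case: leqP => // ni; rewrite pco_exp_low // mulr0.
by rewrite !H; apply: eq_bigr => i _; rewrite pq // (leq_trans _ nN) // -ltnS.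
Qed.

(** The coefficients of a composition up to order n see only the truncations at order n, so
    multiplicativity reduces to that of polynomial evaluation at g. *)
Lemma ps_comp_morph g : pco g 0 = 0 ->
  exists phi : {rmorphism ps -> ps}, forall f, phi f = ps_comp f g.
Proof.
move=> g0; pose phi f := ps_comp f g.
have phiB : zmod_morphism phi.
  move=> f h; apply: psP => n; rewrite pcoB /= -sumrB.
  by apply: eq_bigr => i _; rewrite mulrBl.
have phiM : monoid_morphism phi.
  split.
    apply: psP => n; rewrite /phi /= big_ord_recl /= mul1r big1 ?addr0 //.
    by move=> i _; rewrite mul0r.
  move=> f h; apply: psP => n; rewrite /phi (@pco_compE n) //.
  rewrite (@horner_eqmod n _ (ps_trunc n f * ps_trunc n h)) //.
    rewrite rmorphM hornerM; apply: ps_eqmodM (leqnn n) => i ni.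
      by rewrite (@pco_compE n).
    by rewrite (@pco_compE n).
  by move=> i ni; rewrite coef_trunc // (psM_trunc f h ni).
pose m1 := GRing.isZmodMorphism.Build _ _ phi phiB.
pose m2 := GRing.isMonoidMorphism.Build _ _ phi phiM.
pose m : {rmorphism ps -> ps} := HB.pack phi m1 m2.
by exists m.
Qed.

Lemma ps_comp_psC a g : ps_comp (psC a) g = psC a.
Proof.
apply: psP => n /=; rewrite big_ord_recl pco1 big1 ?addr0 /=.
  by case: (n == 0%N); rewrite ?mulr1 ?mulr0.
by move=> i _; rewrite mul0r.
Qed.
Lemma ps_comp_psX g : pco g 0 = 0 -> ps_comp psX g = g.
Proof.
move=> g0; apply: psP => -[|n] /=; first by rewrite big_ord1 mul0r.
rewrite big_ord_recl /= mul0r add0r big_ord_recl /= mul1r expr1 big1 ?addr0 //.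
by move=> i _; rewrite mul0r.
Qed.
(** The n-th coefficient of f(g) is [pco g 1 ^+ n] times the n-th coefficient of f plus earlier
    terms, a triangular system. This surjectivity is what inverts a change of parameter. *)
Lemma ps_comp_inj g : pco g 0 = 0 -> pco g 1 != 0 ->
  forall h, exists f, ps_comp f g = h.
Proof.
move=> g0 g1 h.
have lead n : pco (g ^+ n) n = pco g 1 ^+ n.
  elim: n => [|n IH]; first by rewrite !expr0.
  rewrite exprS pcoM big_ord_recl g0 mul0r add0r big_ord_recl /= /bump /= subSS subn0 IH.
  rewrite big1 ?addr0 -?exprS // => i _.
  by rewrite pco_exp_low ?mulr0 //= /bump /=; have := ltn_ord i; lia.
have [||f fP] := @triangular_solve F (fun (f : nat -> F) n => pco (ps_comp (Ps f) g) n)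
   (fun n => pco g 1 ^+ n) (pco h).
- by move=> n; rewrite expf_neq0.
- move=> n f f' ff /=; rewrite !big_ord_recr /= lead ![_ * pco g 1 ^+ n]mulrC !addrK.
  by apply: eq_bigr => i _; rewrite ff.
by exists (Ps f); apply: psP => n; rewrite fP.
Qed.

(** The n-th coefficient of v^e is e v0^(e-1) v_n plus terms in earlier coefficients, so the system
    is triangular once v(0) is fixed. *)
Lemma ps_root_ex (u : ps) e (v0 : F) : (e%:R != 0 :> F) -> v0 ^+ e = pco u 0 -> v0 != 0 ->
  exists v, v ^+ e = u /\ pco v 0 = v0.
Proof.
move=> e0 ve v00.
(* [fx] pins the constant coefficient to the prescribed root [v0]; the equation at n = 0 becomes a
   dummy linear one. *)
pose fx (f : nat -> F) := Ps (fun n => if n == 0%N then v0 else f n).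
have [||f fP] := @triangular_solve F
   (fun (f : nat -> F) n => if n == 0%N then f 0%N else pco (fx f ^+ e) n)
   (fun n => if n == 0%N then 1 else e%:R * v0 ^+ e.-1)
   (fun n => if n == 0%N then v0 else pco u n).
- by case=> [|n] /=; rewrite ?oner_eq0 // mulf_neq0 // expf_neq0.
- case=> [|n] f g fg; first by rewrite /= !mul1r !subrr.
  rewrite /=.
  have H k : pco (fx f ^+ k) n.+1 - k%:R * v0 ^+ k.-1 * f n.+1
           = pco (fx g ^+ k) n.+1 - k%:R * v0 ^+ k.-1 * g n.+1.
    have fxg : ps_eqmod n (fx f) (fx g).
      by case=> [|i] //= ni; rewrite fg.
    elim: k => [|k IH]; first by rewrite !expr0 !mul0r.
    rewrite !exprS !pcoM; do 2 rewrite big_ord_recl big_ord_recr; rewrite /= /bump /= !add1n !subSS subn0 subnn.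
    rewrite !pcoX0 /=.
    have -> : \sum_(i < n) f i.+1 * pco (fx f ^+ k) (n - i)%N
            = \sum_(i < n) g i.+1 * pco (fx g ^+ k) (n - i)%N.
      apply: eq_bigr => i _; congr (_ * _); first by apply: fg; rewrite ltnS ltn_ord.
      by apply: (ps_eqmodX k fxg); exact: leq_subr.
    have -> : \sum_(i < n) g (1 + i)%N * pco (fx g ^+ k) (n.+1 - (1 + i))%N
            = \sum_(i < n) g i.+1 * pco (fx g ^+ k) (n - i)%N.
      by apply: eq_bigr => i _; rewrite add1n subSS.
    move: (\sum_(i < n) _) => S.
    have -> : pco (fx f ^+ k) n.+1 = pco (fx g ^+ k) n.+1 - k%:R * v0 ^+ k.-1 * g n.+1
         + k%:R * v0 ^+ k.-1 * f n.+1 by rewrite -IH subrK.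
    case: k IH => [|k] _; first by rewrite !mul0r ?addr0 ?subr0; ring.
    move: (pco (fx g ^+ k.+1) n.+1) => y.
    by rewrite /= exprS -[k.+2]add1n natrD; ring.
  exact: H.
exists (fx f); split => //; apply: psP => -[|n]; first by rewrite pcoX0.
by have := fP n.+1.
Qed.
End PowerSeries.

(** * Formal Laurent series *)

Section FractionExtension.
Variables (D : idomainType) (L : fieldType).

Lemma repr_frac (x : {fraction D}) : x = (\n_(repr x))%:F / (\d_(repr x))%:F.
Proof.
rewrite -{1}[x]reprK; move: (repr x) => y.
have d0 : \d_y != 0 := denom_ratioP y.
apply: (canRL (mulfK _)); first by rewrite tofrac_eq0.
rewrite !piE; apply/eqmodP; rewrite /= FracField.equivfE /FracField.mulf.
by rewrite !numden_Ratio ?mulf_neq0 ?oner_neq0 // !mulr1 mulrC.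
Qed.

Lemma fracE (x : {fraction D}) : exists n d, d != 0 /\ x = n%:F / d%:F.
Proof.
by exists (\n_(repr x)), (\d_(repr x)); split; [exact: denom_ratioP | exact: repr_frac].
Qed.

Lemma frac_morph_uniq (f g : {rmorphism {fraction D} -> L}) :
  (forall x, f x%:F = g x%:F) -> f =1 g.
Proof.
by move=> fg x; have [n [d [d0 ->]]] := fracE x; rewrite !fmorph_div !fg.
Qed.

Lemma frac_ext (f : {rmorphism D -> L}) : injective f ->
  exists phi : {rmorphism {fraction D} -> L}, forall x, phi x%:F = f x.
Proof.
move=> finj; have f0 d : d != 0 -> f d != 0.
  by move=> d0; rewrite -(rmorph0 f) (inj_eq finj).
have H x : exists y, exists n d, [/\ d != 0, x = n%:F / d%:F & y = f n / f d].
  by have [n [d [d0 xE]]] := fracE x; exists (f n / f d), n, d.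
pose phi x := sval (cid (H x)).
have phiE n d : d != 0 -> phi (n%:F / d%:F) = f n / f d.
  move=> d0; rewrite /phi; case: cid => y /= [n' [d' [d'0 /eqP E ->]]].
  move: E; rewrite eqr_div ?tofrac_eq0 // -!tofracM tofrac_eq => /eqP E.
  by apply/eqP; rewrite eqr_div ?f0 // -!rmorphM E.
have phiF x : phi x%:F = f x.
  by rewrite -[x%:F]divr1 -tofrac1 phiE ?oner_neq0 // rmorph1 divr1.
have phiB : zmod_morphism phi.
  move=> x y; have [n [d [d0 ->]]] := fracE x; have [n' [d' [d'0 ->]]] := fracE y.
  rewrite -mulNr addf_div ?tofrac_eq0 // mulNr -!tofracM -tofracB !phiE ?mulf_neq0 //.
  by rewrite -[- (_ / _)]mulNr addf_div ?f0 // rmorphB !rmorphM mulNr.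
have phiM : monoid_morphism phi.
  split; first by rewrite -tofrac1 phiF rmorph1.
  move=> x y; have [n [d [d0 ->]]] := fracE x; have [n' [d' [d'0 ->]]] := fracE y.
  by rewrite mulf_div -!tofracM !phiE ?mulf_neq0 // mulf_div !rmorphM.
pose m1 := GRing.isZmodMorphism.Build _ _ phi phiB.
pose m2 := GRing.isMonoidMorphism.Build _ _ phi phiM.
pose m : {rmorphism {fraction D} -> L} := HB.pack phi m1 m2.
by exists m.
Qed.
End FractionExtension.

Section Laurent.
Variable F : fieldType.

Definition lau : fieldType := {fraction (ps F)}.
Implicit Types (x y : lau) (f g : ps F).

Definition lC : {rmorphism F -> lau} := (@FracField.tofrac _ : {rmorphism ps F -> lau}) \o @psC F.
Definition lX : lau := (psX F)%:F.

Lemma lCE a : lC a = (psC a)%:F. Proof. by []. Qed.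
Lemma lX_neq0 : lX != 0. Proof. by rewrite tofrac_eq0 psX_neq0. Qed.

Lemma lau_form x : x != 0 -> exists k m u, pco u 0 != 0 /\ x = lX ^+ k / lX ^+ m * u%:F.
Proof.
have [n [d [d0 ->]]] := fracE x; rewrite mulf_eq0 negb_or tofrac_eq0 => /andP[n0 _].
have [k [u [u0 nE]]] := ps_factor n0; have [m [v [v0 dE]]] := ps_factor d0.
have vu : v \is a GRing.unit by rewrite unit_psE.
exists k, m, (u / v); split; first by rewrite pcoM0 pcoV0 // mulf_neq0 ?invr_eq0.
have -> : (u / v)%:F = u%:F / v%:F.
  apply: (canRL (mulfK _)); last by rewrite -tofracM divrK.
  by rewrite tofrac_eq0; apply: ps_neq0 v0.
rewrite nE dE !tofracM !tofracXn mulf_div //.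
Qed.

Lemma lau_denom x : exists m f, x = f%:F / lX ^+ m.
Proof.
have [->|/lau_form [k [m [u [u0 ->]]]]] := eqVneq x 0.
  by exists 0%N, 0; rewrite tofrac0 mul0r.
exists m, (psX F ^+ k * u); rewrite tofracM tofracXn -mulrA [_^-1 * _]mulrC mulrA //.
Qed.

Lemma lau_integral x : (exists f, x = f%:F) \/ (exists f, pco f 0 = 0 /\ f != 0 /\ x = (f%:F)^-1).
Proof.
have [->|/lau_form [k [m [u [u0 ->]]]]] := eqVneq x 0; first by left; exists 0; rewrite tofrac0.
have [mk|km] := leqP m k.
  left; exists (psX F ^+ (k - m) * u).
  by rewrite tofracM tofracXn expfB_cond ?(negPf lX_neq0).
right; exists (psX F ^+ (m - k) * u^-1); split; last split.
- by rewrite pcoM0 pco_psXn eq_sym subn_eq0 leqNgt km mul0r.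
- by rewrite mulf_neq0 ?expf_neq0 ?psX_neq0 //; apply: (@ps_neq0 _ _ 0); rewrite pcoV0 ?invr_eq0.
have -> : (psX F ^+ (m - k) * u^-1)%:F = lX ^+ (m - k) / u%:F.
  have uu : u \is a GRing.unit by rewrite unit_psE.
  apply: (canRL (mulfK _)); last by rewrite -tofracM divrK // tofracXn.
  by rewrite tofrac_eq0; apply: ps_neq0 u0.
rewrite expfB_cond ?(negPf lX_neq0) ?(ltnW km) // !invfM !invrK. 
by rewrite [_ * u%:F]mulrC mulrC [(lX ^+ m)^-1 * _]mulrC.
Qed.

Lemma lsub_ex g : pco g 0 = 0 -> g != 0 ->
  exists phi : {rmorphism lau -> lau}, forall f, phi f%:F = (ps_comp f g)%:F.
Proof.
move=> g0 gn0; have [c cE] := ps_comp_morph g0.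
have cinj f : c f = 0 -> f = 0.
  apply: contra_eq => /ps_factor [k [u [u0 ->]]].
  rewrite rmorphM rmorphXn cE ps_comp_psX // mulf_neq0 ?expf_neq0 //.
  by apply: (@ps_neq0 _ _ 0); rewrite cE /= big_ord1 expr0 pco1 mulr1.
pose t : {rmorphism ps F -> lau} := (@FracField.tofrac _ : {rmorphism ps F -> lau}) \o c.
have [|phi phiE] := @frac_ext _ _ t.
  by move=> f f' /eqP; rewrite tofrac_eq -subr_eq0 -rmorphB => /eqP /cinj /eqP; rewrite subr_eq0 => /eqP.
by exists phi => f; rewrite phiE /= cE.
Qed.

(* lsub g is the substitution s := g(s). *)
Definition lsub g : {rmorphism lau -> lau} :=
  if pselect (pco g 0 = 0 /\ g != 0) is left H then sval (cid (lsub_ex H.1 H.2))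
  else (idfun : {rmorphism lau -> lau}).
Lemma lsubE g f : pco g 0 = 0 -> g != 0 -> lsub g f%:F = (ps_comp f g)%:F.
Proof.
move=> g0 gn0; rewrite /lsub; case: pselect => [H|[]//].
by case: cid => phi /= ->.
Qed.
Lemma lsub_lC g a : lsub g (lC a) = lC a.
Proof.
rewrite /lsub; case: pselect => [H|] //.
by case: cid => phi phiE; rewrite -[LHS]/(phi (psC a)%:F) phiE ps_comp_psC.
Qed.
Lemma lsub_lX g : pco g 0 = 0 -> g != 0 -> lsub g lX = g%:F.
Proof. by move=> g0 gn0; rewrite lsubE // ps_comp_psX. Qed.

Lemma psXd0 d : (0 < d)%N -> pco (psX F ^+ d) 0 = 0.
Proof. by case: d => // d _; rewrite pco_psXn. Qed.

(** Adjunction of a d-th root of the parameter: the old field of Laurent series reappears as the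
    subfield of series in s^d. *)
Definition subd d := lsub (psX F ^+ d).
Definition psd d f := Ps (fun n => if (d %| n)%N then pco f (n %/ d)%N else 0).
Lemma subdE d f : (0 < d)%N -> subd d f%:F = (psd d f)%:F.
Proof.
move=> d0; rewrite /subd lsubE ?psXd0 ?expf_neq0 ?psX_neq0 //; congr FracField.tofrac.
apply: psP => n /=; case: ifP => [/dvdnP [k ->]|nd]; last first.
  rewrite big1 // => i _; rewrite -exprM pco_psXn; case: eqP => [E|]; last by rewrite mulr0.
  by rewrite E dvdn_mulr in nd.
have kl : (k < (k * d).+1)%N by rewrite ltnS leq_pmulr.
rewrite mulnK // (bigD1 (Ordinal kl)) //= -exprM pco_psXn [(d * k)%N]mulnC eqxx mulr1.
rewrite big1 ?addr0 // => i ik; rewrite -exprM pco_psXn; case: eqP => [E|]; last by rewrite mulr0.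
case/eqP: ik; apply: val_inj => /=; apply/eqP; by rewrite -(eqn_pmul2l d0) -E mulnC.
Qed.
Lemma subd_lX d : (0 < d)%N -> subd d lX = lX ^+ d.
Proof. by move=> d0; rewrite /subd lsub_lX ?psXd0 ?expf_neq0 ?psX_neq0 // tofracXn. Qed.
Lemma subd_lC d a : subd d (lC a) = lC a. Proof. exact: lsub_lC. Qed.
Lemma subdM d e x : (0 < d)%N -> (0 < e)%N -> subd d (subd e x) = subd (d * e) x.
Proof.
move=> d0 e0; apply: (@frac_morph_uniq _ _ (subd d \o subd e) (subd (d * e)%N)) => f /=.
rewrite !subdE ?muln_gt0 ?d0 //; congr FracField.tofrac; apply: psP => n /=.
rewrite -divnMA; case: (boolP (d %| n)%N) => [/dvdnP [k ->]|nd]; last first.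
  by case: ifP => // /(dvdn_trans (dvdn_mulr e (dvdnn d))); rewrite (negPf nd).
by rewrite mulnK // [(k * d)%N]mulnC dvdn_pmul2l.
Qed.
Lemma subd1 x : subd 1 x = x.
Proof.
apply: (@frac_morph_uniq _ _ (subd 1) idfun) => f.
by rewrite subdE //; congr FracField.tofrac; apply: psP => n; rewrite /= dvd1n divn1.
Qed.

Definition psrot (z : F) f := Ps (fun n => z ^+ n * pco f n).
(** When z runs over the N-th roots of unity these substitutions act as the Galois group over the
    series in s^N. *)
Definition rot z := lsub (psC z * psX F).
Lemma rotE z f : z != 0 -> rot z f%:F = (psrot z f)%:F.
Proof.
move=> z0; have zX0 : pco (psC z * psX F) 0 = 0 by rewrite pcoM0 mulr0.
rewrite /rot lsubE //; last first.
  by apply: (@ps_neq0 _ _ 1); rewrite pco_psCM /= mulr1.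
congr FracField.tofrac; apply: psP => n /=.
rewrite big_ord_recr /= big1 => [|i _]; last first.
  by rewrite exprMn -rmorphXn pco_psCM pco_psXn gtn_eqF // !mulr0.
by rewrite add0r exprMn -rmorphXn pco_psCM pco_psXn eqxx mulr1 mulrC.
Qed.
Lemma rot_lC z a : rot z (lC a) = lC a. Proof. exact: lsub_lC. Qed.
Lemma rot_subd z N x : (0 < N)%N -> z ^+ N = 1 -> rot z (subd N x) = subd N x.
Proof.
move=> N0 zN; have z0 : z != 0.
  by apply/eqP => z0; move/eqP: zN; rewrite z0 expr0n gtn_eqF // eq_sym oner_eq0.
apply: (@frac_morph_uniq _ _ (rot z \o subd N) (subd N)) => f /=.
rewrite !subdE // rotE //; congr FracField.tofrac; apply: psP => n /=.
by case: ifP => [/dvdnP [k ->]|]; rewrite ?mulr0 // mulnC exprM zN expr1n mul1r.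
Qed.
Lemma rot1 x : rot 1 x = x.
Proof.
apply: (@frac_morph_uniq _ _ (rot 1) idfun) => f.
by rewrite rotE ?oner_neq0 //; congr FracField.tofrac; apply: psP => n; rewrite /= expr1n mul1r.
Qed.
Lemma rotM a b x : a != 0 -> b != 0 -> rot a (rot b x) = rot (a * b) x.
Proof.
move=> a0 b0; apply: (@frac_morph_uniq _ _ (rot a \o rot b) (rot (a * b))) => f /=.
rewrite !rotE ?mulf_neq0 //; congr FracField.tofrac; apply: psP => n /=.
by rewrite mulrA exprMn.
Qed.
Lemma rot_lX z : z != 0 -> rot z lX = lC z * lX.
Proof.
move=> z0; rewrite rotE // lCE -tofracM; congr FracField.tofrac; apply: psP => n.
by rewrite pco_psCM /=; case: eqP => [->|]; rewrite ?mulr0.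
Qed.
Lemma rot_subd_comm z d x : (0 < d)%N -> z != 0 -> rot z (subd d x) = subd d (rot (z ^+ d) x).
Proof.
move=> d0 z0; apply: (@frac_morph_uniq _ _ (rot z \o subd d) (subd d \o rot (z ^+ d))) => f /=.
rewrite !(subdE, rotE) ?expf_neq0 //; congr FracField.tofrac; apply: psP => n /=.
by case: ifP => [/dvdnP [k ->]|]; rewrite ?mulr0 // mulnK // -exprM mulnC.
Qed.

Definition in_subd d x := exists y, x = subd d y.

(* Exponents are shifted by a multiple of d, so this says that x is a series in s^d. *)
Lemma in_subdP d x m f : (0 < d)%N -> (d %| m)%N -> x = f%:F / lX ^+ m ->
  in_subd d x <-> (forall n, pco f n != 0 -> (d %| n)%N).
Proof.
move=> d0 /dvdnP [k mE] xE; have lXm : lX ^+ m != 0 by rewrite expf_neq0 ?lX_neq0.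
have subXk : subd d (lX ^+ k) = lX ^+ m by rewrite rmorphXn subd_lX // -exprM mulnC mE.
split=> [[y yE]|H].
  have : f%:F = subd d (y * lX ^+ k) by rewrite rmorphM -yE subXk xE divfK.
  case: (lau_integral (y * lX ^+ k)) => [[g ->]|[g [g0 [gn0 ->]]]].
    rewrite subdE // => /eqP; rewrite tofrac_eq => /eqP -> n /=.
    by case: ifP => //; rewrite eqxx.
  rewrite fmorphV subdE // => E.
  have : f * psd d g = 1.
    apply/eqP; rewrite -tofrac_eq tofracM tofrac1 E mulVf // -subdE // fmorph_eq0 tofrac_eq0 //.
  move=> /(congr1 (fun h => pco h 0)); rewrite pcoM0 pco1 /= dvdn0 div0n g0 mulr0 => /esym/eqP.
  by rewrite oner_eq0.
exists ((Ps (fun n => pco f (n * d)%N))%:F / lX ^+ k).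
rewrite fmorph_div subXk subdE // xE; congr (_%:F / _); apply: psP => n /=.
case: ifP => [/dvdnP [j ->]|nd]; first by rewrite mulnK.
by apply/eqP; apply: contraFT nd => /H.
Qed.

Lemma lau_denom_dvd x d : (0 < d)%N -> exists m f, (d %| m)%N /\ x = f%:F / lX ^+ m.
Proof.
move=> d0; have [m [f ->]] := lau_denom x.
exists (m * d)%N, (psX F ^+ (m * d - m) * f); split; first by rewrite dvdn_mull.
rewrite tofracM tofracXn -/lX; set a := (m * d - m)%N.
have -> : (m * d = a + m)%N by rewrite subnK // leq_pmulr.
by rewrite exprD -mulf_div divff ?mul1r // expf_neq0 ?lX_neq0.
Qed.

(** Exponents divisible by a and by b are divisible by the lcm. This intersection of subfields is
    what closes splitting exponents under gcd. *)
Lemma in_subd_lcm a b x : (0 < a)%N -> (0 < b)%N -> in_subd a x -> in_subd b x ->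
  in_subd (lcmn a b) x.
Proof.
move=> a0 b0 ha hb; have l0 : (0 < lcmn a b)%N by rewrite lcmn_gt0 a0.
have [m [f [dm xE]]] := lau_denom_dvd x l0.
move/(in_subdP a0 (dvdn_trans (dvdn_lcml a b) dm) xE): ha => ha.
move/(in_subdP b0 (dvdn_trans (dvdn_lcmr a b) dm) xE): hb => hb.
by apply/(in_subdP l0 dm xE) => n fn; rewrite dvdn_lcm ha ?hb.
Qed.

Lemma rot_fixed z k x : k.-primitive_root z -> rot z x = x -> in_subd k x.
Proof.
move=> zk zx; have k0 := prim_order_gt0 zk.
have z0 : z != 0.
  by apply/eqP => z0; have := prim_expr_order zk; rewrite z0 expr0n gtn_eqF // => /eqP; rewrite eq_sym oner_eq0.
have [m [f [dm xE]]] := lau_denom_dvd x k0.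
apply/(in_subdP k0 dm xE) => n fn.
have : rot z f%:F = f%:F.
  have -> : f%:F = x * lX ^+ m by rewrite xE divfK // expf_neq0 ?lX_neq0.
  rewrite rmorphM zx rmorphXn rot_lX // exprMn -rmorphXn.
  have -> : z ^+ m = 1 by apply/eqP; rewrite -(prim_order_dvd zk).
  by rewrite rmorph1 mul1r.
rewrite rotE // => /eqP; rewrite tofrac_eq => /eqP /(congr1 (fun h => pco h n)) /= /eqP.
rewrite -{2}[pco f n]mul1r (inj_eq (mulIf fn)) => /eqP zn.
by rewrite (prim_order_dvd zk) zn.
Qed.
End Laurent.
Arguments subd {F}.
Arguments in_subd {F}.

(** * Points of the sphere over C((s)) *)

Section LocalTypes.
Variable F : numClosedFieldType.
Local Notation K := (lau F).
Implicit Types (x y : K) (f g u v : ps F) (w : option F).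

(* The point of the line over K at local coordinate y near w. *)
Definition near_pt w y : K := match w with Some c => lC F c + y | None => y^-1 end.

Lemma near_pt_inj w : injective (near_pt w).
Proof. by case: w => [c|] x y /=; [apply: addrI | apply: invr_inj]. Qed.

Lemma near_pt_map (phi : {rmorphism K -> K}) w y : (forall a, phi (lC F a) = lC F a) ->
  phi (near_pt w y) = near_pt w (phi y).
Proof. by move=> phiC; case: w => [c|] /=; rewrite ?fmorphV // rmorphD phiC. Qed.

Lemma lX_unit_map (phi : {rmorphism K -> K}) k x : phi (lX F ^+ k * x) = phi (lX F) ^+ k * phi x.
Proof. by rewrite rmorphM rmorphXn. Qed.

(** A point of the sphere over Laurent series that specializes to w at s = 0 with contact order k;
    local degrees will be ratios of such orders. *)
Definition ltype w (k : nat) x :=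
  exists u, pco u 0 != 0 /\ x = near_pt w (lX F ^+ k * u%:F).

Definition loc w (e : nat) : K := near_pt w (lX F ^+ e).

Lemma ltype_loc w e : ltype w e (loc w e).
Proof. by exists 1; rewrite pco1 oner_eq0 tofrac1 mulr1. Qed.

Lemma pco0_neq0 u : pco u 0 != 0 -> u%:F != 0.
Proof. by move=> u0; rewrite tofrac_eq0; apply: ps_neq0 u0. Qed.

Lemma ltype_subd w k d x : (0 < d)%N -> ltype w k x -> ltype w (d * k) (subd d x).
Proof.
move=> d0 [u [u0 ->]]; exists (psd d u); split; first by rewrite /= dvdn0 div0n.
rewrite near_pt_map; last exact: subd_lC.
by rewrite lX_unit_map subd_lX // subdE // exprM.
Qed.

Lemma rot_lX_unit z k u : z != 0 ->
  rot z (lX F ^+ k * u%:F) = lX F ^+ k * (psC (z ^+ k) * psrot z u)%:F.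
Proof.
move=> z0; rewrite lX_unit_map rot_lX // rotE // exprMn tofracM -[(psC _)%:F]/(lC F _).
by rewrite (rmorphXn (lC F)) [RHS]mulrCA mulrA.
Qed.

Lemma ltype_rot w k z x : z != 0 -> ltype w k x -> ltype w k (rot z x).
Proof.
move=> z0 [u [u0 ->]]; exists (psC (z ^+ k) * psrot z u).
split; first by rewrite pcoM0 /= expr0 mul1r mulf_neq0 ?expf_neq0.
rewrite near_pt_map; last exact: rot_lC.
by rewrite rot_lX_unit.
Qed.

Lemma subd_loc w d e : (0 < d)%N -> subd d (loc w e) = loc w (d * e).
Proof.
move=> d0; rewrite /loc near_pt_map; last exact: subd_lC.
by rewrite (rmorphXn (subd d)) subd_lX // exprM.
Qed.
Lemma rot_loc w N z : (0 < N)%N -> z ^+ N = 1 -> rot z (loc w N) = loc w N.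
Proof. by move=> N0 zN; rewrite -[N]muln1 -subd_loc // rot_subd. Qed.

Lemma lX_cancel k u v : lX F ^+ k * u%:F = lX F ^+ k * v%:F -> u = v.
Proof.
by move=> /(mulfI (expf_neq0 k (lX_neq0 F))) /eqP; rewrite tofrac_eq => /eqP.
Qed.

(** Rotation by z multiplies the leading coefficient of the local coordinate by z^k. *)
Lemma ltype_rot_fixed w k z x : z != 0 -> ltype w k x -> rot z x = x -> z ^+ k = 1.
Proof.
move=> z0 [u [u0 ->]]; rewrite near_pt_map; last exact: rot_lC.
move=> /near_pt_inj; rewrite rot_lX_unit // => /lX_cancel /(congr1 (fun f => pco f 0)).
rewrite pcoM0 /= expr0 mul1r -{2}[pco u 0]mul1r => /(mulIf u0) //.
Qed.

Lemma lX_unit_exp a b u v : pco u 0 != 0 -> pco v 0 != 0 ->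
  lX F ^+ a * u%:F = lX F ^+ b * v%:F -> a = b.
Proof.
move=> u0 v0; rewrite -!tofracXn -!tofracM => /eqP; rewrite tofrac_eq => /eqP E.
have Ha := congr1 (fun f => pco f a) E; have Hb := congr1 (fun f => pco f b) E.
apply/eqP; rewrite eqn_leq; apply/andP; split.
  move: Hb; rewrite !pco_psXnM leqnn subnn; case: leqP => // _ /esym/eqP.
  by rewrite (negPf v0).
move: Ha; rewrite !pco_psXnM leqnn subnn; case: leqP => // _ /eqP.
by rewrite (negPf u0).
Qed.

Lemma pcoXM0 k u : (0 < k)%N -> pco (psX F ^+ k * u) 0 = 0.
Proof. by move=> k0; rewrite pco_psXnM leqNgt k0. Qed.

Lemma near_pt_fin c k u : near_pt (Some c) (lX F ^+ k * u%:F) = (psC c + psX F ^+ k * u)%:F.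
Proof. by rewrite tofracD tofracM tofracXn. Qed.

Lemma near_pt_inf_nint m v f : (0 < m)%N -> pco v 0 != 0 ->
  near_pt None (lX F ^+ m * v%:F) != f%:F.
Proof.
move=> m0 v0; apply/eqP => E; have : psX F ^+ m * v * f = 1.
  apply/eqP; rewrite -tofrac_eq tofrac1 !tofracM tofracXn -E mulfV //.
  by rewrite mulf_neq0 ?expf_neq0 ?lX_neq0 ?pco0_neq0.
move=> /(congr1 (fun f => pco f 0)); rewrite pcoM0 pcoXM0 // mul0r pco1 => /eqP.
by rewrite eq_sym oner_eq0.
Qed.

Lemma ltype_uniq w w' k k' x : (0 < k)%N -> (0 < k')%N ->
  ltype w k x -> ltype w' k' x -> w = w' /\ k = k'.
Proof.
move=> k0 k'0 [u [u0 xE]] [u' [u'0 xE']].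
have ww : w = w'.
  case: w xE => [c|] xE; case: w' xE' => [c'|] xE' //.
  - move: xE'; rewrite xE !near_pt_fin => /eqP; rewrite tofrac_eq => /eqP /(congr1 (fun f => pco f 0)).
    by rewrite !pcoD !pcoXM0 //= !addr0 => ->.
  - by have /eqP[] := near_pt_inf_nint (psC c + psX F ^+ k * u) k'0 u'0; rewrite -near_pt_fin -xE.
  - by have /eqP[] := near_pt_inf_nint (psC c' + psX F ^+ k' * u') k0 u0; rewrite -near_pt_fin -xE'.
split=> //; move: xE'; rewrite xE ww => /near_pt_inj; exact: lX_unit_exp.
Qed.

Definition lau_auto (tau tau' : {rmorphism K -> K}) :=
  [/\ cancel tau tau', cancel tau' tau,
      (forall a, tau (lC F a) = lC F a) /\ (forall a, tau' (lC F a) = lC F a),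
      (forall w k x, ltype w k x -> ltype w k (tau x)) &
      (forall w k x, ltype w k x -> ltype w k (tau' x))].

(** The change of parameter s := s v with v a unit; its inverse comes from surjectivity of
    composition with a series of order one. *)
Lemma lau_auto_ex v : pco v 0 != 0 ->
  exists tau tau', lau_auto tau tau' /\ tau (lX F) = lX F * v%:F.
Proof.
move=> v0; pose g := psX F * v.
have g0 : pco g 0 = 0 by rewrite /g pcoM0 mul0r.
have gn0 : g != 0 by rewrite mulf_neq0 ?psX_neq0 //; apply: ps_neq0 v0.
have g1 : pco g 1 != 0 by rewrite /g -[psX F]expr1 pco_psXnM.
pose tau := lsub g.
have tauX : tau (lX F) = lX F * v%:F by rewrite /tau lsub_lX // tofracM.
have tauE f : tau f%:F = (ps_comp f g)%:F by rewrite /tau lsubE.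
have comp0 f : pco (ps_comp f g) 0 = pco f 0 by rewrite /= big_ord1 expr0 pco1 mulr1.
have surj x : exists y, tau y = x.
  have [n [d [d0 ->]]] := fracE x.
  have [n' <-] := ps_comp_inj g0 g1 n; have [d' <-] := ps_comp_inj g0 g1 d.
  by exists (n'%:F / d'%:F); rewrite fmorph_div !tauE.
pose t x := sval (cid (surj x)).
have tK : cancel t tau by move=> x; rewrite /t; case: cid.
have Kt : cancel tau t by move=> x; apply: (fmorph_inj tau); rewrite tK.
have tB := can2_zmod_morphism Kt tK.
have tM := can2_monoid_morphism Kt tK.
pose m1 := GRing.isZmodMorphism.Build _ _ t tB.
pose m2 := GRing.isMonoidMorphism.Build _ _ t tM.
pose tau' : {rmorphism K -> K} := HB.pack t m1 m2.
have tau'K : cancel tau' tau by [].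
have tau'C a : tau' (lC F a) = lC F a by apply: (fmorph_inj tau); rewrite tau'K /tau lsub_lC.
have tau'u u : exists u', tau' u%:F = u'%:F /\ pco u' 0 = pco u 0.
  have [u' <-] := ps_comp_inj g0 g1 u; exists u'; split; last by rewrite comp0.
  by apply: (fmorph_inj tau); rewrite tau'K tauE.
(* The inverse sends s to s^(k+1) times a unit; applying [tau] again and comparing orders forces k =
   0. *)
have [v' [v'0 tau'X]] : exists v', pco v' 0 != 0 /\ tau' (lX F) = lX F * v'%:F.
  have [h hE] := ps_comp_inj g0 g1 (psX F).
  have h0 : pco h 0 = 0 by rewrite -comp0 hE.
  have X0 : psX F != 0 := psX_neq0 F.
  have hn0 : h != 0.
    apply: contraNneq X0 => h00; rewrite -hE h00; apply/eqP; apply: psP => n /=.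
    by rewrite big1 // => i _; rewrite mul0r.
  have [[|k] [v' [v'0 hE']]] := ps_factor hn0.
    by move: h0 v'0; rewrite hE' expr0 mul1r => ->; rewrite eqxx.
  have tX : tau' (lX F) = lX F ^+ k.+1 * v'%:F.
    apply: (fmorph_inj tau); rewrite tau'K lX_unit_map.
    by rewrite -(lX_unit_map tau) -tofracXn -tofracM -hE' tauE hE.
  exists v'; split => //; rewrite tX; congr (_ * _).
  have E : lX F ^+ 1 * (1 : ps F)%:F = lX F ^+ k.+1 * (v ^+ k.+1 * ps_comp v' g)%:F.
    by rewrite tofrac1 mulr1 expr1 -[LHS]tau'K tX lX_unit_map tauX tauE exprMn tofracM tofracXn mulrA.
  rewrite -(lX_unit_exp _ _ E) // ?pco1 ?oner_eq0 //.
  by rewrite pcoM0 pcoX0 comp0 mulf_neq0 ?expf_neq0.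
exists tau, tau'; split; last by [].
split => //; first by split=> a; rewrite ?tau'C // /tau lsub_lC.
  move=> w k x [u [u0 ->]]; exists (v ^+ k * ps_comp u g).
  split; first by rewrite pcoM0 pcoX0 comp0 mulf_neq0 ?expf_neq0.
  rewrite near_pt_map; last exact: lsub_lC.
  by rewrite lX_unit_map tauX tauE exprMn tofracM tofracXn mulrA.
move=> w k x [u [u0 ->]]; have [u' [uE u'0]] := tau'u u; exists (v' ^+ k * u').
split; first by rewrite pcoM0 pcoX0 u'0 mulf_neq0 ?expf_neq0.
by rewrite near_pt_map // lX_unit_map tau'X uE exprMn tofracM tofracXn mulrA.
Qed.

(** A k-th root of the unit factor is absorbed into the parameter, so all points of one type are
    conjugate to the standard one. *)
Lemma ltype_auto w k x : (0 < k)%N -> ltype w k x ->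
  exists tau tau', lau_auto tau tau' /\ tau (loc w k) = x.
Proof.
move=> k0 [u [u0 xE]].
have [|||v [vE v0]] := @ps_root_ex F u k (k.-root (pco u 0)).
- by rewrite pnatr_eq0 -lt0n.
- by rewrite rootCK.
- by rewrite rootC_eq0.
have vn0 : pco v 0 != 0 by rewrite v0 rootC_eq0.
have [tau [tau' [H tX]]] := lau_auto_ex vn0; exists tau, tau'; split => //.
have [_ _ [tC _] _ _] := H.
by rewrite /loc near_pt_map // (rmorphXn tau) tX exprMn -[v%:F ^+ _]tofracXn vE xE.
Qed.

Fact pco0_zmod : zmod_morphism (fun f : ps F => pco f 0). Proof. by []. Qed.
Fact pco0_monoid : monoid_morphism (fun f : ps F => pco f 0).
Proof. by split=> // f g; rewrite pcoM0. Qed.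
Definition ps_eval0 (f : ps F) : F := pco f 0.
HB.instance Definition _ := GRing.isZmodMorphism.Build (ps F) F ps_eval0 pco0_zmod.
HB.instance Definition _ := GRing.isMonoidMorphism.Build (ps F) F ps_eval0 pco0_monoid.

Lemma pco0_horner (p : {poly F}) f : pco (map_poly (@psC F) p).[f] 0 = p.[pco f 0].
Proof.
rewrite -[LHS]/(ps_eval0 _) -horner_map -map_poly_comp /=.
by rewrite (eq_map_poly (g := idfun)) ?map_poly_id.
Qed.

Lemma horner_psF (p : {poly F}) f : (map_poly (lC F) p).[f%:F] = ((map_poly (@psC F) p).[f])%:F.
Proof. by rewrite -horner_map -map_poly_comp. Qed.

Lemma mup_factor (c : F) (p : {poly F}) : p != 0 ->
  exists q, q.[c] != 0 /\ p = ('X - c%:P) ^+ (mup c p) * q.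
Proof.
move=> p0; have : (mup c p <= mup c p)%N := leqnn _.
rewrite (mup_geq c _ p0) => /dvdpP [q qE]; exists q; split; last by rewrite mulrC.
have : ~~ (mup c p < mup c p)%N by rewrite ltnn.
rewrite (mup_geq c _ p0) [X in _ %| X]qE exprS dvdp_mul2r ?expf_neq0 ?polyXsubC_eq0 //.
by rewrite dvdp_XsubCl.
Qed.

Lemma horner_ltype_fin (c : F) k u (p : {poly F}) : (0 < k)%N -> pco u 0 != 0 -> p != 0 ->
  exists u', [/\ pco u' 0 != 0 &
    (map_poly (lC F) p).[near_pt (Some c) (lX F ^+ k * u%:F)] = lX F ^+ (k * mup c p) * u'%:F].
Proof.
move=> k0 u0 p0; have [q [qc pE]] := mup_factor c p0; set n := mup c p in pE *.
pose f := psC c + psX F ^+ k * u.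
exists (u ^+ n * (map_poly (@psC F) q).[f]); split.
  rewrite pcoM0 pcoX0 pco0_horner mulf_neq0 ?expf_neq0 //.
  by rewrite pcoD pcoXM0 // addr0.
have fE : near_pt (Some c) (lX F ^+ k * u%:F) = f%:F by rewrite tofracD tofracM tofracXn.
rewrite fE horner_psF pE rmorphM rmorphXn rmorphB /= map_polyX map_polyC hornerM horner_exp hornerXsubC.
by rewrite addrAC subrr add0r exprMn -exprM -mulrA tofracM tofracXn.
Qed.

Lemma horner_ltype_inf k u (p : {poly F}) : (0 < k)%N -> pco u 0 != 0 -> p != 0 ->
  exists u', [/\ pco u' 0 != 0 &
    (map_poly (lC F) p).[near_pt None (lX F ^+ k * u%:F)] = u'%:F / lX F ^+ (k * (size p).-1)].
Proof.
move=> k0 u0 p0; set n := (size p).-1.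
pose f := psX F ^+ k * u; pose q : {poly F} := \poly_(i < n.+1) p`_(n - i).
have sp : size p = n.+1 by rewrite prednK // lt0n size_poly_eq0.
have fF : f%:F = lX F ^+ k * u%:F by rewrite tofracM tofracXn.
have f0 : f%:F != 0 by rewrite fF mulf_neq0 ?expf_neq0 ?lX_neq0 ?pco0_neq0.
have uu : u ^+ n \is a GRing.unit by rewrite unit_psE pcoX0 expf_neq0.
exists ((map_poly (@psC F) q).[f] / u ^+ n); split.
  rewrite pcoM0 pcoV0 ?pcoX0 ?expf_neq0 // mulf_neq0 ?invr_eq0 ?expf_neq0 // pco0_horner.
  by rewrite pcoXM0 // horner_coef0 coef_poly subn0 -lead_coefE lead_coef_eq0.
have -> : ((map_poly (@psC F) q).[f] / u ^+ n)%:F = (map_poly (lC F) q).[f%:F] / u%:F ^+ n.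
  rewrite horner_psF; apply: (canRL (mulfK _)); first by rewrite expf_neq0 ?pco0_neq0.
  by rewrite -tofracXn -tofracM divrK.
rewrite [near_pt _ _]/= exprM -mulrA -invfM -exprMn [u%:F * _]mulrC -fF.
apply: (canRL (mulfK _)); first by rewrite expf_neq0.
rewrite (@horner_coef_wide _ n.+1 (map_poly (lC F) p)); last by rewrite size_map_poly sp.
rewrite (@horner_coef_wide _ n.+1 (map_poly (lC F) q)); last by rewrite size_map_poly size_poly.
rewrite mulr_suml (reindex_inj rev_ord_inj) /=; apply: eq_bigr => i _.
have ni : (i <= n)%N by rewrite -ltnS.
rewrite !coef_map coef_poly ltn_ord subSS -mulrA; congr (_ * _).
rewrite -[in X in _ * X](subnK ni) exprD mulrA exprVn mulVf ?mul1r //.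
by rewrite expf_neq0.
Qed.

Lemma ltype_transc w k x (p : {poly F}) : (0 < k)%N -> ltype w k x -> p != 0 ->
  (map_poly (lC F) p).[x] != 0.
Proof.
move=> k0 [u [u0 ->]] p0; case: w => [c|].
  have [u' [u'0 ->]] := horner_ltype_fin c k0 u0 p0.
  by rewrite mulf_neq0 ?expf_neq0 ?lX_neq0 ?pco0_neq0.
have [u' [u'0 ->]] := horner_ltype_inf k0 u0 p0.
by rewrite mulf_neq0 ?invr_eq0 ?expf_neq0 ?lX_neq0 ?pco0_neq0.
Qed.
End LocalTypes.

(** * Rational functions as endomorphisms of C(z) *)

Section RationalFunctions.
Variable R : realType.
Local Notation C := R[i].
Local Notation K := (lau C).
Implicit Types (f g h : ratf R) (p q : {poly C}) (a c : C) (z w : option C).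

Definition rC : {rmorphism C -> ratf R} :=
  (@FracField.tofrac _ : {rmorphism {poly C} -> {fraction {poly C}}}) \o @polyC C.
Lemma rCE a : rC a = a%:P%:F. Proof. by []. Qed.

Lemma rden_neq0 f : rden f != 0.
Proof.
rewrite /rden dvdp_div_eq0 ?dvdp_gcdr //; exact: denom_ratioP.
Qed.
Lemma coprime_rnum_rden f : coprimep (rnum f) (rden f).
Proof. by apply: coprimep_div_gcd; rewrite denom_ratioP orbT. Qed.
Lemma ratfE f : f = (rnum f)%:F / (rden f)%:F.
Proof.
rewrite {1}[f]repr_frac /rnum /rden; set n := \n_ _; set d := \d_ _.
have d0 : d != 0 by exact: denom_ratioP.
have g0 : gcdp n d != 0 by rewrite gcdp_eq0 (negPf d0) andbF.
apply/eqP; rewrite eqr_div ?tofrac_eq0 ?dvdp_div_eq0 ?dvdp_gcdr //.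
rewrite -!tofracM tofrac_eq.
rewrite -[X in X * _ == _](divpK (dvdp_gcdl n d)) -[X in _ == _ * X](divpK (dvdp_gcdr n d)).
by rewrite mulrAC mulrA.
Qed.

Lemma ratf_reduced p q : q != 0 -> coprimep p q ->
  exists c, [/\ c != 0, rnum (p%:F / q%:F) = c *: p & rden (p%:F / q%:F) = c *: q].
Proof.
move=> q0 pq; set f := _ / _.
have E : p * rden f = rnum f * q.
  apply/eqP; rewrite -tofrac_eq !tofracM.
  by rewrite -eqr_div ?tofrac_eq0 ?rden_neq0 // -ratfE.
have dq : rden f %| q.
  have := dvdp_mull p (dvdpp (rden f)); rewrite E.
  by rewrite Gauss_dvdpr // coprimep_sym coprime_rnum_rden.
have qd : q %| rden f.
  have := dvdp_mull (rnum f) (dvdpp q); rewrite -E.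
  by rewrite Gauss_dvdpr // coprimep_sym.
have /eqpf_eq[c c0 cE] : rden f %= q by rewrite /eqp dq.
exists c; split => //; apply: (mulIf q0).
by rewrite -E cE -scalerAr scalerAl.
Qed.

Lemma size_ratf_reduced p q : q != 0 -> coprimep p q ->
  (size (rnum (p%:F / q%:F)) = size p) * (size (rden (p%:F / q%:F)) = size q).
Proof.
by move=> q0 pq; have [c [c0 -> ->]] := ratf_reduced q0 pq; rewrite !size_scale.
Qed.

Lemma rdeg_reduced p q : q != 0 -> coprimep p q ->
  rdeg (p%:F / q%:F) = (maxn (size p) (size q)).-1.
Proof. by move=> q0 pq; rewrite /rdeg !size_ratf_reduced. Qed.

Definition nonconst f := (0 < rdeg f)%N.

Lemma rC_const a : ~~ nonconst (rC a).
Proof.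
rewrite /nonconst rCE -[a%:P%:F]divr1 -tofrac1 rdeg_reduced ?oner_neq0 ?coprimep1 //.
by rewrite size_poly1 size_polyC; case: (a != 0).
Qed.
Lemma nonconstP f : reflect (exists a, f = rC a) (~~ nonconst f).
Proof.
apply: (iffP idP) => [|[a ->]]; last exact: rC_const.
rewrite /nonconst /rdeg -leqNgt leqn0 -subn1 subn_eq0 geq_max => /andP[/size1_polyC pE /size1_polyC qE].
exists ((rnum f)`_0 / (rden f)`_0); rewrite {1}[f]ratfE {1}pE {1}qE.
by rewrite fmorph_div.
Qed.
Lemma nonconst_neq f a : nonconst f -> f != rC a.
Proof. by apply: contraTneq => ->; exact: rC_const. Qed.

Lemma idr_rdeg : rdeg (idr R) = 1%N.
Proof.
rewrite /idr -['X%:F]divr1 -tofrac1 rdeg_reduced ?oner_neq0 ?coprimep1 //.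
by rewrite size_polyX size_poly1.
Qed.
Lemma nonconst_idr : nonconst (idr R). Proof. by rewrite /nonconst idr_rdeg. Qed.

Section Embedding.
Variables (L : fieldType) (iota : {rmorphism C -> L}).

Definition emb (phi : {rmorphism ratf R -> L}) (t : L) :=
  (forall a, phi (rC a) = iota a) /\ phi (idr R) = t.

Lemma emb_poly phi t p : emb phi t -> phi p%:F = (map_poly iota p).[t].
Proof.
case=> phiC phiX; elim/poly_ind: p => [|p a IH]; first by rewrite !rmorph0 horner0.
rewrite tofracD tofracM rmorphD rmorphM IH -[('X)%:F]/(idr R) phiX -[a%:P%:F]/(rC a) phiC.
by rewrite rmorphD rmorphM /= map_polyX map_polyC hornerMXaddC.
Qed.

Lemma embE phi t f : emb phi t ->
  phi f = (map_poly iota (rnum f)).[t] / (map_poly iota (rden f)).[t].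
Proof. by move=> ph; rewrite {1}[f]ratfE fmorph_div !(emb_poly _ ph). Qed.

Lemma emb_uniq phi psi t : emb phi t -> emb psi t -> phi =1 psi.
Proof. by move=> ph ps f; rewrite (embE _ ph) (embE _ ps). Qed.

Definition transc t := forall p, p != 0 -> (map_poly iota p).[t] != 0.

Lemma emb_ex t : transc t -> exists phi, emb phi t.
Proof.
move=> tr; pose f : {rmorphism {poly C} -> L} :=
  (horner_eval t : {rmorphism {poly L} -> L}) \o (map_poly iota : {rmorphism {poly C} -> {poly L}}).
have [|phi phiE] := @frac_ext _ _ f.
  move=> p q /eqP; rewrite -subr_eq0 -rmorphB => H; apply/eqP; rewrite -subr_eq0.
  by apply: contraTT H => /tr.
exists phi; split=> [a|]; first by rewrite rCE phiE /= map_polyC /horner_eval hornerC.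
by rewrite /idr phiE /= map_polyX /horner_eval hornerX.
Qed.
End Embedding.

Lemma poly_prod_roots p : p = lead_coef p *: \prod_(a <- sval (closed_field_poly_normal p)) ('X - a%:P).
Proof. exact: (svalP (closed_field_poly_normal p)). Qed.

Lemma nonconst_transc g : nonconst g -> transc rC g.
Proof.
move=> gn p p0; rewrite [p]poly_prod_roots -mul_polyC rmorphM rmorph_prod hornerM horner_prod.
rewrite /= map_polyC hornerC mulf_neq0 ?fmorph_eq0 ?lead_coef_eq0 //.
rewrite prodf_seq_neq0; apply/allP => a _ /=.
by rewrite rmorphB /= map_polyX map_polyC hornerXsubC subr_eq0; exact: nonconst_neq.
Qed.

(* Composition on the right with g, as a field endomorphism (the identity if g is constant). *)
Definition compm g : {rmorphism ratf R -> ratf R} :=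
  if pselect (nonconst g) is left H then sval (cid (emb_ex (nonconst_transc H))) else idfun.
Lemma emb_compm g : nonconst g -> emb rC (compm g) g.
Proof. by move=> gn; rewrite /compm; case: pselect => // H; case: cid. Qed.
Lemma compmE g f : nonconst g -> compm g f = rcomp f g.
Proof. by move=> /emb_compm/embE ->. Qed.
Lemma compm_rC g a : compm g (rC a) = rC a.
Proof. by rewrite /compm; case: pselect => // H; case: cid => phi []. Qed.

Lemma rcomp_rC g a : nonconst g -> rcomp (rC a) g = rC a.
Proof. by move=> gn; rewrite -compmE // compm_rC. Qed.
Lemma rcomp_idl g : nonconst g -> rcomp (idr R) g = g.
Proof. by move=> gn; rewrite -compmE // (emb_compm gn).2. Qed.
Lemma rcomp_idr f : rcomp f (idr R) = f.
Proof.
rewrite -compmE ?nonconst_idr //.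
by rewrite (emb_uniq (psi := idfun) (emb_compm nonconst_idr)) //; split.
Qed.
Lemma nonconst_comp f g : nonconst f -> nonconst g -> nonconst (rcomp f g).
Proof.
move=> fn gn; apply: contraTT (fn) => /nonconstP [a].
by rewrite -compmE // -(compm_rC g a) => /fmorph_inj ->; exact: rC_const.
Qed.
Lemma rcompA f g h : nonconst g -> nonconst h ->
  rcomp f (rcomp g h) = rcomp (rcomp f g) h.
Proof.
move=> gn hn; have ghn := nonconst_comp gn hn.
rewrite -compmE // -[in RHS]compmE // -[in RHS]compmE //.
apply: (emb_uniq (psi := compm h \o compm g) (emb_compm ghn)); split=> [a|] /=.
  by rewrite !compm_rC.
by rewrite (emb_compm gn).2 compmE.
Qed.
Lemma rcomp_inj g : nonconst g -> injective (fun f => rcomp f g).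
Proof. by move=> gn f f' /=; rewrite -!compmE //; apply: fmorph_inj. Qed.

Lemma iterc_nonconst f d : nonconst f -> nonconst (iterc f d).
Proof.
by move=> fn; elim: d => [|d IH]; [exact: nonconst_idr | exact: nonconst_comp].
Qed.
Lemma iterc_add f d e : nonconst f -> iterc f (d + e) = rcomp (iterc f d) (iterc f e).
Proof.
move=> fn; elim: d => [|d IH]; first by rewrite rcomp_idl // iterc_nonconst.
by rewrite addSn /iterc /= -!/(iterc _ _) IH rcompA ?iterc_nonconst.
Qed.
Lemma iterc1 f : iterc f 1 = f. Proof. exact: rcomp_idr. Qed.

Lemma ltype_transc_emb w k (t : K) : (0 < k)%N -> ltype w k t -> transc (lC C) t.
Proof. by move=> k0 tt p; apply: ltype_transc tt. Qed.

Lemma coprimep_root p q a : coprimep p q -> q.[a] = 0 -> p.[a] != 0.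
Proof.
by move=> pq qa; rewrite coprimep_sym in pq; have := coprimep_root pq; apply; apply/rootP.
Qed.

Lemma fib_poly_neq0 f w : nonconst f -> fib_poly f w != 0.
Proof.
move=> fn; case: w => [c|] /=; last exact: rden_neq0.
apply: contraTneq fn => /eqP; rewrite subr_eq0 => /eqP E; apply/nonconstP; exists c.
by rewrite {1}[f]ratfE E -mul_polyC tofracM mulfK ?tofrac_eq0 ?rden_neq0.
Qed.

Lemma size_fib_poly f w : (size (fib_poly f w) <= (rdeg f).+1)%N.
Proof.
have N i j : (0 < j)%N -> (maxn i j <= (maxn i j).-1.+1)%N by lia.
have Hr := N (size (rnum f)) (size (rden f)); rewrite size_poly_gt0 rden_neq0 in Hr.
case: w => [c|] /=; rewrite /rdeg (leq_trans _ (Hr _)) ?leq_maxr //.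
rewrite (leq_trans (size_polyD _ _)) // geq_max leq_maxl size_polyN.
by rewrite (leq_trans (size_scale_leq _ _)) ?leq_maxr.
Qed.

(* The local degree is the order of f - f(z) in a local coordinate at z. *)
Lemma ltype_ratf phi z k t f : (0 < k)%N -> nonconst f -> emb (lC C) phi t -> ltype z k t ->
  (0 < locdeg f z)%N /\ ltype (evalr f z) (k * locdeg f z) (phi f).
Proof.
move=> k0 fn ph [u [u0 tE]]; have fw0 w := fib_poly_neq0 w fn.
have pol p : phi p%:F = (map_poly (lC C) p).[t] by exact: emb_poly ph.
have pn0 p : p != 0 -> phi p%:F != 0 by rewrite fmorph_eq0 tofrac_eq0.
have fE : phi f = phi (rnum f)%:F / phi (rden f)%:F by rewrite {1}[f]ratfE fmorph_div.
have fcE c : phi f = lC C c + phi (fib_poly f (Some c))%:F / phi (rden f)%:F.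
  rewrite /= tofracB -mul_polyC tofracM rmorphB rmorphM mulrBl mulfK ?pn0 ?rden_neq0 //.
  by rewrite -[c%:P%:F]/(rC c) ph.1 -fE addrC subrK.
case: z tE => [z|] tE; rewrite /evalr /=.
- have val p : p != 0 -> exists v, pco v 0 != 0 /\ phi p%:F = lX C ^+ (k * mup z p) * v%:F.
    by move=> p0; have [v [v0 E]] := horner_ltype_fin z k0 u0 p0; exists v; rewrite pol tE E.
  have mup0 p : p.[z] != 0 -> mup z p = 0%N by move=> pz; apply: mupNroot.
  case: eqP => [qz|/eqP qz] /=.
    have pz := coprimep_root (coprime_rnum_rden f) qz.
    have pf0 : rnum f != 0 by apply: contraNneq pz => ->; rewrite horner0.
    split; first by rewrite -XsubC_dvd ?rden_neq0 // dvdp_XsubCl; apply/rootP.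
    have [v [v0 vE]] := val _ (rden_neq0 f); have [v' [v'0 v'E]] := val _ pf0.
    exists (v / v'); split; first by rewrite pcoM0 pcoV0 ?mulf_neq0 ?invr_eq0.
    have vv : (v / v')%:F = v%:F / v'%:F.
      apply: (canRL (mulfK _)); first exact: pco0_neq0.
      by rewrite -tofracM divrK // unit_psE.
    by rewrite /= fE vE v'E mup0 // muln0 expr0 mul1r vv mulrA invf_div.
  set c := _ / _; have fwn := fw0 (Some c); split.
    rewrite -XsubC_dvd // dvdp_XsubCl; apply/rootP.
    by rewrite /= hornerD hornerN hornerZ /c divfK // subrr.
  have [v [v0 vE]] := val _ (rden_neq0 f); have [v' [v'0 v'E]] := val _ fwn.
  exists (v' / v); split; first by rewrite pcoM0 pcoV0 ?mulf_neq0 ?invr_eq0.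
  have vv : (v' / v)%:F = v'%:F / v%:F.
    apply: (canRL (mulfK _)); first exact: pco0_neq0.
    by rewrite -tofracM divrK // unit_psE.
  by rewrite /= (fcE c) vE v'E (mup0 (rden f)) // muln0 expr0 mul1r vv mulrA.
- have val p : p != 0 -> exists v, pco v 0 != 0 /\ phi p%:F = v%:F / lX C ^+ (k * (size p).-1).
    by move=> p0; have [v [v0 E]] := horner_ltype_inf k0 u0 p0; exists v; rewrite pol tE E.
  have quo p q : p != 0 -> q != 0 -> (size p <= size q)%N ->
      exists v, pco v 0 != 0 /\
        phi p%:F / phi q%:F = lX C ^+ (k * ((size q).-1 - (size p).-1)) * v%:F.
    move=> p0 q0 spq; have [v [v0 vE]] := val _ p0; have [v' [v'0 v'E]] := val _ q0.
    exists (v / v'); split; first by rewrite pcoM0 pcoV0 ?mulf_neq0 ?invr_eq0.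
    have vv : (v / v')%:F = v%:F / v'%:F.
      apply: (canRL (mulfK _)); first exact: pco0_neq0.
      by rewrite -tofracM divrK // unit_psE.
    have kk : (k * (size p).-1 <= k * (size q).-1)%N by rewrite leq_mul2l; lia.
    rewrite vE v'E vv mulnBr expfB_cond ?(negPf (lX_neq0 _)) //.
    by rewrite !invfM invrK mulrACA [RHS]mulrC [X in _ * X = _]mulrC.
  case: (ltnP (size (rden f)) (size (rnum f))) => [qp|pq] /=.
    have pf0 : rnum f != 0 by rewrite -size_poly_gt0; lia.
    have dE : (rdeg f - (size (rden f)).-1 = (size (rnum f)).-1 - (size (rden f)).-1)%N.
      by rewrite /rdeg; lia.
    have q0 := size_poly_gt0 (rden f); rewrite rden_neq0 in q0.
    split; first by rewrite dE; lia.
    have [v [v0 vE]] := quo _ _ (rden_neq0 f) pf0 (ltnW qp).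
    exists v; split => //; rewrite dE /= -vE fE invf_div //.
  have dE c : (size (fib_poly f (Some c)) < size (rden f))%N ->
     (rdeg f - (size (fib_poly f (Some c))).-1
       = (size (rden f)).-1 - (size (fib_poly f (Some c))).-1)%N.
    by rewrite /rdeg; lia.
  have main c : (size (fib_poly f (Some c)) < size (rden f))%N ->
     (0 < rdeg f - (size (fib_poly f (Some c))).-1)%N /\
     ltype (Some c) (k * (rdeg f - (size (fib_poly f (Some c))).-1)) (phi f).
    move=> cq; have [v [v0 vE]] := quo _ _ (fw0 (Some c)) (rden_neq0 f) (ltnW cq).
    have := size_poly_gt0 (fib_poly f (Some c)); rewrite fw0 => s0.
    by rewrite dE //; split; [lia | exists v; split => //=; rewrite (fcE c) vE].
  case: (ltnP (size (rnum f)) (size (rden f))) => [pq'|pq']; apply: main; rewrite /=; first by rewrite scale0r subr0.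
  have spq : size (rnum f) = size (rden f) by lia.
  have q0 : lead_coef (rden f) != 0 by rewrite lead_coef_eq0 rden_neq0.
  have sq0 : (0 < size (rden f))%N by rewrite size_poly_gt0 rden_neq0.
  rewrite -(prednK sq0) ltnS; apply/leq_sizeP => j.
  rewrite leq_eqVlt => /predU1P[<-|jq]; rewrite coefB coefZ.
    by rewrite -[in X in _ - _ * X]lead_coefE divfK // -spq -lead_coefE subrr.
  have sj : (size (rden f) <= j)%N by rewrite -(prednK sq0).
  by rewrite !nth_default ?spq // mulr0 subr0.
Qed.
End RationalFunctions.

(** * Wronskians and their zeros *)

Fact wronsk_ring (A : comNzRingType) (g g' h h' y yn m : A) :
  (g' * (y * yn) + g * (m * yn)) * h - g * (y * yn) * h' =
  yn * (m * (g * h) + (g' * h - g * h') * y).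
Proof. ring. Qed.
Fact wronsk_euler (A : comNzRingType) (g g' h h' x a b : A) :
  x * (g' * h - g * h') = (a - b) * (g * h) + ((x * g' - a * g) * h - g * (x * h' - b * h)).
Proof. ring. Qed.

Lemma leq_sum_subset (T : eqType) (s t : seq T) (F : T -> nat) :
  uniq s -> uniq t -> {subset s <= t} -> (\sum_(z <- s) F z <= \sum_(z <- t) F z)%N.
Proof.
move=> us ut st; rewrite [X in (_ <= X)%N](bigID (mem s)) /= -(big_filter t (mem s)).
rewrite (perm_big [seq z <- t | z \in s]) ?leq_addr //=.
apply: uniq_perm; rewrite ?filter_uniq // => z.
by rewrite mem_filter; case: (boolP (z \in s)) => // /st ->.
Qed.

Section Wronskian.
Variable F : numFieldType.
Implicit Types (p q g h : {poly F}).

Definition wronsk g h := g^`() * h - g * h^`().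

Lemma mup_wronsk z g h : g != 0 -> h.[z] != 0 -> (0 < mup z g)%N ->
  wronsk g h != 0 /\ mup z (wronsk g h) = (mup z g).-1.
Proof.
move=> g0 hz; have : (mup z g <= mup z g)%N := leqnn _.
rewrite {1}(mup_geq z _ g0) => /dvdpP [g1 gE].
case E: (mup z g) gE => [|n] // gE _.
have g1z : g1.[z] != 0.
  have : ~~ (n.+1 < mup z g)%N by rewrite E ltnn.
  rewrite (mup_geq z _ g0) [X in _ %| X]gE exprS dvdp_mul2r ?expf_neq0 ?polyXsubC_eq0 //.
  by rewrite dvdp_XsubCl.
pose k := n.+1%:R * (g1 * h) + (g1^`() * h - g1 * h^`()) * ('X - z%:P).
have WE : wronsk g h = ('X - z%:P) ^+ n * k.
  rewrite /wronsk gE derivM deriv_exp derivXsubC mul1r /= -mulr_natl exprS.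
  exact: wronsk_ring.
have kz : k.[z] != 0.
  rewrite /k mulr_natl hornerD hornerMn !hornerM hornerXsubC subrr mulr0 addr0.
  by rewrite mulrn_eq0 !mulf_eq0 (negPf g1z) (negPf hz).
have k0 : k != 0 by apply: contraNneq kz => ->; rewrite horner0.
have X0 : ('X - z%:P) ^+ n != 0 by rewrite expf_neq0 ?polyXsubC_eq0.
rewrite WE mulf_neq0 //; split => //.
by rewrite mupM // mup_XsubCX eqxx (mupNroot (q := k)) ?addn0.
Qed.

Lemma size_euler g n : size g = n.+1 -> (size ('X * g^`() - n%:R * g)%R <= n)%N.
Proof.
move=> sg; apply/leq_sizeP => j nj; rewrite coefB coefXM mulr_natl coefMn coef_deriv.
case: j nj => [|j] nj; first by move: nj; rewrite leqn0 => /eqP ->; rewrite mulr0n subrr.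
move: nj; rewrite leq_eqVlt => /predU1P[->|nj] /=; first by rewrite subrr.
by rewrite nth_default ?mul0rn ?subrr // sg.
Qed.

(** The operator x d/dx multiplies a leading term by its degree, so the leading coefficient of x(g'h
    - gh') is a - b times that of gh, and a differs from b. *)
Lemma size_wronsk g h : g != 0 -> (size g < size h)%N ->
  size (wronsk g h) = ((size g).-1 + (size h).-1)%N.
Proof.
move=> g0 gh; set a := (size g).-1; set b := (size h).-1.
have sg : size g = a.+1 by rewrite /a prednK // size_poly_gt0.
have sh : size h = b.+1 by rewrite /b prednK //; exact: leq_ltn_trans gh.
have h0 : h != 0 by rewrite -size_poly_gt0 sh.
have ab : (a < b)%N by rewrite -ltnS -sg -sh.
have E : 'X * wronsk g h = (a%:R - b%:R) * (g * h) +
  (('X * g^`() - a%:R * g) * h - g * ('X * h^`() - b%:R * h)) by exact: wronsk_euler.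
have ab0 : a%:R - b%:R != 0 :> F by rewrite subr_eq0 eqr_nat neq_ltn ab.
have s1 : size ((a%:R - b%:R) * (g * h)) = (a + b).+1.
  rewrite -!polyC_natr -polyCB mul_polyC size_scale // size_mul // sg sh addnS //.
have s2 : size ('X * wronsk g h) = (a + b).+1.
  rewrite E size_polyDl // s1 ltnS (leq_trans (size_polyD _ _)) // geq_max size_polyN.
  rewrite !(leq_trans (size_polyMleq _ _)) //.
    by rewrite sg addSn /= leq_add2l size_euler.
  by rewrite sh addnS /= leq_add2r size_euler.
have W0 : wronsk g h != 0.
  by apply/eqP => W0; move: s2; rewrite W0 mulr0 size_poly0.
by move: s2; rewrite mulrC size_mulX // => -[].
Qed.

Lemma sum_mup_roots (s : seq F) c : c != 0 ->
  \sum_(z <- undup s) mup z (c *: \prod_(a <- s) ('X - a%:P)) = size s.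
Proof.
move=> c0; have M z : mup z (c *: \prod_(a <- s) ('X - a%:P)) = count_mem z s.
  by rewrite -mul_polyC mupMr ?mu_prod_XsubC // /root hornerC.
rewrite (eq_bigr _ (fun z _ => M z)) -[RHS](perm_size (perm_count_undup s)) size_flatten /shape.
by rewrite -map_comp sumnE big_map; apply: eq_bigr => z _; rewrite /= size_nseq.
Qed.
End Wronskian.

(** * Fibres and the Riemann-Hurwitz formula *)

Section Fibers.
Variable R : realType.
Local Notation C := R[i].
Local Notation K := (lau C).
Implicit Types (f g h : ratf R) (p q : {poly C}) (a c : C) (z w : option C).

Lemma emb_ltype_ex w k (t : K) : (0 < k)%N -> ltype w k t -> exists phi, emb (lC C) phi t.
Proof. by move=> k0 tt; apply: emb_ex; apply: ltype_transc_emb tt. Qed.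

Lemma emb_comp phi (t : K) f g : emb (lC C) phi t -> nonconst g ->
  exists psi, emb (lC C) psi (phi g) /\ forall f, phi (rcomp f g) = psi f.
Proof.
move=> ph gn; exists (phi \o compm g); split; last by move=> h; rewrite /= compmE.
by split=> [a|] /=; rewrite ?compm_rC ?(emb_compm gn).2 ?ph.1.
Qed.

Lemma locdeg_gt0 f z : nonconst f -> (0 < locdeg f z)%N.
Proof.
move=> fn; have [phi ph] := emb_ltype_ex (ltn0Sn 0) (ltype_loc z 1).
by have [] := ltype_ratf (ltn0Sn 0) fn ph (ltype_loc z 1).
Qed.

(** The image of z + s has one type, computed through the composite and through g followed by f;
    uniqueness of types yields value and local degree together. *)
Lemma eval_locdeg_comp f g z : nonconst f -> nonconst g ->
  evalr (rcomp f g) z = evalr f (evalr g z) /\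
  locdeg (rcomp f g) z = (locdeg g z * locdeg f (evalr g z))%N.
Proof.
move=> fn gn; have T1 := ltype_loc z 1.
have [phi ph] := emb_ltype_ex (ltn0Sn 0) T1.
have [g0 gT] := ltype_ratf (ltn0Sn 0) gn ph T1.
have [f0 fT] := ltype_ratf (ltn0Sn 0) (nonconst_comp fn gn) ph T1.
have [psi [ps psE]] := emb_comp f ph gn; rewrite !mul1n in gT fT.
have [f'0 f'T] := ltype_ratf g0 fn ps gT; rewrite psE in fT.
by apply: ltype_uniq fT f'T => //; rewrite muln_gt0 g0.
Qed.
Lemma evalr_comp f g z : nonconst f -> nonconst g -> evalr (rcomp f g) z = evalr f (evalr g z).
Proof. by move=> fn gn; have [] := eval_locdeg_comp z fn gn. Qed.
Lemma locdeg_comp f g z : nonconst f -> nonconst g ->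
  locdeg (rcomp f g) z = (locdeg g z * locdeg f (evalr g z))%N.
Proof. by move=> fn gn; have [] := eval_locdeg_comp z fn gn. Qed.

Definition roots_seq p : seq C := sval (closed_field_poly_normal p).
Lemma size_roots_seq p : p != 0 -> size (roots_seq p) = (size p).-1.
Proof.
move=> p0; rewrite {2}[p]poly_prod_roots size_scale ?lead_coef_eq0 //.
by rewrite size_prod_XsubC.
Qed.
Lemma mem_roots_seq p a : p != 0 -> (a \in roots_seq p) = root p a.
Proof.
move=> p0; rewrite {2}[p]poly_prod_roots rootZ ?lead_coef_eq0 //.
by rewrite root_prod_XsubC.
Qed.
Lemma sum_mup_poly p : p != 0 -> \sum_(a <- undup (roots_seq p)) mup a p = (size p).-1.
Proof.
move=> p0; rewrite -size_roots_seq // -(@sum_mup_roots _ (roots_seq p) (lead_coef p)) ?lead_coef_eq0 //.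
by rewrite -poly_prod_roots.
Qed.

Definition fiber f w : seq (option C) :=
  (if evalr f None == w then [:: None] else [::]) ++
  map Some (undup (roots_seq (fib_poly f w))).

Lemma fiber_uniq f w : uniq (fiber f w).
Proof.
rewrite /fiber cat_uniq map_inj_uniq ?undup_uniq; last by move=> x y [].
rewrite andbT; apply/andP; split; first by case: ifP.
by apply/hasPn => _ /mapP [y _ ->]; case: ifP.
Qed.

Lemma fib_polyP f (z : C) w : nonconst f -> root (fib_poly f w) z = (evalr f (Some z) == w).
Proof.
move=> fn; case: w => [c|] /=; last by rewrite rootE; case: eqP.
rewrite rootE hornerD hornerN hornerZ; case: (eqVneq (rden f).[z] 0) => [qz|qz].
  rewrite qz mulr0 subr0; apply/negbTE; exact: coprimep_root (coprime_rnum_rden f) qz.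
rewrite subr_eq0; apply/eqP/eqP => [->|[<-]]; last by rewrite divfK.
by rewrite mulfK.
Qed.

Lemma mem_fiber f w z : nonconst f -> (z \in fiber f w) = (evalr f z == w).
Proof.
move=> fn; rewrite mem_cat; case: z => [z|].
  rewrite mem_map; last by move=> x y [].
  rewrite mem_undup mem_roots_seq ?fib_poly_neq0 // fib_polyP //.
  by case: ifP.
have -> : (None \in map Some (undup (roots_seq (fib_poly f w)))) = false.
  by apply/mapP => -[].
by rewrite orbF; case: ifP.
Qed.

Lemma sum_fiber f w : nonconst f -> \sum_(z <- fiber f w) locdeg f z = rdeg f.
Proof.
move=> fn; have f0 := fib_poly_neq0 w fn; have sf := size_fib_poly f w.
rewrite big_cat big_map.
have -> : \sum_(a <- undup (roots_seq (fib_poly f w))) locdeg f (Some a)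
  = \sum_(a <- undup (roots_seq (fib_poly f w))) mup a (fib_poly f w).
  apply: eq_big_seq => a; rewrite mem_undup mem_roots_seq // fib_polyP // => /eqP {1}<-.
  by [].
rewrite sum_mup_poly //; set s := \big[_/_]_(_ <- _) _.
rewrite -[LHS]/(s + (size (fib_poly f w)).-1)%N {}/s; case: (evalr f None =P w) => [E|nE].
  by rewrite big_seq1 /locdeg E subnK //; lia.
(* When infinity is not over w the fibre polynomial must have full degree, since a drop in degree
   would give f the value w at infinity. *)
rewrite big_nil add0n.
apply/eqP; rewrite eqn_leq; apply/andP; split; first by lia.
rewrite leqNgt; apply/negP => lt; apply: nE.
have := fn; rewrite /nonconst /rdeg => rd.
case: w {f0} sf lt => [c|] sf lt; last first.
  rewrite /evalr ifT // ltnNge; apply/negP => le; move: lt; rewrite /fib_poly /rdeg.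
  by rewrite (maxn_idPr le) ltnn.
move: sf lt; rewrite [evalr _ _]/= [fib_poly _ _]/= /rdeg => sf lt.
have q0 : (0 < size (rden f))%N by rewrite size_poly_gt0 rden_neq0.
have sfib : (size (rnum f - c *: rden f)%R < maxn (size (rnum f)) (size (rden f)))%N by lia.
have pE : rnum f = (rnum f - c *: rden f) + c *: rden f by rewrite subrK.
have sc : (size (c *: rden f) <= size (rden f))%N := size_scale_leq _ _.
have pq : (size (rnum f) <= size (rden f))%N.
  rewrite leqNgt; apply/negP => qp.
  move: sfib; rewrite (maxn_idPl (ltnW qp)) size_polyDl ?ltnn // size_polyN.
  exact: leq_ltn_trans sc _.
rewrite (maxn_idPr pq) in sfib.
have lq : lead_coef (rden f) != 0 by rewrite lead_coef_eq0 rden_neq0.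
rewrite ltnNge pq /=.
have [c0|c0] := eqVneq c 0.
  by rewrite c0 in sfib *; rewrite scale0r subr0 in sfib; rewrite sfib.
have sE : size (rnum f) = size (rden f).
  by rewrite pE addrC size_polyDl size_scale.
rewrite sE ltnn; congr Some; rewrite pE addrC lead_coefDl ?size_scale // lead_coefZ mulfK //.
Qed.

(** Infinity is always listed, ramified or not, because the Wronskian detects only finite points. *)
Definition ram_points f : seq (option C) :=
  None :: map Some (undup (roots_seq (wronsk (rnum f) (rden f)))).

(** Passing from (P, Q) to (P - cQ, Q) or to (Q, P) changes the Wronskian at most by sign, so over
    each w it may be computed from a pair whose first entry cuts out the fibre. *)
Lemma wronsk_fib f w : exists (s : bool) (h : {poly C}),
  [/\ wronsk (rnum f) (rden f) = (-1) ^+ s * wronsk (fib_poly f w) h,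
      forall z : C, (fib_poly f w).[z] = 0 -> h.[z] != 0 &
      (size (fib_poly f w) < maxn (size (rnum f)) (size (rden f)))%N ->
      size h = maxn (size (rnum f)) (size (rden f))].
Proof.
case: w => [c|] /=.
  exists false, (rden f); split.
  - by rewrite expr0 mul1r /wronsk derivB derivZ -!mul_polyC; ring.
  - move=> z H; apply/eqP => qz; have := coprimep_root (coprime_rnum_rden f) qz.
    by move: H; rewrite hornerD hornerN hornerZ qz mulr0 subr0 => ->; rewrite eqxx.
  - move=> lt; apply/esym/maxn_idPr; rewrite leqNgt; apply/negP => qp.
    move: lt; rewrite (maxn_idPl (ltnW qp)) size_polyDl ?ltnn // size_polyN.
    exact: leq_ltn_trans (size_scale_leq _ _) qp.
exists true, (rnum f); split.
- by rewrite expr1 /wronsk; ring.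
- by move=> z qz; exact: coprimep_root (coprime_rnum_rden f) qz.
- by lia.
Qed.

Lemma wronsk_neq0_locdeg f (z : C) : nonconst f ->
  wronsk (rnum f) (rden f) != 0 /\ mup z (wronsk (rnum f) (rden f)) = (locdeg f (Some z)).-1.
Proof.
move=> fn; set w := evalr f (Some z).
have [s [h [WE hz _]]] := wronsk_fib f w.
have fz : root (fib_poly f w) z by rewrite fib_polyP.
have f0 := fib_poly_neq0 w fn.
have [W0 WM] := @mup_wronsk _ z _ h f0 (hz _ (rootP fz)) (locdeg_gt0 (Some z) fn).
have s0 : (-1) ^+ s != 0 :> {poly C} by rewrite expf_neq0 // oppr_eq0 oner_eq0.
rewrite WE mulf_neq0 //; split => //.
rewrite mupMr -?WM //; case: (s); rewrite ?expr0 ?expr1 rootE ?hornerN hornerC //.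
  by rewrite oppr_eq0 oner_eq0.
by rewrite oner_eq0.
Qed.

Lemma ram_points_uniq f : uniq (ram_points f).
Proof.
rewrite /= map_inj_uniq ?undup_uniq ?andbT; last by move=> x y [].
by apply/mapP => -[].
Qed.

Lemma ram_pointsP f z : nonconst f -> z \notin ram_points f -> locdeg f z = 1%N.
Proof.
move=> fn; case: z => [z|] //; rewrite inE mem_map; last by move=> x y [].
have [W0 Wz] := wronsk_neq0_locdeg z fn.
rewrite mem_undup mem_roots_seq // => /mupNroot; rewrite Wz.
by move: (locdeg_gt0 (Some z) fn); case: (locdeg f (Some z)) => [|[]].
Qed.

(** Finite ramification is counted by the degree of the Wronskian, and what that degree lacks from 2
    deg f - 2 is exactly the ramification at infinity. *)
Lemma riemann_hurwitz f : nonconst f ->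
  (\sum_(z <- ram_points f) (locdeg f z).-1 = (rdeg f).*2 - 2)%N.
Proof.
move=> fn; rewrite big_cons big_map.
have [W0 _] := wronsk_neq0_locdeg 0 fn.
rewrite (eq_bigr (fun z : C => mup z (wronsk (rnum f) (rden f)))); last first.
  by move=> z _; have [_ ->] := wronsk_neq0_locdeg z fn.
rewrite sum_mup_poly //; have lg := locdeg_gt0 None fn; move: lg; rewrite /locdeg.
set w := evalr f None => lg.
have [s [h [WE _ sh]]] := wronsk_fib f w.
have f0 := fib_poly_neq0 w fn; have sf0 : (0 < size (fib_poly f w))%N by rewrite size_poly_gt0.
have sfN : (size (fib_poly f w) < maxn (size (rnum f)) (size (rden f)))%N.
  by move: lg; rewrite /rdeg; lia.
have sW : size (wronsk (rnum f) (rden f)) = ((size (fib_poly f w)).-1 + (size h).-1)%N.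
  rewrite WE -size_wronsk ?sh //; case: (s); rewrite ?expr0 ?expr1 ?mul1r // mulN1r size_polyN //.
by rewrite sW sh // /rdeg; move: sfN sf0; lia.
Qed.

Lemma riemann_hurwitz_le f (s : seq (option C)) : nonconst f -> uniq s ->
  (\sum_(z <- s) (locdeg f z).-1 <= (rdeg f).*2 - 2)%N.
Proof.
move=> fn us; rewrite -riemann_hurwitz // (bigID (mem (ram_points f))) /=.
rewrite [X in (_ + X)%N]big1_seq ?addn0; last first.
  by move=> z /andP[zn _]; rewrite ram_pointsP.
rewrite -big_filter; apply: leq_sum_subset; rewrite ?filter_uniq ?ram_points_uniq // => z.
by rewrite mem_filter => /andP[].
Qed.
End Fibers.

(** * Ramification of polynomials over C(x) *)

Section Splitting.
Variable L : fieldType.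
Implicit Types p q : {poly L}.

Definition splits p := exists rs : seq L, p %= \prod_(r <- rs) ('X - r%:P).

Lemma splits_dvd p q : p %| q -> splits q -> splits p.
Proof.
move=> pq [rs qE]; move: pq; rewrite (eqp_dvdr _ qE).
by move=> /dvdp_prod_XsubC [m mE]; exists (mask m rs).
Qed.
Lemma splits_mul p q : splits p -> splits q -> splits (p * q).
Proof.
move=> [rs pE] [rs' qE]; exists (rs ++ rs'); rewrite big_cat /=.
by rewrite (eqp_trans (eqp_mulr q pE)) // eqp_mull.
Qed.
End Splitting.

Lemma map_prod_XsubC (L L' : fieldType) (phi : {rmorphism L -> L'}) (rs : seq L) :
  map_poly phi (\prod_(r <- rs) ('X - r%:P)) = \prod_(r <- map phi rs) ('X - r%:P).
Proof.
rewrite rmorph_prod big_map; apply: eq_bigr => r _.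
by rewrite rmorphB /= map_polyX map_polyC.
Qed.

Lemma splits_map (L L' : fieldType) (phi : {rmorphism L -> L'}) (p : {poly L}) :
  splits p -> splits (map_poly phi p).
Proof. by move=> [rs pE]; exists (map phi rs); rewrite -map_prod_XsubC eqp_map. Qed.

Lemma splits_desc (L L' : fieldType) (phi : {rmorphism L -> L'}) (p : {poly L}) (rs : seq L') :
  map_poly phi p %= \prod_(r <- rs) ('X - r%:P) ->
  (forall r, r \in rs -> exists x, r = phi x) -> splits p.
Proof.
move=> pE H; have [ss rsE] : exists ss, rs = map phi ss.
  elim: rs H {pE} => [|r rs IH] H; first by exists [::].
  have [|ss ->] := IH; first by move=> x xrs; apply: H; rewrite inE xrs orbT.
  by have [x ->] := H r (mem_head _ _); exists (x :: ss).
by exists ss; rewrite -(eqp_map phi) map_prod_XsubC -rsE.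
Qed.

Lemma eqp_prod_root (L : fieldType) (p : {poly L}) (rs : seq L) x :
  p %= \prod_(r <- rs) ('X - r%:P) -> root p x = (x \in rs).
Proof. by move=> pE; rewrite (eqp_root pE) root_prod_XsubC. Qed.

Section FiberPolynomial.
Variables (R : realType) (L : fieldType) (iota : {rmorphism R[i] -> L}).
Implicit Types (U : ratf R) (x : L).

(* The roots of fibp U x are the finite preimages of x under U. *)
Definition fibp U x : {poly L} :=
  map_poly iota (rnum U) - x *: map_poly iota (rden U).

Lemma fibp_neq0 U x i : (forall a, x != iota a) ->
  ((rnum U)`_i != 0) || ((rden U)`_i != 0) -> (fibp U x)`_i != 0.
Proof.
move=> xn; rewrite coefB coefZ !coef_map /=.
have [->|q0 _] := eqVneq (rden U)`_i 0; first by rewrite orbF rmorph0 mulr0 subr0 fmorph_eq0.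
rewrite subr_eq0; apply: contraNneq (xn ((rnum U)`_i / (rden U)`_i)) => E.
by rewrite fmorph_div E mulfK ?fmorph_eq0.
Qed.

Lemma size_fibp U x : (forall a, x != iota a) -> size (fibp U x) = (rdeg U).+1.
Proof.
move=> xn; have d0 : (0 < size (rden U))%N by rewrite size_poly_gt0 rden_neq0.
have m0 : (0 < maxn (size (rnum U)) (size (rden U)))%N by rewrite leq_max d0 orbT.
rewrite /rdeg prednK //; apply/eqP; rewrite eqn_leq; apply/andP; split.
  rewrite (leq_trans (size_polyD _ _)) // geq_max size_polyN size_map_poly leq_maxl.
  by rewrite (leq_trans (size_scale_leq _ _)) // size_map_poly leq_maxr.
rewrite -(prednK m0) ltnNge; apply/negP => /leq_sizeP /(_ _ (leqnn _)); apply/eqP.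
apply: fibp_neq0 => //; case: (ltnP (size (rden U)) (size (rnum U))) => [lt|le].
  rewrite -lead_coefE lead_coef_eq0 -size_poly_eq0 -lt0n.
  by rewrite (leq_ltn_trans _ lt).
by rewrite -[(rden U)`__]lead_coefE lead_coef_eq0 rden_neq0 orbT.
Qed.
End FiberPolynomial.

Lemma map_fibp (R : realType) (L L' : fieldType) (iota : {rmorphism R[i] -> L})
    (iota' : {rmorphism R[i] -> L'}) (phi : {rmorphism L -> L'}) (U : ratf R) x :
  (forall a, phi (iota a) = iota' a) -> map_poly phi (fibp iota U x) = fibp iota' U (phi x).
Proof.
move=> ph; rewrite /fibp rmorphB /= map_polyZ -!map_poly_comp.
by rewrite !(eq_map_poly (g := iota')).
Qed.

Section LocalSplitting.
Variable R : realType.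
Local Notation C := R[i].
Local Notation K := (lau C).
Local Notation lC := (lC C).
Implicit Types (f g U : ratf R) (Q : {poly ratf R}) (w z : option C) (t : K).

Definition spl Q w k := exists phi, emb lC phi (loc w k) /\ splits (map_poly phi Q).

Lemma emb_auto phi (t : K) (tau : {rmorphism K -> K}) : (forall a, tau (lC a) = lC a) ->
  emb lC phi t -> emb lC (tau \o phi : {rmorphism ratf R -> K}) (tau t).
Proof. by move=> tC [pC pX]; split=> [a|] /=; rewrite ?pC ?pX ?tC. Qed.

Lemma splits_emb phi psi (t : K) Q : emb lC phi t -> emb lC psi t ->
  splits (map_poly phi Q) -> splits (map_poly psi Q).
Proof. by move=> ph ps; rewrite (eq_map_poly (emb_uniq ph ps)). Qed.

(** Points of equal type differ by an automorphism of C((s)), so splitting depends only on the type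
    and the embedding in [spl] may be chosen freely. *)
Lemma spl_ltype Q w k phi t : (0 < k)%N -> ltype w k t -> emb lC phi t ->
  spl Q w k <-> splits (map_poly phi Q).
Proof.
move=> k0 tT ph; have [tau [tau' [[tK tK' [tC tC'] _ _] tE]]] := ltype_auto k0 tT.
split=> [[psi [ps sp]]|sp].
  apply: (splits_emb (emb_auto tC ps)); first by rewrite tE.
  by rewrite map_poly_comp; apply: splits_map.
exists (tau' \o phi); split; first by rewrite -(tK (loc w k)) tE; apply: emb_auto.
by rewrite map_poly_comp; apply: splits_map.
Qed.

Lemma spl_mul Q w k d : (0 < d)%N -> spl Q w k -> spl Q w (d * k).
Proof.
move=> d0 [phi [ph sp]]; exists (subd d \o phi); split.
  by rewrite -subd_loc //; apply: emb_auto => // a; exact: subd_lC.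
by rewrite map_poly_comp; apply: splits_map.
Qed.

(** At exponent ab every root is a series in s^b and also in s^a, hence in s^lcm(a,b), and so it
    already exists at exponent ab / lcm(a,b) = gcd(a,b). *)
Lemma spl_gcd Q w a b : (0 < a)%N -> (0 < b)%N -> spl Q w a -> spl Q w b ->
  spl Q w (gcdn a b).
Proof.
move=> a0 b0 [pa [ea [ra ra_E]]] [pb [eb [rb rb_E]]].
set g := gcdn a b; have g0 : (0 < g)%N by rewrite gcdn_gt0 a0.
have gl := muln_lcm_gcd a b; have l0 : (0 < lcmn a b)%N by rewrite lcmn_gt0 a0.
have [pg eg] := emb_ltype_ex g0 (ltype_loc w g); exists pg; split => //.
have E d c p : (0 < d)%N -> emb lC p (loc w c) -> emb lC (subd d \o p : {rmorphism ratf R -> K}) (loc w (d * c)).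
  by move=> d0 ep; rewrite -subd_loc //; apply: emb_auto => // x; exact: subd_lC.
have [Ea Eb Eg] := And3 (E b a pa b0 ea) (E a b pb a0 eb) (E _ _ pg l0 eg).
rewrite mulnC in Ea; rewrite gl in Eg.
have ra' : map_poly (subd (lcmn a b) \o pg) Q %= \prod_(r <- map (subd b) ra) ('X - r%:P).
  by rewrite -(eq_map_poly (emb_uniq Ea Eg)) map_poly_comp -map_prod_XsubC eqp_map.
have rb' : map_poly (subd (lcmn a b) \o pg) Q %= \prod_(r <- map (subd a) rb) ('X - r%:P).
  by rewrite -(eq_map_poly (emb_uniq Eb Eg)) map_poly_comp -map_prod_XsubC eqp_map.
rewrite map_poly_comp in ra'; apply: (splits_desc ra') => r rra.
have : r \in map (subd a) rb.
  by rewrite -(eqp_prod_root r rb') map_poly_comp (eqp_prod_root r ra').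
case/mapP: rra => x _ xE /mapP [y _ yE].
by have := @in_subd_lcm _ a b r a0 b0; apply; [exists y | exists x].
Qed.

Lemma spl_dvd Q P w k : P %| Q -> spl Q w k -> spl P w k.
Proof.
by move=> PQ [phi [ph sp]]; exists phi; split => //; apply: splits_dvd sp; rewrite dvdp_map.
Qed.
Lemma spl_eqp Q P w k : P %= Q -> spl Q w k -> spl P w k.
Proof. by move=> /andP[PQ _]; apply: spl_dvd. Qed.

(* The ramification index nu_Q(w): splitting over w happens exactly at its multiples. *)
Lemma ram_index_ex Q w : exists n, forall k, (0 < k)%N -> spl Q w k -> 
  (0 < n)%N /\ forall j, (0 < j)%N -> spl Q w j <-> (n %| j)%N.
Proof.
case: (pselect (exists k, (0 < k)%N /\ spl Q w k)) => [[k0 k0P]|H]; last first.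
  by exists 0%N => k k0 sk; case: H; exists k.
pose P n := `[< (0 < n)%N /\ spl Q w n >].
have PP : exists n, P n by exists k0; apply/asboolP.
have [n /asboolP[n0 nS] nmin] := ex_minnP PP.
exists n => _ _ _; split => // j j0; split=> [sj|/dvdnP [d dE]].
  have gS := spl_gcd n0 j0 nS sj; have : P (gcdn n j).
    by apply/asboolP; rewrite gcdn_gt0 n0.
  move=> /nmin ng; have gn : (gcdn n j <= n)%N by rewrite dvdn_leq ?dvdn_gcdl.
  have <- : gcdn n j = n by apply/eqP; rewrite eqn_leq gn.
  exact: dvdn_gcdr.
by move: j0; rewrite dE muln_gt0 => /andP[d0 _]; exact: spl_mul.
Qed.
Definition ram_index Q w : nat := sval (cid (ram_index_ex Q w)).
Lemma ram_indexP Q w k : (0 < k)%N -> spl Q w k ->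
  (0 < ram_index Q w)%N /\ forall j, (0 < j)%N -> spl Q w j <-> (ram_index Q w %| j)%N.
Proof. by move=> k0 sk; rewrite /ram_index; case: cid => n /= /(_ k k0 sk). Qed.

Definition pcomp g Q : {poly ratf R} := map_poly (compm g) Q.

(** The map g sends z + s^k to a point of contact order k deg_z g with g(z). This is the
    divisibility form of dividing the index by its gcd with the local degree. *)
Lemma spl_pcomp g Q z k : nonconst g -> (0 < k)%N ->
  spl (pcomp g Q) z k <-> spl Q (evalr g z) (k * locdeg g z).
Proof.
move=> gn k0; have [phi ph] := emb_ltype_ex k0 (ltype_loc z k).
have [g0 gT] := ltype_ratf k0 gn ph (ltype_loc z k).
have [psi [ps psE]] := emb_comp g ph gn.
rewrite (spl_ltype _ k0 (ltype_loc z k) ph) (spl_ltype _ _ gT ps) ?muln_gt0 ?k0 //.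
rewrite /pcomp -map_poly_comp (eq_map_poly (g := psi)) // => f /=.
by rewrite /= compmE // psE.
Qed.

Lemma pcomp_comp f g Q : nonconst f -> nonconst g ->
  pcomp g (pcomp f Q) = pcomp (rcomp f g) Q.
Proof.
move=> fn gn; rewrite /pcomp -map_poly_comp; apply: eq_map_poly => h /=.
by rewrite !compmE ?nonconst_comp // rcompA.
Qed.

Lemma pcomp_fibp U f g : nonconst g -> pcomp g (fibp (@rC R) U f) = fibp (@rC R) U (rcomp f g).
Proof.
move=> gn; rewrite /pcomp (map_fibp (iota' := @rC R)) ?compmE // => a.
by rewrite compm_rC.
Qed.

Lemma root_fibp U f V : nonconst f -> root (fibp (@rC R) U f) V -> f = rcomp U V /\ nonconst V.
Proof.
move=> fn; rewrite rootE /fibp hornerD hornerN hornerZ subr_eq0 => /eqP E.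
have Vn : nonconst V.
  apply: contraT => /nonconstP [a Va]; move: E; rewrite Va !horner_map => E.
  have [qa|qa] := eqVneq (rden U).[a] 0.
    have := coprimep_root (coprime_rnum_rden U) qa.
    by move/eqP: E; rewrite qa rmorph0 mulr0 fmorph_eq0 => /eqP ->; rewrite eqxx.
  have /eqP[] := nonconst_neq ((rnum U).[a] / (rden U).[a]) fn.
  by rewrite fmorph_div E mulfK // fmorph_eq0.
split=> //; rewrite /rcomp -/(rC R) [X in X / _]E mulfK //.
by apply: nonconst_transc => //; exact: rden_neq0.
Qed.

Lemma fibp_root U V : nonconst V -> root (fibp (@rC R) U (rcomp U V)) V.
Proof.
move=> Vn; rewrite rootE /fibp hornerD hornerN hornerZ subr_eq0 /rcomp divfK //.
by apply: nonconst_transc => //; exact: rden_neq0.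
Qed.

Lemma prim_root_ex (N : nat) : (0 < N)%N -> exists zt : C, N.-primitive_root zt.
Proof.
move=> N0; pose p : {poly C} := 'X^N - 1.
have sp : size p = N.+1 by apply: size_Xn_sub_1.
have p0 : p != 0 by rewrite -size_poly_gt0 sp.
have pE := poly_prod_roots p; set rs := sval _ in pE.
have srs : size rs = N by have := size_roots_seq p0; rewrite sp.
have urs : uniq rs.
  have sep : separable_poly p by apply: cyclotomic.separable_Xn_sub_1; rewrite pnatr_eq0 -lt0n.
  rewrite -separable_prod_XsubC -(@eqp_separable _ p) //.
  by rewrite {1}pE eqp_scale // lead_coef_eq0.
have /hasP [zt _ ztP] : has N.-primitive_root rs.
  apply: has_prim_root => //; last by rewrite srs.
  apply/allP => x; rewrite /= -root_prod_XsubC unity_rootE -(rootZ _ _ (_ : lead_coef p != 0)) -?pE //.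
    by rewrite /p rootE hornerD hornerN hornerXn hornerC subr_eq0.
  by rewrite lead_coef_eq0.
by exists zt.
Qed.

Definition leval f t : K := (map_poly lC (rnum f)).[t] / (map_poly lC (rden f)).[t].
Lemma lev_emb phi t f : emb lC phi t -> phi f = leval f t.
Proof. by move=> ph; rewrite (embE _ ph). Qed.
Lemma leval_map (tau : {rmorphism K -> K}) t f : (forall a, tau (lC a) = lC a) ->
  tau (leval f t) = leval f (tau t).
Proof.
by move=> tC; rewrite /leval fmorph_div -!horner_map /= -!map_poly_comp !(eq_map_poly (g := lC)).
Qed.

(** An automorphism of C((s)) carries the standard point over U(z) to the image of z + s; its
    inverse gives the parameter in which U has the local normal form w + s^e. *)
Lemma uniformizer_lift U z : nonconst U ->
  exists t, ltype z 1 t /\ leval U t = loc (evalr U z) (locdeg U z).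
Proof.
move=> Un; have T := ltype_loc z 1; have [phi ph] := emb_ltype_ex (ltn0Sn 0) T.
have [l0 lT] := ltype_ratf (ltn0Sn 0) Un ph T; rewrite mul1n in lT.
have [tau [tau' [[tK tK' [tC tC'] _ tT'] tE]]] := ltype_auto l0 lT.
exists (tau' (loc z 1)); split; first exact: tT'.
by rewrite -leval_map // -(lev_emb _ ph) -tE tK.
Qed.

Lemma loc_nonconst w k a : (0 < k)%N -> loc w k != lC a :> K.
Proof.
move=> k0; have /(_ ('X - a%:P)) := ltype_transc_emb k0 (ltype_loc w k).
rewrite polyXsubC_eq0 => /(_ isT).
by rewrite rmorphB /= map_polyX map_polyC hornerXsubC subr_eq0.
Qed.

Lemma fibp_leval U t x : transc lC t -> root (fibp lC U x) t = (leval U t == x).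
Proof.
move=> tr; have d0 := tr _ (rden_neq0 U).
rewrite rootE /fibp hornerD hornerN hornerZ subr_eq0 /leval.
by apply/eqP/eqP => [->|<-]; rewrite ?mulfK ?divfK.
Qed.

(* All solutions of U(t) = w + s^N: the conjugates of the lifted uniformizers eta z at the points z over w. *)
Lemma fiber_lifts U w N zt (eta : option C -> K) : nonconst U -> (0 < N)%N ->
  N.-primitive_root zt -> (forall z, evalr U z = w -> locdeg U z %| N)%N ->
  (forall z, ltype z 1 (eta z) /\ leval U (eta z) = loc (evalr U z) (locdeg U z)) ->
  let ts := [seq rot (zt ^+ i) (subd (N %/ locdeg U z) (eta z)) | z <- fiber U w, i <- iota 0 (locdeg U z)] in
  uniq ts /\ fibp lC U (loc w N) %= \prod_(t <- ts) ('X - t%:P).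
Proof.
move=> Un N0 ztN dv etaP ts.
have zt0 : zt != 0.
  apply/eqP => z0; have := prim_expr_order ztN; rewrite z0 expr0n gtn_eqF // => /eqP.
  by rewrite eq_sym oner_eq0.
have quo z : evalr U z = w -> (0 < N %/ locdeg U z)%N.
  by move=> zw; rewrite divn_gt0 ?locdeg_gt0 // dvdn_leq // dv.
have T z i : evalr U z = w -> ltype z (N %/ locdeg U z) (rot (zt ^+ i) (subd (N %/ locdeg U z) (eta z))).
  move=> zw; apply: ltype_rot; first by rewrite expf_neq0.
  by have := ltype_subd (quo _ zw) (etaP z).1; rewrite muln1.
have ztN1 i : (zt ^+ i) ^+ N = 1 by rewrite exprAC (prim_expr_order ztN : zt ^+ N = 1); exact: expr1n.
have inj z i j : evalr U z = w -> (i <= j < locdeg U z)%N ->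
    rot (zt ^+ i) (subd (N %/ locdeg U z) (eta z)) = rot (zt ^+ j) (subd (N %/ locdeg U z) (eta z)) -> i = j.
  move=> zw /andP[ij jb]; rewrite -[in X in _ = X](subnKC ij) exprD -rotM ?expf_neq0 //.
  move=> /fmorph_inj /esym fix_x.
  have T0 : ltype z (N %/ locdeg U z) (subd (N %/ locdeg U z) (eta z)).
    by have := ltype_subd (quo _ zw) (etaP z).1; rewrite muln1.
  have {fix_x} E : zt ^+ ((j - i) * (N %/ locdeg U z)) = 1.
    by rewrite exprM; apply: ltype_rot_fixed T0 fix_x; rewrite expf_neq0.
  move/eqP: E; rewrite -(prim_order_dvd ztN).
  rewrite -{1}(divnK (dv z zw)) [(_ * locdeg U z)%N]mulnC dvdn_pmul2r ?quo //.
  move=> H; apply/eqP; rewrite eqn_leq ij -subn_eq0.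
  by apply: contraTT H; rewrite -lt0n => /gtnNdvd ->; rewrite // (leq_ltn_trans (leq_subr _ _)).
have uts : uniq ts.
  apply: allpairs_uniq_dep => [||p q]; [exact: fiber_uniq|by move=> z _; exact: iota_uniq|].
  move=> /allpairsPdep [x [k [xf ki ->]]] /allpairsPdep [x' [k' [xf' ki' ->]]] /= E.
  move: xf xf'; rewrite !mem_fiber // => /eqP xw /eqP x'w.
  have xx : x = x'.
    by have := T x k xw; rewrite E => H; have [->] := ltype_uniq (quo _ xw) (quo _ x'w) H (T x' k' x'w).
  subst x'; congr Tagged; move: ki ki'; rewrite !mem_iota add0n /= => ki ki'.
  case: (leqP k k') => kk; first by apply: (inj x) E => //; rewrite kk.
  by apply/esym; apply: (inj x) (esym E) => //; rewrite (ltnW kk).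
have ln a := loc_nonconst w a N0.
split=> //; rewrite eqp_sym -dvdp_size_eqp; last first.
  apply: uniq_roots_dvdp; last by rewrite uniq_rootsE.
  apply/allP => t /allpairsPdep [z [i [zf _ ->]]]; move: zf; rewrite mem_fiber // => /eqP zw.
  rewrite fibp_leval; last exact: ltype_transc_emb (quo _ zw) (T z i zw).
  rewrite -leval_map; last by move=> a; exact: rot_lC.
  rewrite -leval_map; last by move=> a; exact: subd_lC.
  by rewrite (etaP z).2 subd_loc ?quo // divnK ?dv // zw rot_loc.
rewrite size_prod_XsubC size_fibp // eqSS size_allpairs_dep sumnE big_map.
rewrite -(sum_fiber w Un); apply/eqP; apply: eq_bigr => z _.
by rewrite size_iota.
Qed.

Lemma eta_ex U : nonconst U -> exists eta : option C -> K,
  forall z, ltype z 1 (eta z) /\ leval U (eta z) = loc (evalr U z) (locdeg U z).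
Proof.
move=> Un; exists (fun z => sval (cid (uniformizer_lift z Un))) => z.
exact: svalP (cid (uniformizer_lift z Un)).
Qed.

Lemma spl_fibp_idr U w N : nonconst U -> (0 < N)%N ->
  (forall z, evalr U z = w -> locdeg U z %| N)%N -> spl (fibp (@rC R) U (idr R)) w N.
Proof.
move=> Un N0 dv; have [zt ztN] := prim_root_ex N0; have [eta etaP] := eta_ex Un.
have [phi ph] := emb_ltype_ex N0 (ltype_loc w N); exists phi; split=> //.
have [_ ts] := fiber_lifts Un N0 ztN dv etaP.
by rewrite (map_fibp (iota' := lC) _ _ ph.1) ph.2; eexists; exact: ts.
Qed.

Lemma spl_fibp U f z k : nonconst U -> nonconst f -> (0 < k)%N ->
  (forall y, evalr U y = evalr f z -> locdeg U y %| k * locdeg f z)%N ->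
  spl (fibp (@rC R) U f) z k.
Proof.
move=> Un fn k0 dv; rewrite -(rcomp_idl fn) -pcomp_fibp // spl_pcomp //.
by apply: spl_fibp_idr => //; rewrite muln_gt0 k0 locdeg_gt0.
Qed.

End LocalSplitting.

(** * Symmetric functions and derivations *)

Section RootTransform.
Variable k : fieldType.

Lemma horner_mx_intertwine (L : fieldType) n (A V D : 'M[L]_n.+1) (p : {poly L}) :
  A *m V = V *m D -> horner_mx A p *m V = V *m horner_mx D p.
Proof.
move=> AV; elim/poly_ind: p => [|p a IH]; first by rewrite !rmorph0 mul0mx mulmx0.
rewrite !rmorphD !rmorphM /= !horner_mx_X !horner_mx_C mulmxDl mulmxDr.
by rewrite -mulmxA AV mulmxA IH -mulmxA mul_scalar_mx mul_mx_scalar.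
Qed.

Lemma char_poly_intertwine (L : fieldType) n (A V D : 'M[L]_n.+1) :
  A *m V = V *m D -> \det V != 0 -> char_poly A = char_poly D.
Proof.
move=> AV V0; apply: (mulIf (_ : (\det V)%:P != 0)); first by rewrite polyC_eq0.
rewrite -det_map_mx /char_poly -det_mulmx [RHS]mulrC -det_mulmx; congr (\det _).
rewrite /char_poly_mx mulmxBl mulmxBr -!map_mxM AV.
by rewrite mul_scalar_mx mul_mx_scalar.
Qed.

(* H is the characteristic polynomial of multiplication by f on k[y]/(P). *)
Lemma root_transform (P f : {poly k}) : P \is monic ->
  exists H : {poly k}, H \is monic /\
    forall (L : fieldType) (psi : {rmorphism k -> L}) (s : seq L), uniq s ->
      map_poly psi P = \prod_(t <- s) ('X - t%:P) ->
      map_poly psi H = \prod_(t <- s) ('X - ((map_poly psi f).[t])%:P).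
Proof.
move=> Pm; case E: (size P) => [|[|n]].
- by have := monic_neq0 Pm; rewrite -size_poly_eq0 E.
- exists 1; split=> [|L psi s us sE]; first exact: monic1.
  have : size (map_poly psi P) = 1%N by rewrite size_map_poly.
  rewrite sE size_prod_XsubC => -[/size0nil ->].
  by rewrite big_nil rmorph1.
(* [A] is the companion matrix of P; the vectors (1, t, ..., t^n) at the roots t are its
   eigenvectors, so the Vandermonde matrix diagonalizes it. *)
pose A := \matrix_(i < n.+1, j < n.+1) if i == n :> nat then - P`_j else (i.+1 == j)%:R.
exists (char_poly (horner_mx A f)); split=> [|L psi s us sE]; first exact: char_poly_monic.
have ss : size s = n.+1.
  by have := size_map_poly psi P; rewrite sE size_prod_XsubC E => -[].
pose a := \row_(j < n.+1) s`_j; pose V := Vandermonde n.+1 a.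
have V0 : \det V != 0.
  rewrite det_Vandermonde; apply/prodf_neq0 => i _; apply/prodf_neq0 => j ij.
  by rewrite !mxE subr_eq0 nth_uniq ?ss // gtn_eqF.
have AV : map_mx psi A *m V = V *m diag_mx a.
  apply/matrixP => i j; rewrite mul_mx_diag !mxE.
  have root_s : (map_poly psi P).[s`_j] = 0.
    by apply/rootP; rewrite sE root_prod_XsubC mem_nth // ss.
  have [iE|ni] := eqVneq (i : nat) n.
    rewrite iE; under eq_bigr => l _ do rewrite !mxE iE eqxx rmorphN mulNr.
    move: root_s; rewrite (@horner_coef_wide _ n.+2) ?size_map_poly ?E //.
    rewrite big_ord_recr /= coef_map /= -[P`_n.+1]/(P`_(n.+2.-1)) -E -lead_coefE (monicP Pm) rmorph1 mul1r.
    rewrite -exprSr => /eqP; rewrite addrC addr_eq0 => /eqP ->; rewrite sumrN.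
    by congr (- _); apply: eq_bigr => l _; rewrite coef_map.
  have iS : (i.+1 < n.+1)%N by rewrite ltn_neqAle eqSS ni ltn_ord.
  rewrite (bigD1 (Ordinal iS)) //= !mxE (negPf ni) eqxx rmorph1 mul1r big1 ?addr0 -?exprSr //.
  by move=> l; rewrite -val_eqE /= !mxE (negPf ni) eq_sym => /negPf ->; rewrite rmorph0 mul0r.
rewrite map_char_poly map_horner_mx (char_poly_intertwine (horner_mx_intertwine _ AV) V0).
rewrite horner_mx_diag /char_poly.
have -> : char_poly_mx (diag_mx (map_mx (horner (map_poly psi f)) a)) =
   diag_mx (\row_j ('X - ((map_poly psi f).[s`_j])%:P)).
  apply/matrixP => i j; rewrite !mxE; case: (i == j); rewrite ?mulr1n ?mulr0n ?subr0 // rmorph0 subrr //.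
rewrite det_diag [RHS](big_nth 0) big_mkord ss; apply: eq_bigr => j _.
by rewrite !mxE.
Qed.
End RootTransform.

Section Derivations.
Variable L : fieldType.

Definition leibniz (D : L -> L) := forall x y, D (x * y) = D x * y + x * D y.

Variable D : {additive L -> L}.
Hypothesis DL : leibniz D.

Lemma leibniz1 : D 1 = 0.
Proof.
by have := DL 1 1; rewrite !mulr1 mul1r => /eqP; rewrite -subr_eq0 opprD addrA subrr sub0r oppr_eq0 => /eqP.
Qed.
Lemma leibniz_div x y : y != 0 -> D (x / y) = (D x * y - x * D y) / y ^+ 2.
Proof.
move=> y0; have := DL (x / y) y; rewrite divfK // => ->.
by field.
Qed.
Lemma leibnizX x n : D (x ^+ n) = n%:R * x ^+ n.-1 * D x.
Proof.
elim: n => [|n IH]; first by rewrite expr0 leibniz1 !mul0r.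
rewrite exprS DL IH; case: n {IH} => [|n] /=; first by rewrite !expr0 !mul0r mulr0 addr0 mulr1 !mul1r.
rewrite !exprS -[n.+2%:R]natr1; ring.
Qed.
End Derivations.

Section QuotientRule.
Variables (k : fieldType) (N N' M M' dN dN' dM dM' : k).
Hypotheses (M0 : M != 0) (M'0 : M' != 0).
Fact quotient_rule_wd : N * M' = N' * M -> dN * M' + N * dM' = dN' * M + N' * dM ->
  (dN * M - N * dM) / M ^+ 2 = (dN' * M' - N' * dM') / M' ^+ 2.
Proof.
move=> E E'; have -> : dN' = (dN * M' + N * dM' - N' * dM) / M by rewrite E' addrK mulfK.
have -> : N' = N * M' / M by rewrite E mulfK.
by field; rewrite M0 M'0.
Qed.
Fact quotient_rule_sub :
  ((dN * M' + N * dM' - (dN' * M + N' * dM)) * (M * M') -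
     (N * M' - N' * M) * (dM * M' + M * dM')) / (M * M') ^+ 2 =
  (dN * M - N * dM) / M ^+ 2 - (dN' * M' - N' * dM') / M' ^+ 2.
Proof. by field; rewrite M0 M'0. Qed.
Fact quotient_rule_mul :
  ((dN * N' + N * dN') * (M * M') - N * N' * (dM * M' + M * dM')) / (M * M') ^+ 2 =
  (dN * M - N * dM) / M ^+ 2 * (N' / M') + N / M * ((dN' * M' - N' * dM') / M' ^+ 2).
Proof. by field; rewrite M0 M'0. Qed.
End QuotientRule.

Lemma frac_derivation (A : idomainType) (d : {additive A -> A}) :
  (forall x y, d (x * y) = d x * y + x * d y) ->
  exists D : {additive {fraction A} -> {fraction A}},
    leibniz D /\ forall x, D x%:F = (d x)%:F.
Proof.
move=> dL; pose val (n m : A) : {fraction A} := ((d n)%:F * m%:F - n%:F * (d m)%:F) / m%:F ^+ 2.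
have H x : exists y, exists n m, [/\ m != 0, x = n%:F / m%:F & y = val n m].
  by have [n [m [m0 xE]]] := fracE x; exists (val n m), n, m.
pose D x := sval (cid (H x)).
have D_E n m : m != 0 -> D (n%:F / m%:F) = val n m.
  move=> m0; rewrite /D; case: cid => y /= [n' [m' [m'0 /eqP E ->]]].
  move: E; rewrite eqr_div ?tofrac_eq0 // -!tofracM tofrac_eq => /eqP E.
  have E' := congr1 d E; rewrite !dL in E'.
  have {}E := congr1 (@FracField.tofrac A) E; rewrite !tofracM in E.
  have {}E' := congr1 (@FracField.tofrac A) E'; rewrite !tofracD !tofracM in E'.
  rewrite /val; move: E E'.
  move: (tofrac_eq0 m) (tofrac_eq0 m'); rewrite (negPf m0) (negPf m'0) => /negbT M0 /negbT M'0.
  move: (n%:F) (n'%:F) (m%:F) (m'%:F) ((d n)%:F) ((d n')%:F) ((d m)%:F) ((d m')%:F) M0 M'0.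
  move=> N N' M M' dN dN' dM dM' M0 M'0 E E'.
  exact: quotient_rule_wd.
have DF x : D x%:F = (d x)%:F.
  rewrite -[x%:F]divr1 -tofrac1 D_E ?oner_neq0 // /val.
  have d1 : d 1 = 0.
    by have := dL 1 1; rewrite !mulr1 mul1r => /eqP; rewrite -subr_eq0 opprD addrA subrr sub0r oppr_eq0 => /eqP.
  by rewrite d1 tofrac0 mulr0 subr0 tofrac1 mulr1 expr1n divr1.
have DB : zmod_morphism D.
  move=> x y; have [n [m [m0 ->]]] := fracE x; have [n' [m' [m'0 ->]]] := fracE y.
  rewrite -[- (_ / _)]mulNr addf_div ?tofrac_eq0 // mulNr -!tofracM -tofracB !D_E ?mulf_neq0 //.
  rewrite /val raddfB !dL !(tofracD, tofracN, tofracM).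
  move: (tofrac_eq0 m) (tofrac_eq0 m'); rewrite (negPf m0) (negPf m'0) => /negbT M0 /negbT M'0.
  move: (n%:F) (n'%:F) (m%:F) (m'%:F) ((d n)%:F) ((d n')%:F) ((d m)%:F) ((d m')%:F) M0 M'0.
  by move=> N N' M M' dN dN' dM dM'; exact: quotient_rule_sub.
pose m1 := GRing.isZmodMorphism.Build _ _ D DB.
pose Da : {additive {fraction A} -> {fraction A}} := HB.pack D m1.
exists Da; split => // x y /=.
have [n [m [m0 ->]]] := fracE x; have [n' [m' [m'0 ->]]] := fracE y.
rewrite mulf_div -!tofracM !D_E ?mulf_neq0 // /val !dL !(tofracD, tofracM).
move: (tofrac_eq0 m) (tofrac_eq0 m'); rewrite (negPf m0) (negPf m'0) => /negbT M0 /negbT M'0.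
move: (n%:F) (n'%:F) (m%:F) (m'%:F) ((d n)%:F) ((d n')%:F) ((d m)%:F) ((d m')%:F) M0 M'0.
by move=> N N' M M' dN dN' dM dM'; exact: quotient_rule_mul.
Qed.

Lemma map_polyMXaddC (A : nzRingType) (d : {additive A -> A}) (f : {poly A}) a :
  map_poly d (f * 'X + a%:P) = map_poly d f * 'X + (d a)%:P.
Proof.
apply/polyP => i; rewrite coef_map !coefD !coefMX !coefC coef_map.
by case: i => [|i] /=; rewrite ?add0r ?addr0.
Qed.

Section ChainRule.
Variables (R : realType) (L : fieldType) (iota : {rmorphism R[i] -> L}).
Variables (d : {additive ratf R -> ratf R}) (D : {additive L -> L}).
Hypotheses (dL : leibniz d) (d_poly : forall p, d p%:F = (p^`())%:F) (DL : leibniz D).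
Variables (phi : {rmorphism ratf R -> L}) (t : L).
Hypotheses (ph : emb iota phi t) (DC : forall a, D (iota a) = 0) (Dt : D t = 1).

Lemma emb_deriv f : D (phi f) = phi (d f).
Proof.
have pol p : D (phi p%:F) = phi (d p%:F).
  rewrite d_poly; elim/poly_ind: p => [|p a IH]; first by rewrite deriv0 tofrac0 !raddf0.
  rewrite derivMXaddC !(tofracD, tofracM) !rmorphD !rmorphM raddfD DL IH.
  by rewrite -[('X)%:F]/(idr R) ph.2 Dt -[a%:P%:F]/(rC R a) ph.1 DC addr0 mulr1 addrC.
have [n [m [m0 ->]]] := fracE f; have M0 : m%:F != 0 :> ratf R by rewrite tofrac_eq0.
rewrite fmorph_div leibniz_div ?fmorph_eq0 // leibniz_div // !pol.
by rewrite fmorph_div rmorphXn rmorphB !rmorphM.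
Qed.

Lemma deriv_horner (f : {poly ratf R}) r :
  D (map_poly phi f).[r] = (map_poly phi (map_poly d f)).[r] + (map_poly phi f^`()).[r] * D r.
Proof.
elim/poly_ind: f => [|f a IH].
  by rewrite deriv0 !raddf0 !horner0 raddf0 mul0r addr0.
rewrite derivMXaddC [map_poly phi (f * 'X + _)]rmorphD rmorphM /= map_polyX map_polyC hornerMXaddC.
rewrite raddfD DL IH /= emb_deriv.
have -> : map_poly d (f * 'X + a%:P) = map_poly d f * 'X + (d a)%:P.
  exact: map_polyMXaddC.
rewrite !rmorphD !rmorphM /= map_polyX map_polyC !hornerE; ring.
Qed.
End ChainRule.

Fact euler_shift_field (k : fieldType) (M A W E a m : k) : M != 0 ->
  ((a * A * W + A * E) * M - A * W * (m * M)) / M ^+ 2 = A * (a * W + E - m * W) / M.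
Proof. by move=> M0; field. Qed.

(** * The operator s d/ds and integrality of Laurent series *)

Section Euler.
Variable F : fieldType.
Implicit Types w : ps F.

Lemma horner_psX (p : {poly F}) n : pco (map_poly (@psC F) p).[psX F] n = p`_n.
Proof.
elim/poly_ind: p n => [|p a IH] n; first by rewrite rmorph0 horner0 pco0 coef0.
rewrite rmorphD rmorphM /= map_polyX map_polyC hornerMXaddC pcoD mulrC -[psX F]expr1 pco_psXnM.
by rewrite expr1 coefD coefMX coefC; case: n => [|n] /=; rewrite ?add0r // subSS subn0 IH addr0.
Qed.

(** The operator s d/ds: it never lowers the order, and d/dx is a constant times a power of s times
    it both at finite points and at infinity. *)
Definition ps_euler w := Ps (fun n => n%:R * pco w n).
Fact ps_euler_zmod : zmod_morphism ps_euler.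
Proof. by move=> f g; apply: psP => n; rewrite pcoB /= mulrBr. Qed.
HB.instance Definition _ := GRing.isZmodMorphism.Build (ps F) (ps F) ps_euler ps_euler_zmod.
Lemma ps_eulerM f g : ps_euler (f * g) = ps_euler f * g + f * ps_euler g.
Proof.
apply: psP => n; rewrite pcoD /= mulr_sumr -big_split /=; apply: eq_bigr => i _.
have ni : (i <= n)%N by rewrite -ltnS.
by rewrite -{1}(subnKC ni) natrD; ring.
Qed.

Definition euler : {additive lau F -> lau F} := sval (cid (frac_derivation ps_eulerM)).
Lemma eulerL : leibniz euler. Proof. by rewrite /euler; case: cid => D []. Qed.
Lemma eulerE w : euler w%:F = (ps_euler w)%:F. Proof. by rewrite /euler; case: cid => D []. Qed.
Lemma euler_lC a : euler (lC F a) = 0.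
Proof.
by rewrite eulerE; apply/eqP; rewrite tofrac_eq0; apply/eqP; apply: psP => -[|n] /=; rewrite ?mul0r ?mulr0.
Qed.
Lemma euler_lX : euler (lX F) = lX F.
Proof.
rewrite eulerE; congr (_%:F); apply: psP => n /=.
by case: eqP => [->|]; rewrite ?mul1r ?mulr0.
Qed.

Lemma scaled_derivation (L : fieldType) (D : {additive L -> L}) u : leibniz D ->
  exists D' : {additive L -> L}, leibniz D' /\ forall x, D' x = u * D x.
Proof.
move=> DL; pose D' x := u * D x.
have D'B : zmod_morphism D' by move=> x y; rewrite /D' raddfB mulrBr.
pose m1 := GRing.isZmodMorphism.Build _ _ D' D'B.
pose Da : {additive L -> L} := HB.pack D' m1.
by exists Da; split=> // x y /=; rewrite /D' DL; ring.
Qed.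

Definition lint (x : lau F) := exists f, x = f%:F.
Lemma lintM x y : lint x -> lint y -> lint (x * y).
Proof. by move=> [f ->] [g ->]; exists (f * g); rewrite tofracM. Qed.
Lemma lintN x : lint x -> lint (- x).
Proof. by move=> [f ->]; exists (- f); rewrite tofracN. Qed.
Definition ps_deriv (f : ps F) := Ps (fun n => n.+1%:R * pco f n.+1).
Lemma euler_ps_deriv f : (lX F)^-1 * euler f%:F = (ps_deriv f)%:F.
Proof.
rewrite eulerE; apply: (canLR (mulKf (lX_neq0 F))); rewrite -tofracM; congr (_%:F); apply: psP => n.
by rewrite -[psX F]expr1 pco_psXnM; case: n => [|n] /=; rewrite ?mul0r // subSS subn0.
Qed.
Lemma eulerX n : euler (lX F ^+ n) = n%:R * lX F ^+ n.
Proof.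
rewrite (leibnizX eulerL) euler_lX; case: n => [|n] /=; first by rewrite !mul0r.
by rewrite -mulrA -exprSr.
Qed.
Lemma eulerXV n : euler (lX F ^+ n)^-1 = - n%:R / lX F ^+ n.
Proof.
have y0 : lX F ^+ n != 0 by rewrite expf_neq0 ?lX_neq0.
transitivity (euler (1 / lX F ^+ n)); first by rewrite div1r.
rewrite (leibniz_div eulerL) // (leibniz1 eulerL) eulerX mul0r mul1r sub0r.
by rewrite expr2 invfM mulrA -mulNr mulfK.
Qed.
Lemma euler_shift a w m : exists w',
  euler (lX F ^+ a * w%:F / lX F ^+ m) = lX F ^+ a * w'%:F / lX F ^+ m.
Proof.
exists (a%:R * w + ps_euler w - m%:R * w).
have M0 : lX F ^+ m != 0 by rewrite expf_neq0 ?lX_neq0.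
rewrite (leibniz_div eulerL) // eulerL !eulerX eulerE tofracB tofracD !tofracM !(rmorph_nat (@FracField.tofrac _)).
exact: euler_shift_field.
Qed.
(** At x = s^-N the derivation d/dx is -(1/N) s^N (s d/ds), so each application raises the order by
    at least N. *)
Lemma iter_euler_shift N (c : F) (D : lau F -> lau F) w m k :
  (forall x, D x = lC F c * lX F ^+ N * euler x) ->
  exists w', iter k D (w%:F / lX F ^+ m) = lX F ^+ (N * k) * w'%:F / lX F ^+ m.
Proof.
move=> DE; elim: k => [|k [w' IH]]; first by exists w; rewrite muln0 expr0 mul1r.
have [w2 E] := euler_shift (N * k) w' m.
exists (psC c * w2); rewrite iterS IH DE E mulnS exprD tofracM -lCE !mulrA; congr (_ / _ ); ring.
Qed.
Lemma iter_ps_deriv (D : lau F -> lau F) k w : (forall n, n.+1%:R != 0 :> F) ->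
  (forall x, D x = (lX F)^-1 * euler x) -> iter k D w%:F = 0 -> forall i, (k <= i)%N -> pco w i = 0.
Proof.
move=> char0 DE; elim: k w => [|k IH] w.
  by move=> /eqP; rewrite tofrac_eq0 => /eqP -> i _; rewrite pco0.
rewrite iterSr DE euler_ps_deriv => /IH H [//|i] ki.
by have /eqP := H i ki; rewrite mulf_eq0 (negPf (char0 i)) => /eqP.
Qed.

(** Power series are integrally closed: for a root 1/f with f(0) = 0, multiplying the equation by
    f^n leaves 1 plus terms divisible by f. *)
Lemma lint_monic_root (Q : {poly lau F}) r : Q \is monic ->
  (forall i, lint Q`_i) -> root Q r -> lint r.
Proof.
move=> Qm Qi /rootP Qr; case: (lau_integral r) => [//|[f [f0 [fn0 rE]]]].
case E: (size Q) => [|n]; first by have := monic_neq0 Qm; rewrite -size_poly_eq0 E.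
have Qn : Q`_n = 1 by have := monicP Qm; rewrite lead_coefE E.
have [g gE] : exists g : 'I_n -> ps F, forall i : 'I_n, Q`_i = (g i)%:F.
  by exists (fun i => sval (cid (Qi i))) => i; exact: svalP (cid (Qi i)).
have f1 : f%:F != 0 :> lau F by rewrite tofrac_eq0.
have : (\sum_(i < n) g i * f ^+ (n - i) + 1)%:F = 0 :> lau F.
  move: Qr; rewrite (@horner_coef_wide _ n.+1) ?E // big_ord_recr /= Qn mul1r.
  move=> /(congr1 (fun x => x * f%:F ^+ n)); rewrite mul0r mulrDl rE exprVn mulVf ?expf_neq0 // => <-.
  rewrite tofracD tofrac1 (big_morph _ (@tofracD _) (tofrac0 _)) mulr_suml; congr (_ + _).
  apply: eq_bigr => i _; rewrite tofracM tofracXn gE -mulrA; congr (_ * _).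
  rewrite exprVn; apply: (canRL (mulKf _)); first by rewrite expf_neq0.
  by rewrite -exprD subnKC // ltnW.
move/eqP; rewrite tofrac_eq0 => /eqP /(congr1 (fun h => pco h 0)); rewrite pcoD pco1 pco0.
rewrite (big_morph (fun h => pco h 0) (fun a b => pcoD a b 0) (pco0 F 0)).
rewrite big1 => [/eqP|i _]; first by rewrite add0r oner_eq0.
by rewrite pcoM0 pcoX0 f0 expr0n subn_eq0 leqNgt ltn_ord mulr0.
Qed.

Lemma common_denom (xs : seq (lau F)) : exists m, forall x, x \in xs -> exists w, x = w%:F / lX F ^+ m.
Proof.
elim: xs => [|x xs [m H]]; first by exists 0%N.
have [m' [w xE]] := lau_denom x; exists (m' + m)%N => y; rewrite inE => /predU1P[->|/H [v ->]].
  exists (w * psX F ^+ m); rewrite xE tofracM tofracXn exprD -mulf_div divff ?mulr1 //.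
  by rewrite expf_neq0 ?lX_neq0.
exists (psX F ^+ m' * v); rewrite tofracM tofracXn exprD -mulf_div divff ?mul1r //.
by rewrite expf_neq0 ?lX_neq0.
Qed.
End Euler.
Arguments euler {F}.

Lemma irreducible_coprime_deriv (L : fieldType) (Q : {poly L}) :
  (forall n, n.+1%:R != 0 :> L) -> irreducible_poly Q -> coprimep Q Q^`().
Proof.
move=> char0 [sQ irrQ]; have Q0 : Q != 0 by rewrite -size_poly_gt0 (ltn_trans _ sQ).
have dQ : Q^`() != 0.
  apply/eqP => H; have := congr1 (fun p : {poly L} => p`_(size Q).-2) H; rewrite coef_deriv coef0 => /eqP.
  rewrite -mulr_natl mulf_eq0 (negPf (char0 _)) /=.
  by rewrite prednK -?lead_coefE ?lead_coef_eq0 ?(negPf Q0) // -subn1 subn_gt0.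
apply: contraT => /negP ncop; have /irrQ H : size (gcdp Q Q^`()) != 1%N by apply/negP.
have /eqp_size sE := H (dvdp_gcdl _ _).
have := dvdp_leq dQ (dvdp_gcdr Q Q^`()); rewrite sE leqNgt.
by rewrite lt_size_deriv.
Qed.

(** Multiplying a root by d turns Q into the equation with coefficients Q_i d^(n-i), which are
    integral once d is a common denominator. *)
Lemma scaled_root (k L : fieldType) (phi : {rmorphism k -> L}) (Q : {poly k}) (d : k) r n :
  size Q = n.+1 -> root (map_poly phi Q) r ->
  root (\poly_(i < n.+1) phi (Q`_i * d ^+ (n - i))) (phi d * r).
Proof.
move=> sQ /rootP Qr; rewrite rootE horner_poly.
have -> : \sum_(i < n.+1) phi (Q`_i * d ^+ (n - i)) * (phi d * r) ^+ i = phi d ^+ n * (map_poly phi Q).[r].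
  rewrite (@horner_coef_wide _ n.+1 (map_poly phi Q)) ?size_map_poly ?sQ // mulr_sumr.
  apply: eq_bigr => i _; rewrite coef_map rmorphM rmorphXn exprMn.
  have -> : phi d ^+ n = phi d ^+ (n - i) * phi d ^+ i by rewrite -exprD subnK // -ltnS.
  ring.
by rewrite Qr mulr0.
Qed.

Lemma scaled_monic (k L : fieldType) (phi : {rmorphism k -> L}) (Q : {poly k}) (d : k) n :
  size Q = n.+1 -> Q \is monic ->
  \poly_(i < n.+1) phi (Q`_i * d ^+ (n - i)) \is monic.
Proof.
move=> sQ Qm; have Qn : Q`_n = 1 by have := monicP Qm; rewrite lead_coefE sQ.
rewrite monicE lead_coefE size_poly_eq; last by rewrite subnn expr0 mulr1 Qn rmorph1 oner_eq0.
by rewrite coef_poly ltnSn subnn expr0 mulr1 Qn rmorph1.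
Qed.

(** * Unramified polynomials over C(x) have roots *)

Section SimplyConnected.
Variable R : realType.
Local Notation C := R[i].
Local Notation K := (lau C).
Local Notation lC := (lC C).
Local Notation lX := (lX C).
Implicit Types (f g U : ratf R) (Q : {poly ratf R}) (w z : option C) (t : K).

Lemma ratf_natr_neq0 n : n.+1%:R != 0 :> ratf R.
Proof. by rewrite -(rmorph_nat (rC R)) fmorph_eq0 pnatr_eq0. Qed.

Lemma poly_deriv_leibniz (p q : {poly C}) : deriv (p * q) = deriv p * q + p * deriv q.
Proof. exact: derivM. Qed.
Definition ratf_deriv : {additive ratf R -> ratf R} := sval (cid (frac_derivation poly_deriv_leibniz)).
Lemma ratf_derivL : leibniz ratf_deriv. Proof. by rewrite /ratf_deriv; case: cid => D []. Qed.
Lemma ratf_derivE (p : {poly C}) : ratf_deriv p%:F = (p^`())%:F.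
Proof. by rewrite /ratf_deriv; case: cid => D []. Qed.

Lemma lint_emb_poly phi (c : C) (p : {poly C}) : emb lC phi (loc (Some c) 1) -> lint (phi p%:F).
Proof.
move=> ph; rewrite (emb_poly _ ph); exists (map_poly (@psC C) p).[psC c + psX C].
by rewrite -horner_psF tofracD.
Qed.

(** A nonconstant function takes the value infinity somewhere, which is excluded at finite points
    and at infinity; a constant vanishing at infinity is zero. *)
Lemma no_poles_eq0 f phi k : (0 < k)%N -> emb lC phi (loc None k) ->
  (forall c psi, emb lC psi (loc (Some c) 1) -> lint (psi f)) ->
  (exists x, phi f = (psX C * x)%:F) -> f = 0.
Proof.
move=> k0 ph fin [x xE]; have [fn|/nonconstP [a fa]] := boolP (nonconst f); last first.
  move: xE; rewrite fa ph.1 lCE => /eqP; rewrite tofrac_eq => /eqP /(congr1 (fun h => pco h 0)).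
  by rewrite pcoM0 mul0r /= => ->; rewrite rmorph0.
have nolint z n psi t : (0 < n)%N -> ltype z n t -> emb lC psi t -> evalr f z = None -> ~ lint (psi f).
  move=> n0 tT ps fz [y yE]; have [l0 []] := ltype_ratf n0 fn ps tT; rewrite fz => u [u0 E].
  have nl : (0 < n * locdeg f z)%N by rewrite muln_gt0 n0.
  by have := near_pt_inf_nint y nl u0; rewrite -E yE eqxx.
have : fiber f None <> [::].
  by move=> E; have := sum_fiber None fn; rewrite E big_nil => /esym E'; move: fn; rewrite /nonconst E'.
case E: (fiber f None) => [//|z s] _; have : z \in fiber f None by rewrite E mem_head.
rewrite mem_fiber // => /eqP fz; case: z {E} fz => [c|] fz.
  have [psi ps] := emb_ltype_ex (ltn0Sn 0) (ltype_loc (Some c) 1).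
  by case: (nolint _ _ _ _ (ltn0Sn 0) (ltype_loc (Some c) 1) ps fz); exact: fin ps.
by case: (nolint _ _ _ _ k0 (ltype_loc None k) ph fz); exists (psX C * x).
Qed.

Lemma clear_denominators Q : exists d : {poly C}, d != 0 /\
  forall i n, (i < n)%N -> exists p : {poly C}, Q`_i * d%:F ^+ (n - i) = p%:F.
Proof.
exists (\prod_(j < size Q) rden Q`_j); split.
  by apply/prodf_neq0 => j _; exact: rden_neq0.
move=> i n ni; have [si|si] := ltnP i (size Q); last first.
  by exists 0; rewrite nth_default // mul0r tofrac0.
rewrite (bigD1 (Ordinal si)) //=; set e := \prod_(_ | _) _.
exists (rnum Q`_i * e * (rden Q`_i * e) ^+ (n - i.+1)).
rewrite -[(n - i)%N]prednK ?subn_gt0 // -subnS exprS !tofracM tofracXn mulrA; congr (_ * _).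
rewrite {1}[Q`_i]ratfE mulrA divfK ?tofrac_eq0 ?rden_neq0 //.
by rewrite tofracM.
Qed.

Lemma monic_eqp_prod (L : fieldType) (p : {poly L}) rs : p \is monic ->
  p %= \prod_(r <- rs) ('X - r%:P) -> p = \prod_(r <- rs) ('X - r%:P).
Proof.
move=> pm pE; have := eqp_eq pE; rewrite (monicP (monic_prod_XsubC _ _ _)) (monicP pm).
by rewrite !scale1r.
Qed.

(* Along the roots y of Q, d/dx raises the order at infinity and keeps y integral
   at finite points; the norm of a high derivative of d y is then a rational
   function without poles vanishing at infinity, so d y is a polynomial in x. *)
Lemma unramified_root Q N : Q \is monic -> irreducible_poly Q -> (0 < N)%N ->
  (forall c : C, spl Q (Some c) 1) -> spl Q None N -> exists r, root Q r.
Proof.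
move=> Qm Qirr N0 spf spi.
have Qcop := irreducible_coprime_deriv ratf_natr_neq0 Qirr.
have [[u v] /= uvE] := Bezout_eq1_coprimepP _ _ Qcop.
have [d [d0 dE]] := clear_denominators Q.
have d1 : d%:F != 0 :> ratf R by rewrite tofrac_eq0.
(* Differentiating Q(r) = 0 gives r' = - Q^d(r) / Q'(r), with Q^d the coefficientwise derivative.
   Since v inverts Q' modulo Q, this is r' = g(r). *)
pose g := - v * map_poly ratf_deriv Q.
(* [fk k] expresses the k-th x-derivative of d r as a polynomial in r. *)
pose fk k : {poly ratf R} := iter k (fun f : {poly ratf R} => map_poly ratf_deriv f + f^`() * g) (d%:F *: 'X).
have uniq_roots (phi : {rmorphism ratf R -> K}) (rs : seq K) : map_poly phi Q = \prod_(r <- rs) ('X - r%:P) -> uniq rs.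
  move=> E; rewrite -separable_prod_XsubC -E separable_map.
  by rewrite separable_poly.unlock.
have iterD phi t (D : {additive K -> K}) r k : emb lC phi t -> leibniz D ->
    (forall a, D (lC a) = 0) -> D t = 1 -> root (map_poly phi Q) r ->
    iter k D (phi d%:F * r) = (map_poly phi (fk k)).[r].
  move=> ph DL DC Dt /rootP Qr.
  have ch (f : {poly ratf R}) := deriv_horner ratf_derivL ratf_derivE DL ph DC Dt f r.
  have Dr : D r = (map_poly phi g).[r].
    have E1 : (map_poly phi v).[r] * (map_poly phi Q^`()).[r] = 1.
      have := congr1 (fun p => (map_poly phi p).[r]) uvE.
      by rewrite (rmorphD (map_poly phi)) !(rmorphM (map_poly phi)) (rmorph1 (map_poly phi)) hornerD !hornerM hornerC Qr mulr0 add0r.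
    have := ch Q; rewrite Qr raddf0 => /esym/eqP; rewrite addrC addr_eq0 => /eqP E2.
    rewrite /g rmorphM rmorphN /= hornerM hornerN mulNr -mulrN -E2.
    by rewrite mulrA E1 mul1r.
  elim: k => [|k IH]; first by rewrite /= map_polyZ map_polyX hornerZ hornerX.
  have -> : fk k.+1 = map_poly ratf_deriv (fk k) + (fk k)^`() * g by [].
  clearbody g; rewrite iterS IH ch Dr (rmorphD (map_poly phi)) (rmorphM (map_poly phi)).
  by rewrite hornerD [in RHS]hornerM.
have Dloc (a : C) n : exists D : {additive K -> K}, [/\ leibniz D, forall c, D (lC c) = 0 &
    forall x, D x = lC a * lX ^+ n * euler x].
  have [D [DL DE]] := scaled_derivation (lC a * lX ^+ n) (@eulerL C).
  by exists D; split => // c; rewrite DE euler_lC mulr0.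
have [phi0 [ph0 [rs0 rs0E]]] := spi.
have {}rs0E := monic_eqp_prod (monic_map phi0 Qm) rs0E.
have us0 := uniq_roots _ _ rs0E.
have [m mE] := common_denom [seq phi0 d%:F * r | r <- rs0].
(* At infinity the d r have poles of order at most m in s, and each derivative gains N >= 1, so m +
   1 derivatives make them vanish there. *)
set k := m.+1.
(* The constant coefficient of [H] is, up to sign, the norm of the k-th derivative of d r. *)
have [H [Hm HE]] := root_transform (fk k) Qm.
have H0 (phi : {rmorphism ratf R -> K}) (rs : seq K) : map_poly phi Q = \prod_(r <- rs) ('X - r%:P) ->
    phi H`_0 = \prod_(r <- rs) - (map_poly phi (fk k)).[r].
  move=> E; rewrite -coef_map -horner_coef0 (HE _ _ _ (uniq_roots _ _ E) E) horner_prod.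
  by apply: eq_bigr => r _; rewrite hornerXsubC sub0r.
have finD c phi : emb lC phi (loc (Some c) 1) -> exists D : {additive K -> K},
    [/\ leibniz D, forall c, D (lC c) = 0, D (loc (Some c) 1) = 1 &
    forall x, D x = lX^-1 * euler x].
  move=> ph; have [D [DL DE]] := scaled_derivation lX^-1 (@eulerL C).
  have DC a : D (lC a) = 0 by rewrite DE euler_lC mulr0.
  exists D; split=> //.
  by rewrite /loc /near_pt raddfD DC add0r DE expr1 euler_lX mulVf ?lX_neq0.
have int0 c phi r : emb lC phi (loc (Some c) 1) -> root (map_poly phi Q) r -> lint (phi d%:F * r).
  move=> ph Qr; set n := (size Q).-1.
  have sQ : size Q = n.+1 by rewrite prednK // (ltn_trans _ Qirr.1).
  apply: lint_monic_root (scaled_monic phi d%:F sQ Qm) _ (scaled_root d%:F sQ Qr) => i.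
  rewrite coef_poly; case: ltnP => [ni|_]; last by exists 0; rewrite tofrac0.
  move: ni; rewrite ltnS leq_eqVlt => /predU1P[->|ni].
    exists 1; rewrite subnn expr0 mulr1 -[n]/((n.+1).-1) -sQ -lead_coefE (monicP Qm).
    by rewrite rmorph1 tofrac1.
  by have [p ->] := dE _ _ ni; exact: lint_emb_poly ph.
have nu0 : H`_0 = 0.
  apply: (no_poles_eq0 N0 ph0) => [c psi ps|].
    have [phi [ph [rs rsE]]] := spf c.
    rewrite (emb_uniq ps ph); have {}rsE := monic_eqp_prod (monic_map phi Qm) rsE.
    rewrite (H0 _ _ rsE) big_seq; elim/big_rec: _ => [|r x rrs xi]; first by exists 1; rewrite tofrac1.
    apply: lintM xi; apply: lintN.
    have [D [DL DC D1 DE]] := finD _ _ ph.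
    have Qr : root (map_poly phi Q) r by rewrite rsE root_prod_XsubC.
    rewrite -(iterD _ _ _ _ _ ph DL DC D1 Qr).
    elim: (k) => [|j [w wE]]; first exact: int0 ph Qr.
    by rewrite iterS wE DE euler_ps_deriv; eexists.
  have [D [DL DC DE]] := Dloc (- (N%:R)^-1) N.
  have N1 : N%:R != 0 :> C by rewrite pnatr_eq0 -lt0n.
  have D1 : D (loc None N) = 1.
    rewrite DE /loc /near_pt eulerXV rmorphN fmorphV rmorph_nat.
    have LN1 : N%:R != 0 :> K by rewrite -(rmorph_nat lC) fmorph_eq0.
    rewrite mulrACA mulfV ?expf_neq0 ?lX_neq0 // mulr1 mulrNN mulVf //.
  have vanish r : r \in rs0 -> exists x, (map_poly phi0 (fk k)).[r] = (psX C * x)%:F.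
    move=> rrs; have Qr : root (map_poly phi0 Q) r by rewrite rs0E root_prod_XsubC.
    rewrite -(iterD _ _ _ _ _ ph0 DL DC D1 Qr).
    have [|w ->] := mE (phi0 d%:F * r); first by apply/mapP; exists r.
    have [w' ->] := iter_euler_shift w m k DE.
    have [e ->] : exists e, (N * k = m + e.+1)%N.
      exists (N * k - m.+1)%N; rewrite addnS -addSn subnKC //.
      by rewrite /k -{1}[m.+1]mul1n leq_mul2r N0 orbT.
    exists (psX C ^+ e * w'); rewrite mulrA -exprS tofracM tofracXn exprD -mulrA mulrC -!mulrA.
    by rewrite mulKf ?expf_neq0 ?lX_neq0 // mulrC.
  rewrite (H0 _ _ rs0E).
  have : rs0 != [::].
    apply: contraTneq Qirr.1 => E; have := size_map_poly phi0 Q.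
    by rewrite rs0E E big_nil size_poly1 => <-.
  case: (rs0) vanish => [//|r1 rs1] vanish _.
  rewrite big_cons; have [x ->] := vanish r1 (mem_head _ _).
  have [y yE] : lint (\prod_(j <- rs1) - (map_poly phi0 (fk k)).[j]).
    rewrite big_seq; elim/big_rec: _ => [|r y rrs yi]; first by exists 1; rewrite tofrac1.
    apply: lintM yi; apply: lintN.
    by have [|y' ->] := vanish r; [rewrite inE rrs orbT | eexists].
  by exists (- x * y); rewrite yE -tofracN -tofracM mulrA mulrN.
(* A zero norm makes one root r over x = 0 have vanishing k-th derivative of d r, so the expansion
   of d r in x is a polynomial [p] and r = p / d. *)
have [phi [ph [rs rsE]]] := spf 0.
have {}rsE := monic_eqp_prod (monic_map phi Qm) rsE.
have := H0 _ _ rsE; rewrite nu0 rmorph0 => /esym/eqP; rewrite prodf_seq_eq0 => /hasP [r0 r0rs].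
rewrite oppr_eq0 => /eqP fr0.
have Qr0 : root (map_poly phi Q) r0 by rewrite rsE root_prod_XsubC.
have [D [DL DC D1 DE]] := finD _ _ ph.
have [w wE] := int0 _ _ _ ph Qr0.
move: fr0; rewrite -(iterD _ _ _ _ _ ph DL DC D1 Qr0) wE.
move=> /(iter_ps_deriv (fun n => _) DE) H1.
have {H1} wi : forall i, (k <= i)%N -> pco w i = 0 by apply: H1 => n; rewrite pnatr_eq0.
pose p : {poly C} := \poly_(i < k) pco w i.
have phX : phi (idr R) = lX by rewrite ph.2 /loc /near_pt rmorph0 add0r expr1.
have pE : phi p%:F = w%:F.
  rewrite (emb_poly _ ph) -ph.2 phX horner_psF; congr (_%:F); apply: psP => n.
  by rewrite horner_psX coef_poly; case: ltnP => // kn; rewrite wi.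
exists (p%:F / d%:F); rewrite -(fmorph_root phi).
have -> : phi (p%:F / d%:F) = r0.
  by rewrite fmorph_div pE -wE mulrAC divff ?mul1r // fmorph_eq0.
exact: Qr0.
Qed.
End SimplyConnected.

Lemma irreducible_factor (L : fieldType) (Q : {poly L}) : (1 < size Q)%N ->
  exists P, [/\ P \is monic, irreducible_poly P & P %| Q].
Proof.
have [n] := ubnP (size Q); elim: n Q => // n IH Q sQ Q1.
have Q0 : Q != 0 by rewrite -size_poly_gt0 (ltn_trans _ Q1).
have [irr|nirr] := pselect (irreducible_poly Q).
  exists ((lead_coef Q)^-1 *: Q); have l0 : (lead_coef Q)^-1 != 0 by rewrite invr_eq0 lead_coef_eq0.
  split; first by rewrite monicE lead_coefZ mulVf // lead_coef_eq0.
    split=> [|q q1]; first by rewrite size_scale.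
    rewrite dvdpZr // => /(irr.2 q q1) qQ.
    by rewrite (eqp_trans qQ) // eqp_sym eqp_scale.
  by rewrite dvdpZl.
have [q [q1 qQ nqQ]] : exists q : {poly L}, [/\ size q != 1%N, q %| Q & ~~ (q %= Q)].
  apply: contrapT => H; apply: nirr; split => // q q1 qQ.
  by apply: contrapT => /negP nq; apply: H; exists q.
have q0 : q != 0 by apply: contraTneq qQ => ->; rewrite dvd0p.
have sq : (1 < size q)%N by rewrite ltn_neqAle eq_sym q1 size_poly_gt0.
have sqQ : (size q < size Q)%N.
  by rewrite ltn_neqAle dvdp_leq // andbT dvdp_size_eqp.
have [|P [Pm Pirr Pq]] := IH q _ sq; first exact: leq_trans sqQ _.
by exists P; split => //; apply: dvdp_trans qQ.
Qed.

(** * Lifting through rational functions *)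

Section Lifting.
Variable R : realType.
Local Notation C := R[i].
Implicit Types (f g U F : ratf R) (Q : {poly ratf R}) (a b w : option C).

Lemma unramified_splits Q N : Q != 0 -> (0 < N)%N ->
  (forall c : C, spl Q (Some c) 1) -> spl Q None N -> splits Q.
Proof.
have [n] := ubnP (size Q); elim: n Q => // n IH Q sQ Q0 N0 spf spi.
have [Q1|Q1] := leqP (size Q) 1.
  exists [::]; rewrite big_nil -size_poly_eq1 eqn_leq Q1 size_poly_gt0 //.
have [P [Pm Pirr PQ]] := irreducible_factor Q1.
have [|r Pr] := unramified_root Pm Pirr N0 (fun c => spl_dvd PQ (spf c)).
  exact: spl_dvd PQ spi.
have /factor_theorem [Q' QE] : root Q r by rewrite -dvdp_XsubCl (dvdp_trans _ PQ) // dvdp_XsubCl.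
have Q'0 : Q' != 0 by apply: contraNneq Q0 => E; rewrite QE E mul0r.
have Q'Q : Q' %| Q by rewrite QE dvdp_mulr.
rewrite QE; apply: splits_mul; last by exists [:: r]; rewrite big_seq1 eqpxx.
apply: IH => //; last exact: spl_dvd Q'Q spi.
  by move: sQ; rewrite QE size_mul ?polyXsubC_eq0 // size_XsubC addn2.
by move=> c; apply: spl_dvd Q'Q (spf c).
Qed.

Lemma splits_root (L : fieldType) (p : {poly L}) : splits p -> (1 < size p)%N -> exists r, root p r.
Proof.
move=> [[|r rs] pE] p1; first by rewrite (eqp_size pE) big_nil size_poly1 in p1.
by exists r; rewrite (eqp_prod_root _ pE) mem_head.
Qed.

(* The sphere is simply connected: a map that U could only cover without ramification lifts through U. *)
Lemma unramified_lift U F : nonconst U -> nonconst F ->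
  (forall z y, evalr U y = evalr F z -> locdeg U y %| locdeg F z)%N ->
  splits (fibp (@rC R) U F).
Proof.
move=> Un Fn dv; have sP : size (fibp (@rC R) U F) = (rdeg U).+1.
  by apply: size_fibp => a; exact: nonconst_neq.
have S z : spl (fibp (@rC R) U F) z 1.
  by apply: spl_fibp => // y yz; rewrite mul1n dv.
by apply: (@unramified_splits _ 1) => //; rewrite -size_poly_gt0 sP.
Qed.

Lemma unramified_lfactor U F : nonconst U -> nonconst F ->
  (forall z y, evalr U y = evalr F z -> locdeg U y %| locdeg F z)%N ->
  exists V, F = rcomp U V /\ nonconst V.
Proof.
move=> Un Fn dv; have [|V Vr] := splits_root (unramified_lift Un Fn dv).
  by rewrite size_fibp // => a; exact: nonconst_neq.
by exists V; exact: root_fibp.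
Qed.

Section Reduced.
Variables (p q : {poly C}).
Hypotheses (q0 : q != 0) (pq : coprimep p q).
Let f : ratf R := p%:F / q%:F.

Definition fibq w := if w is Some c then p - c *: q else q.

Lemma fib_poly_reduced w : exists2 c, c != 0 & fib_poly f w = c *: fibq w.
Proof.
have [c [c0 pE qE]] := ratf_reduced q0 pq; exists c => //.
by case: w => [a|] /=; rewrite ?pE qE // scalerBr !scalerA mulrC.
Qed.
Lemma evalr_reduced_fin z :
  evalr f (Some z) = if q.[z] == 0 then None else Some (p.[z] / q.[z]).
Proof.
have [c [c0 pE qE]] := ratf_reduced q0 pq; rewrite /evalr pE qE !hornerZ mulf_eq0 (negPf c0) /=.
by case: ifP => // _; rewrite -mulf_div mulfV // mul1r.
Qed.
Lemma evalr_reduced_inf :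
  evalr f None = if (size q < size p)%N then None
    else if (size p < size q)%N then Some 0 else Some (lead_coef p / lead_coef q).
Proof.
have [c [c0 pE qE]] := ratf_reduced q0 pq; rewrite /evalr pE qE !size_scale //.
by case: ifP => // _; case: ifP => // _; rewrite !lead_coefZ -mulf_div mulfV // mul1r.
Qed.
Lemma mupZ (c a : C) (g : {poly C}) : c != 0 -> mup a (c *: g) = mup a g.
Proof. by move=> c0; rewrite -mul_polyC mupMr // rootC. Qed.
Lemma locdeg_reduced_fin z : locdeg f (Some z) = mup z (fibq (evalr f (Some z))).
Proof.
by rewrite /locdeg; have [c c0 ->] := fib_poly_reduced (evalr f (Some z)); rewrite mupZ.
Qed.
Lemma locdeg_reduced_inf :
  locdeg f None = ((maxn (size p) (size q)).-1 - (size (fibq (evalr f None))).-1)%N.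
Proof.
rewrite /locdeg rdeg_reduced //.
by have [c c0 ->] := fib_poly_reduced (evalr f None); rewrite size_scale.
Qed.
End Reduced.

Lemma rdeg1_bij f : rdeg f = 1%N ->
  (forall z, locdeg f z = 1%N) /\ injective (evalr f).
Proof.
move=> f1; have fn : nonconst f by rewrite /nonconst f1.
have H w : exists z, fiber f w = [:: z] /\ locdeg f z = 1%N.
  have := sum_fiber w fn; rewrite f1; case: (fiber f w) => [|z [|z' s]]; rewrite ?big_nil ?big_seq1 //.
    by exists z.
  by rewrite !big_cons; have := locdeg_gt0 z fn; have := locdeg_gt0 z' fn; lia.
split=> [z|z z' zz'].
  have [y [yE y1]] := H (evalr f z); have : z \in fiber f (evalr f z) by rewrite mem_fiber.
  by rewrite yE inE => /eqP ->.
have [y [yE y1]] := H (evalr f z); have : z \in fiber f (evalr f z) by rewrite mem_fiber.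
have : z' \in fiber f (evalr f z) by rewrite mem_fiber // zz'.
by rewrite yE !inE => /eqP -> /eqP ->.
Qed.

Definition mob (al be ga de : C) : ratf R := (al *: 'X + be%:P)%:F / (ga *: 'X + de%:P)%:F.

Lemma mobP al be ga de : al * de - be * ga != 0 ->
  [/\ rdeg (mob al be ga de) = 1%N,
      forall z, evalr (mob al be ga de) (Some z) =
        if ga * z + de == 0 then None else Some ((al * z + be) / (ga * z + de)) &
      evalr (mob al be ga de) None = if ga == 0 then None else Some (al / ga)].
Proof.
move=> det; set p := al *: 'X + be%:P; set q := ga *: 'X + de%:P.
have hE (x y z : C) : (x *: 'X + y%:P).[z] = x * z + y by rewrite hornerD hornerZ hornerX hornerC.
have q0 : q != 0.
  apply: contraNneq det => qE; have := hE ga de 0; have := hE ga de 1; rewrite -/q qE !horner0 mulr1 mulr0 add0r.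
  by move=> H1 d0; move: H1; rewrite -d0 addr0 => <-; rewrite !mulr0 subrr.
have pq : coprimep p q.
  apply/coprimepP => d dp dq; rewrite -size_poly_eq1; apply/negPn/negP => sd.
  have d0 : d != 0 by apply: contraTneq dq => ->; rewrite dvd0p.
  have [z rz] : exists z, root d z by apply/closed_rootP.
  move: rz; rewrite -dvdp_XsubCl => rz; have := dvdp_trans rz dq; have := dvdp_trans rz dp.
  rewrite !dvdp_XsubCl !rootE !hE => /eqP E2 /eqP E1.
  move/negP: det; apply; have [g0|g0] := eqVneq ga 0.
    by move: E1; rewrite g0 mul0r add0r => ->; rewrite !mulr0 subrr.
  have zE : z = - de / ga by apply: (mulfI g0); rewrite mulrCA mulfV // mulr1; apply/eqP; rewrite -addr_eq0 E1.
  apply/eqP; move: E2; rewrite zE => /(congr1 (fun x => x * - ga)); rewrite mul0r => <-.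
  by field.
have sz (x y : C) : size (x *: 'X + y%:P) = if x == 0 then (y != 0 : nat) else 2%N.
  case: eqP => [->|/eqP x0]; first by rewrite scale0r add0r size_polyC.
  by rewrite size_polyDl size_scale ?size_polyX // size_polyC; case: (y != 0).
split.
- rewrite rdeg_reduced // !sz; case: (eqVneq al 0) => [a0|_]; case: (eqVneq ga 0) => [g0|_].
  + by case/negP: det; rewrite a0 g0 mul0r mulr0 subrr.
  + by case: (be != 0).
  + by case: (de != 0).
  + by [].
- by move=> z; rewrite evalr_reduced_fin // !hE.
- rewrite evalr_reduced_inf // !sz; case: (eqVneq ga 0) => [g0|g0].
    case: (eqVneq al 0) => [a0|a0]; first by case/negP: det; rewrite a0 g0 mul0r mulr0 subrr.
    by case: (de != 0).
  case: (eqVneq al 0) => [a0|a0]; first by rewrite a0 mul0r; case: (be != 0).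
  congr (Some (_ / _)); rewrite lead_coefDl ?lead_coefZ ?lead_coefX ?mulr1 //;
    by rewrite size_scale // size_polyX size_polyC; case: (_ != 0).
Qed.

Lemma mobius3 w1 w2 w3 : w1 != w2 -> w2 != w3 -> w1 != w3 -> exists M : ratf R,
  [/\ rdeg M = 1%N, evalr M (Some 0) = w1, evalr M (Some 1) = w2 & evalr M None = w3].
Proof.
case: w1 => [w1|]; case: w2 => [w2|]; case: w3 => [w3|] // n12 n23 n13;
 rewrite ?(inj_eq Some_inj) in n12 n23 n13.
- have g0 : w2 - w1 != 0 by rewrite subr_eq0 eq_sym.
  have d0 : w3 - w2 != 0 by rewrite subr_eq0 eq_sym.
  have D : w3 * (w2 - w1) * (w3 - w2) - w1 * (w3 - w2) * (w2 - w1) != 0.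
    have -> : w3 * (w2 - w1) * (w3 - w2) - w1 * (w3 - w2) * (w2 - w1) = (w3 - w1) * ((w2 - w1) * (w3 - w2)) by ring.
    by rewrite !mulf_neq0 // subr_eq0 eq_sym.
  have [M1 ME MI] := mobP D; exists (mob (w3 * (w2 - w1)) (w1 * (w3 - w2)) (w2 - w1) (w3 - w2)); split => //.
  + by rewrite ME !mulr0 !add0r (negPf d0) mulfK.
  + have s0 : w2 - w1 + (w3 - w2) != 0 by rewrite addrC addrA subrK subr_eq0 eq_sym.
    rewrite ME !mulr1 (negPf s0); congr Some; apply: (mulIf s0); rewrite divfK //; ring.
  + by rewrite MI (negPf g0) mulfK.
- have D : (w2 - w1) * 1 - w1 * 0 != 0 by rewrite mulr1 mulr0 subr0 subr_eq0 eq_sym.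
  have [M1 ME MI] := mobP D; exists (mob (w2 - w1) w1 0 1); split => //.
  + by rewrite ME !mulr0 !add0r (negPf (oner_neq0 _)) divr1.
  + by rewrite ME !mulr1 add0r (negPf (oner_neq0 _)) divr1 subrK.
  + by rewrite MI eqxx.
- have D : w3 * (-1) - (- w1) * 1 != 0.
    by rewrite mulrN1 mulr1 opprK addrC subr_eq0.
  have [M1 ME MI] := mobP D; exists (mob w3 (- w1) 1 (-1)); split => //.
  + by rewrite ME !mulr0 !add0r oppr_eq0 (negPf (oner_neq0 _)) divrNN divr1.
  + by rewrite ME mulr1 subrr eqxx.
  + by rewrite MI (negPf (oner_neq0 _)) divr1.
- have D : w3 * 0 - (w2 - w3) * 1 != 0 by rewrite mulr0 mulr1 sub0r oppr_eq0 subr_eq0.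
  have [M1 ME MI] := mobP D; exists (mob w3 (w2 - w3) 1 0); split => //.
  + by rewrite ME mulr0 addr0 eqxx.
  + by rewrite ME !mulr1 addr0 (negPf (oner_neq0 _)) divr1 addrC subrK.
  + by rewrite MI (negPf (oner_neq0 _)) divr1.
Qed.

Lemma third_point a b : exists c : option C, a != c /\ c != b.
Proof.
have [c Hc] : exists c, c \notin [:: a; b].
  pose s : seq (option C) := [:: None; Some 0; Some 1].
  have /allPn [c _ Hc] : ~~ all (mem [:: a; b]) s; last by exists c.
  apply/negP => /allP H; have us : uniq s by rewrite /= !inE /= (inj_eq Some_inj) eq_sym oner_eq0.
  by have := uniq_leq_size us H.
by move: Hc; rewrite !inE negb_or => /andP[ca cb]; exists c; rewrite eq_sym.
Qed.

Definition powr (e : nat) : ratf R := ('X^e)%:F.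
Lemma powrP e : (0 < e)%N -> [/\ rdeg (powr e) = e,
  forall z, evalr (powr e) (Some z) = Some (z ^+ e), evalr (powr e) None = None,
  locdeg (powr e) (Some 0) = e & locdeg (powr e) None = e].
Proof.
move=> e0; have E : powr e = ('X^e)%:F / (1 : {poly C})%:F by rewrite tofrac1 divr1.
have c1 : coprimep ('X^e : {poly C}) 1 by rewrite coprimep1.
have n1 : (1 : {poly C}) != 0 by rewrite oner_neq0.
have I : evalr (powr e) None = None.
  by rewrite E evalr_reduced_inf // size_polyXn size_poly1 ltnS e0.
have F z : evalr (powr e) (Some z) = Some (z ^+ e).
  by rewrite E evalr_reduced_fin // hornerC oner_eq0 hornerXn divr1.
split => //.
- by rewrite E rdeg_reduced // size_polyXn size_poly1 (maxn_idPl _).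
- rewrite E locdeg_reduced_fin // -E F expr0n gtn_eqF //= scale0r subr0.
  by rewrite -['X]subr0 mup_XsubCX eqxx.
- by rewrite E locdeg_reduced_inf // -E I /= size_polyXn size_poly1 (maxn_idPl _) // subn0.
Qed.

(* A cover ramified over at most two points is cyclic, so both indices agree. *)
Lemma two_point_ram Q a b e : Q != 0 -> a != b -> (0 < e)%N ->
  (forall w, exists k, (0 < k)%N /\ spl Q w k) ->
  (forall w, w != a -> w != b -> spl Q w 1) -> spl Q a e -> spl Q b e.
Proof.
move=> Q0 ab e0 ex un sa; have [c [ac cb]] := third_point a b.
have [M [M1 M0 _ MI]] := mobius3 ac cb ab.
have Mn : nonconst M by rewrite /nonconst M1.
have [Ml Minj] := rdeg1_bij M1.
have [Pd PE PI P0 Pinf] := powrP e0.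
have Pn : nonconst (powr e) by rewrite /nonconst Pd.
(* [X] is ramified to order e exactly over a and b; pulling back by it removes all ramification at
   finite points, hence all ramification. *)
pose X := rcomp M (powr e); have Xn : nonconst X by exact: nonconst_comp.
have XI : evalr X None = b /\ locdeg X None = e.
  by rewrite evalr_comp // locdeg_comp // PI Pinf Ml muln1 MI.
have X0 : evalr X (Some 0) = a /\ locdeg X (Some 0) = e.
  by rewrite evalr_comp // locdeg_comp // PE P0 Ml muln1 expr0n gtn_eqF.
have [N [N0 sN]] := ex b.
have sp : splits (pcomp X Q).
  apply: (@unramified_splits _ N) => //; first by rewrite map_poly_eq0.
    move=> z; rewrite spl_pcomp // mul1n; have [->|z0] := eqVneq z 0.
      by rewrite X0.1 X0.2.
    rewrite -[locdeg X _]muln1; apply: spl_mul; first exact: locdeg_gt0.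
    apply: un; rewrite evalr_comp // PE.
      by rewrite -M0 (inj_eq Minj) (inj_eq Some_inj) expf_eq0 (negPf z0) andbF.
    by rewrite -MI (inj_eq Minj).
  rewrite spl_pcomp // XI.1 XI.2 mulnC; exact: spl_mul.
have : spl (pcomp X Q) None 1.
  have [phi ph] := emb_ltype_ex (ltn0Sn 0) (ltype_loc (None : option C) 1).
  by exists phi; split => //; apply: splits_map.
by rewrite spl_pcomp // XI.1 XI.2 mul1n.
Qed.
End Lifting.

Fact clear_denom (k : fieldType) (s b d u a : k) : a != 0 ->
  s * b * (d * u) = b * (d * a) * (s * (u / a)).
Proof. by move=> a0; field. Qed.

(** * Puiseux roots and the genus *)

Section PuiseuxRoots.
Variable R : realType.
Local Notation C := R[i].
Local Notation K := (lau C).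
Local Notation lC := (lC C).
Local Notation lX := (lX C).
Implicit Types (Q : {poly {poly C}}) (x : K) (c : option C) (y : nat * pser R).

Definition lau_of y : K := (Ps y.2)%:F / lX ^+ y.1.

Lemma normalized_inj y y' : normalized y -> normalized y' -> lau_of y = lau_of y' -> y = y'.
Proof.
case: y y' => [m w] [m' w'] /=; rewrite /normalized /lau_of /=.
wlog mm : m m' w w' / (m <= m')%N.
  move=> H; case: (leqP m m') => mm; first exact: H.
  by move=> h1 h2 /esym E; apply/esym; apply: H => //; exact: ltnW.
move=> h1 h2 /eqP; rewrite eqr_div ?expf_neq0 ?lX_neq0 // -!tofracXn -!tofracM tofrac_eq => /eqP.
rewrite -{1}(subnKC mm) exprD mulrCA [RHS]mulrC => /(mulfI (expf_neq0 m (psX_neq0 C))).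
rewrite mulrC => E; have mE : m = m'.
  apply/eqP; rewrite eqn_leq mm -subn_eq0 -leqn0 leqNgt; apply/negP => lt.
  case: h2 => [m'0|]; first by rewrite m'0 in lt.
  by have := congr1 (fun f => pco f 0) E; rewrite (pcoXM0 _ lt) /= => <-; rewrite eqxx.
subst m'; move: E; rewrite subnn expr0 mul1r => E; congr (_, _).
by have := congr1 (@pco _) E.
Qed.

Lemma normalized_ex x : exists y, normalized y /\ lau_of y = x.
Proof.
have [->|/lau_form [k [m [u [u0 ->]]]]] := eqVneq x 0.
  exists (0%N, fun=> 0); split; first by left.
  rewrite /lau_of /= expr0 divr1; apply/eqP; rewrite tofrac_eq0; apply/eqP; exact: psP.
have [mk|km] := leqP m k.
  exists (0%N, pco (psX C ^+ (k - m) * u)); split; first by left.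
  rewrite /lau_of /= expr0 divr1.
  have -> : Ps (pco (psX C ^+ (k - m) * u)) = psX C ^+ (k - m) * u by apply: psP.
  by rewrite tofracM tofracXn expfB_cond ?(negPf (lX_neq0 _)).
exists ((m - k)%N, pco u); split; first by right.
rewrite /lau_of /=; have -> : Ps (pco u) = u by apply: psP.
rewrite expfB_cond ?(negPf (lX_neq0 _)) ?(ltnW km) //.
by rewrite invfM invrK mulrC [_^-1 * _]mulrC.
Qed.

Lemma horner_reverse (L : fieldType) (iota : {rmorphism C -> L}) (p : {poly C}) D t :
  t != 0 -> ((size p).-1 <= D)%N ->
  (map_poly iota (\poly_(i < D.+1) p`_(D - i))).[t] = t ^+ D * (map_poly iota p).[t^-1].
Proof.
move=> t0 sp; rewrite (@horner_coef_wide _ D.+1); last by rewrite size_map_poly size_poly.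
rewrite (@horner_coef_wide _ D.+1 (map_poly iota p)); last by rewrite size_map_poly; case: (size p) sp.
rewrite mulr_sumr (reindex_inj rev_ord_inj) /=; apply: eq_bigr => i _.
have iD : (i <= D)%N by rewrite -ltnS.
rewrite !coef_map coef_poly subSS ltnS leq_subr /= subKn // mulrCA; congr (_ * _).
have -> : t ^+ D = t ^+ i * t ^+ (D - i) by rewrite -exprD subnKC.
by rewrite mulrC mulrA exprVn mulVf ?mul1r // expf_neq0.
Qed.

(** The power of s by which [xsub] differs from plain substitution into the coefficients: at
    infinity [xrev] has multiplied by x^(-xdeg Q). *)
Definition shift_exp Q c e := if c is Some _ then 0%N else (e * xdeg Q)%N.

Lemma xsubE Q c e j phi : (0 < e)%N -> emb lC phi (loc c e) ->
  (j < size Q)%N -> (Ps (ps_of_poly (xsub Q c e j)))%:F = phi (Q`_j)%:F * lX ^+ shift_exp Q c e.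
Proof.
move=> e0 ph jQ.
have E (p : {poly C}) : (Ps (ps_of_poly p))%:F = (map_poly lC p).[lX] :> K.
  rewrite horner_psF; congr (_%:F); apply: psP => n.
  by rewrite horner_psX.
rewrite E (emb_poly _ ph) /xsub /shift_exp; case: c {ph} => [c|].
  rewrite expr0 mulr1 map_comp_poly horner_comp; congr (_.[_]).
  by rewrite rmorphD /= map_polyC map_polyXn hornerD hornerC hornerXn.
rewrite map_comp_poly horner_comp map_polyXn hornerXn horner_reverse.
- by rewrite -exprM mulrC /loc /near_pt.
- by rewrite expf_neq0 ?lX_neq0.
- by rewrite /xdeg; exact: (@leq_bigmax _ (fun j : 'I_(size Q) => (size (Q`_j)%R).-1) (Ordinal jQ)).
Qed.

Lemma is_rootE Q c e y phi : (0 < e)%N -> emb lC phi (loc c e) -> (0 < size Q)%N ->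
  is_root Q c e y <-> root (map_poly phi (map_poly (@FracField.tofrac _) Q)) (lau_of y).
Proof.
move=> e0 ph Q0; set n := (size Q).-1; case: y => [m w].
pose W := Ps w.
have powE j : Ps (ps_pow w j) = W ^+ j.
  elim: j => [|j IH]; first by apply: psP.
  by rewrite exprS -IH; apply: psP.
have shE a f : Ps (ps_shift a (pco f)) = psX C ^+ a * f.
  by apply: psP => k; rewrite pco_psXnM.
pose S := \sum_(j < size Q) Ps (ps_of_poly (xsub Q c e j)) * (psX C ^+ (m * (n - j)) * W ^+ j).
have SE : is_root Q c e (m, w) <-> S = 0.
  have E k : \sum_(j < size Q) ps_mul (ps_of_poly (xsub Q c e j))
           (ps_shift (m * (n - j))%N (ps_pow w j)) k = pco S k.
    rewrite /S (big_morph (fun h => pco h k) (fun a b => pcoD a b k) (pco0 C k)).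
    by apply: eq_bigr => j _; rewrite -powE -shE.
  split=> H; last by rewrite /is_root; cbv zeta => k; have := E k; rewrite H pco0 => Ek; exact: Ek.
  by apply: psP => k; rewrite -E; exact: H.
rewrite SE rootE (@horner_coef_wide _ (size Q)).
  have : S%:F = lX ^+ (shift_exp Q c e + m * n) * 
     \sum_(i < size Q) (map_poly phi (map_poly (@FracField.tofrac _) Q))`_i * lau_of (m, w) ^+ i.
    rewrite /S (big_morph _ (@tofracD _) (tofrac0 _)) mulr_sumr; apply: eq_bigr => j _.
    rewrite !tofracM (xsubE e0 ph (ltn_ord j)) !coef_map /= /lau_of /= !tofracXn.
    have jn : (j <= n)%N by rewrite -ltnS prednK.
    rewrite expr_div_n -exprM exprD -[in RHS](subnK jn) mulnDr exprD.
    by apply: clear_denom; rewrite expf_neq0 ?lX_neq0.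
  move=> SF; split=> [S0|/eqP S0].
    by move: SF; rewrite S0 tofrac0 => /esym/eqP; rewrite mulf_eq0 expf_eq0 (negPf (lX_neq0 _)) andbF.
  by apply/eqP; rewrite -tofrac_eq0 SF S0 mulr0.
by rewrite size_map_poly (leq_trans (size_poly _ _)).
Qed.

Definition lprim e x := forall k, (1 < k)%N -> (k %| e)%N -> ~ in_subd k x.

Lemma in_subd_mod k m w : (0 < k)%N ->
  in_subd k (lau_of (m, w)) <-> (forall j, w j != 0 -> j = m %[mod k]).
Proof.
(* Numerator and denominator are multiplied by s^(m(k-1)), so that the denominator becomes a power
   of s^k. *)
move=> k0; have E : lau_of (m, w) = (psX C ^+ (m * k.-1) * Ps w)%:F / lX ^+ (m * k).
  have -> : (m * k = m * k.-1 + m)%N by rewrite -{1}(prednK k0) mulnS addnC.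
  rewrite /lau_of /= tofracM tofracXn exprD -mulf_div divff ?mul1r // expf_neq0 ?lX_neq0 //.
have modE j : (k %| j + m * k.-1)%N = (j == m %[mod k]).
  rewrite -(eqn_modDr (m * k.-1) j m) -mulnS (prednK k0) modnMl /dvdn //.
rewrite (in_subdP k0 (dvdn_mull _ (dvdnn k)) E); split=> H j.
  move=> wj; apply/eqP; rewrite -modE; apply: H.
  by rewrite pco_psXnM leq_addl addnK.
rewrite pco_psXnM; case: leqP => [mj|]; last by rewrite eqxx.
by move=> /= /H /eqP; rewrite -modE subnK.
Qed.

Lemma primitiveE e y : primitive e y <-> lprim e (lau_of y).
Proof.
case: y => m w; split=> H k k1 ke; first by move/(in_subd_mod _ _ (ltnW k1)); exact: H.
by move=> Hj; apply: (H k k1 ke); apply/(in_subd_mod _ _ (ltnW k1)).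
Qed.

(** Lists of coefficient sequences are replaced by duplicate-free sequences in the field C((s));
    normalization is what makes the coding bijective. *)
Lemma prim_countP Q c e cnt phi : (0 < e)%N -> emb lC phi (loc c e) -> (0 < size Q)%N ->
  prim_count Q c e cnt <-> exists s : seq K, [/\ uniq s, size s = cnt &
    forall x, x \in s <-> root (map_poly phi (map_poly (@FracField.tofrac _) Q)) x /\ lprim e x].
Proof.
move=> e0 ph Q0; split=> [[l [lc [nd lP]]]|[s [us sc sP]]].
  have inl x : x \in map lau_of l <-> exists y, List.In y l /\ lau_of y = x.
    elim: l {lc nd lP} => [|y l IH]; first by split=> // -[y []].
    rewrite /= inE; split=> [/predU1P[->|/IH [y' [y'l <-]]]|[y' [[<-|y'l] E]]].
    - by exists y; split; [left|].
    - by exists y'; split; [right|].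
    - by rewrite E eqxx.
    - by apply/orP; right; apply/IH; exists y'.
  exists (map lau_of l); split; last first.
  - move=> x; rewrite inl; split=> [[y [/lP [ny [ry py]] <-]]|[rx px]].
      by split; [apply/(is_rootE _ e0 ph Q0)|apply/primitiveE].
    have [y [ny yE]] := normalized_ex x; exists y; split => //; apply/lP; split => //.
    by split; [apply/(is_rootE _ e0 ph Q0)|apply/primitiveE]; rewrite yE.
  - by rewrite size_map.
  have nl : forall y, List.In y l -> normalized y by move=> y /lP [].
  elim: l nd nl {lc lP inl} => [//|y l IH] nd nl /=.
  have ny := nl y (or_introl erefl); have [yl ndl] : ~ List.In y l /\ List.NoDup l.
    by inversion nd.
  rewrite IH // ?andbT; last by move=> y' y'l; apply: nl; right.
  apply/negP => H; apply: yl; elim: l H nl {IH nd ndl} => [//|y' l IH].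
  rewrite /= inE => /predU1P[yy|H] nl.
    by left; apply/esym; apply: normalized_inj yy => //; apply: nl; right; left.
  by right; apply: IH => // y2 y2l; apply: nl; case: y2l => [->|y2l]; [left|right; right].
pose rep x := sval (cid (normalized_ex x)).
have repP x : normalized (rep x) /\ lau_of (rep x) = x by rewrite /rep; case: cid.
exists (map rep s); split; first by rewrite size_map.
have inr y : List.In y (map rep s) <-> exists x, x \in s /\ rep x = y.
  elim: s {us sc sP} => [|x s IH]; first by split=> // -[x []].
  rewrite /=; split=> [[<-|/IH [x' [x's <-]]]|[x' []]].
  - by exists x; rewrite mem_head.
  - by exists x'; rewrite inE x's orbT.
  - by rewrite inE => /predU1P[->|x's] yE; [left|right; apply/IH; exists x'].
split=> [|y].
  elim: s us inr {sc sP} => [|x s IH] /= us inr; first exact: List.NoDup_nil.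
  case/andP: us => xs us; apply: List.NoDup_cons; last first.
    apply: IH => // y; elim: s {us xs inr} => [|x' s IH]; first by split=> // -[x' []].
    rewrite /=; split=> [[<-|/IH [x2 [x2s <-]]]|[x2 []]].
    - by exists x'; rewrite mem_head.
    - by exists x2; rewrite inE x2s orbT.
    - by rewrite inE => /predU1P[->|x2s] yE; [left|right; apply/IH; exists x2].
  move=> H; move/negP: xs; apply; elim: s H {IH us inr} => [//|x' s IH] /= [E|/IH xs].
    by rewrite inE -(repP x).2 -E (repP x').2 eqxx.
  by rewrite inE xs orbT.
rewrite inr; split=> [[x [/sP [rx px] <-]]|[ny [ry py]]].
  have [nx xE] := repP x; split => //; split; [apply/(is_rootE _ e0 ph Q0)|apply/primitiveE]; by rewrite xE.
exists (lau_of y); split.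
  by apply/sP; split; [apply/(is_rootE _ e0 ph Q0)|apply/primitiveE].
by have [nx xE] := repP (lau_of y); apply: normalized_inj.
Qed.
End PuiseuxRoots.

(* A ramified point has a primitive Puiseux root with parameter e > 1, whose e conjugates contribute to the defect. *)
Section GenusBound.
Variable R : realType.
Local Notation C := R[i].
Local Notation K := (lau C).
Local Notation lC := (lC C).
Local Notation lX := (lX C).
Implicit Types (Q : {poly {poly C}}) (x : K) (c w : option C).

Definition fracp Q : {poly ratf R} := map_poly (@FracField.tofrac _) Q.

Lemma size_fracp Q : size (fracp Q) = size Q.
Proof.
apply: size_map_inj_poly; rewrite ?tofrac0 // => p q /eqP.
by rewrite tofrac_eq => /eqP.
Qed.

Lemma in_subd_rot k z x : (0 < k)%N -> z != 0 -> in_subd k (rot z x) -> in_subd k x.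
Proof.
move=> k0 z0 [y yE]; exists (rot (z^-1 ^+ k) y).
by rewrite -rot_subd_comm ?invr_eq0 // -yE rotM ?invr_eq0 // mulVf // rot1.
Qed.

Lemma emb_rot phi c N z : (0 < N)%N -> z ^+ N = 1 -> emb lC phi (loc c N) ->
  emb lC (rot z \o phi : {rmorphism ratf R -> K}) (loc c N).
Proof.
move=> N0 zN Hp; have := emb_auto (tau := rot z) (rot_lC z) Hp.
by rewrite rot_loc.
Qed.

Lemma rot_root phi c N z (P : {poly ratf R}) x : (0 < N)%N -> z ^+ N = 1 ->
  emb lC phi (loc c N) -> root (map_poly phi P) x -> root (map_poly phi P) (rot z x).
Proof.
move=> N0 zN Hp; rewrite /root => /eqP Hx.
have E : map_poly phi P = map_poly (rot z) (map_poly phi P).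
  rewrite -map_poly_comp; apply: eq_map_poly => f /=.
  exact: (emb_uniq Hp (emb_rot N0 zN Hp)).
by rewrite E horner_map Hx rmorph0.
Qed.

Lemma emb_subd phi c N d : (0 < d)%N -> emb lC phi (loc c N) ->
  emb lC (subd d \o phi : {rmorphism ratf R -> K}) (loc c (d * N)).
Proof.
move=> d0 Hp; have := emb_auto (tau := subd d) (subd_lC d) Hp.
by rewrite subd_loc.
Qed.

Lemma loc_emb_ex w k : (0 < k)%N -> exists phi, emb lC phi (loc w k).
Proof. by move=> k0; apply: (emb_ltype_ex k0 (ltype_loc w k)). Qed.

(** Some root r at exponent k is not a series in s^k. For the largest divisor d of k with r =
    y(s^d), maximality makes y primitive at exponent e = k / d > 1. *)
Lemma ramified_primitive (P : {poly ratf R}) w k phi : (0 < k)%N -> spl P w k -> ~ spl P w 1 ->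
  (forall e, (0 < e)%N -> emb lC (phi e) (loc w e)) ->
  exists e y, [/\ (1 < e)%N, root (map_poly (phi e) P) y & lprim e y].
Proof.
move=> k0 [psi [Hpsi [rs rsE]]] nspl phiP.
have [r r_in nr] : exists2 r, r \in rs & ~ in_subd k r.
  apply: contrapT => H; apply: nspl; exists (phi 1%N); split; first exact: phiP.
  have := emb_subd k0 (phiP 1%N isT); rewrite muln1 => Hk.
  apply: (@splits_desc _ _ (subd k) _ rs).
    rewrite -map_poly_comp (eq_map_poly (emb_uniq Hk Hpsi)) //.
  by move=> r rin; apply: contrapT => nr; apply: H; exists r.
have [d [/andP[d0 dk] dr dmax]] : exists d, [/\ (0 < d)%N && (d %| k)%N, in_subd d r &
    forall d', (0 < d')%N -> (d' %| k)%N -> in_subd d' r -> (d' <= d)%N].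
  pose D := fun d => (0 < d)%N && (d %| k)%N && `[< in_subd d r >].
  have D1 : exists d, D d by exists 1%N; rewrite /D dvd1n; apply/asboolP; exists r; rewrite subd1.
  have Dle d : D d -> (d <= k)%N by rewrite /D => /andP[/andP[_ dk] _]; exact: dvdn_leq.
  case: (ex_maxnP D1 Dle) => d /andP[dd /asboolP dr] dmax.
  by exists d; split=> // d' d0 dk dr'; apply: dmax; rewrite /D d0 dk; apply/asboolP.
have [e ke] := dvdnP dk; have e0 : (0 < e)%N by case: (e) ke k0 => // ->.
have [y ry] := dr.
exists e, y; split.
- case: e e0 ke => [|[|e]] // _ ke; case: nr; by rewrite ke mul1n.
- have := emb_subd d0 (phiP e e0); rewrite mulnC -ke => Hk.
  have rr : root (map_poly psi P) r by rewrite (eqp_prod_root _ rsE).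
  move: rr; rewrite ry -(eq_map_poly (emb_uniq Hk Hpsi)) map_poly_comp.
  by rewrite /root horner_map fmorph_eq0.
- move=> j j1 je [x yx].
  have : (d * j <= d)%N.
    apply: dmax; first by rewrite muln_gt0 d0 ltnW.
      by rewrite ke mulnC dvdn_mul.
    by exists x; rewrite ry yx subdM // ltnW.
  by rewrite -{2}[d]muln1 leq_pmul2l // leqNgt j1.
Qed.

(** The conjugates are the e rotations of y. A coincidence of two of them would make y a series in
    s^j for a divisor j > 1 of e. *)
Lemma primitive_conjugates (P : {poly ratf R}) w e phi y : (1 < e)%N ->
  emb lC phi (loc w e) -> root (map_poly phi P) y -> lprim e y ->
  exists s : seq K, [/\ uniq s, size s = e &
    forall x, x \in s -> root (map_poly phi P) x /\ lprim e x].
Proof.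
move=> e1 Hp Hy Py; have e0 := ltnW e1.
have [zt Hz] := prim_root_ex R e0.
have z0 : zt != 0.
  apply/eqP => z0; have := prim_expr_order Hz.
  by rewrite z0 expr0n gtn_eqF // => /esym/eqP; rewrite oner_eq0.
exists [seq rot (zt ^+ i) y | i <- iota 0 e]; split.
- rewrite map_inj_in_uniq ?iota_uniq // => i j.
  rewrite !mem_iota !add0n /= => ie je.
  wlog ij : i j ie je / (i <= j)%N.
    move=> W E; case/orP: (leq_total i j) => ij; first exact: W ij E.
    exact/esym/(W j i je ie ij (esym E)).
  move=> E; apply/eqP; rewrite eqn_leq ij /= leqNgt; apply/negP => ltij.
  have : rot (zt ^+ (j - i)) y = y.
    have zi := expf_neq0 i z0; have zk := expf_neq0 (j - i) z0.
    have Ej : rot (zt ^+ j) y = rot (zt ^+ i) (rot (zt ^+ (j - i)) y).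
      by rewrite (rotM y zi zk) -(exprD zt i (j - i)) (subnKC ij).
    exact/esym/(fmorph_inj (rot (zt ^+ i)))/(etrans E Ej).
  move/(rot_fixed (exp_prim_root Hz (j - i))).
  apply: Py; last by apply: dvdn_div; exact: dvdn_gcdr.
  rewrite ltn_divRL ?mul1n ?dvdn_gcdr //.
  have := dvdn_leq (_ : 0 < j - i)%N (dvdn_gcdl (j - i) e).
  rewrite subn_gt0 ltij => /(_ isT); lia.
- by rewrite size_map size_iota.
- move=> _ /mapP[i _ ->]; split.
    by apply: (rot_root e0 _ Hp) => //; rewrite exprAC (prim_expr_order Hz) expr1n.
  move=> k k1 ke /in_subd_rot H; apply: (Py k k1 ke); apply: H; first exact: ltnW.
  exact: expf_neq0.
Qed.

(** Each ramified point contributes at least 1 to the Riemann-Hurwitz sum, which equals 2g + 2n -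
    2. *)
Lemma genus_ramified Q g (T : seq (option C)) : has_genus Q g -> (1 < size Q)%N ->
  (forall w, exists k, (0 < k)%N /\ spl (fracp Q) w k) -> uniq T ->
  (forall w, w \in T -> ~ spl (fracp Q) w 1) -> (size T <= 2 * g + 2 * (size Q).-1)%N.
Proof.
move=> Hg sQ Hspl uT HT; move: Hg; rewrite /has_genus; cbv zeta.
have n0 : ((size Q).-1 == 0)%N = false by case: (size Q) sQ => [|[]].
rewrite n0 => -[cnt [cntP [S [uS [S0 ->]]]]].
have def w : w \in T -> (0 < loc_defect cnt w (size Q).-1)%N.
  move=> /HT nspl; have [k [k0 Hk]] := Hspl w.
  have phi_ex e : exists phi, (0 < e)%N -> emb lC phi (loc w e).
    case: e => [|e]; last by have [phi Hp] := loc_emb_ex w (ltn0Sn e); exists phi.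
    by have [phi Hp] := loc_emb_ex w (ltn0Sn 0); exists phi.
  have phiP e := svalP (cid (phi_ex e)).
  have [e [y [e1 Hy Py]]] := ramified_primitive k0 Hk nspl phiP.
  have [s [us ss Hs]] := primitive_conjugates e1 (phiP e (ltnW e1)) Hy Py.
  have en : (e <= (size Q).-1)%N.
    have := @max_poly_roots _ (map_poly (sval (cid (phi_ex e))) (fracp Q)) s.
    rewrite size_map_poly size_fracp ss map_poly_eq0 -size_poly_eq0 size_fracp.
    case: (size Q) sQ => [|n] //= _ H; rewrite -ltnS; apply: H => //.
    by apply/allP => x /Hs[].
  have e0 := ltnW e1.
  have := cntP w e; rewrite e0 en => /(_ isT)/(prim_countP _ e0 (phiP e e0) (ltnW sQ)).1.
  move=> [s' [us' ss' Hs']].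
  have le : (e <= cnt w e)%N.
    by move: ss' => <-; rewrite -ss; apply: uniq_leq_size => // x /Hs ?; apply/Hs'.
  have elt : (e < (size Q).-1.+1)%N by [].
  rewrite /loc_defect (bigD1 (Ordinal elt)) //= ltn_addr // muln_gt0.
  by rewrite -ltnS prednK // e1 divn_gt0.
rewrite addnC; apply: (@leq_trans (\sum_(c <- S) loc_defect cnt c (size Q).-1)); last exact: leq_addr.
apply: (@leq_trans (\sum_(c <- T) loc_defect cnt c (size Q).-1)).
  rewrite -sum1_size big_seq [leqRHS]big_seq; apply: leq_sum => w; exact: def.
apply: leq_sum_subset => // w /def; apply: contraTT => /S0 ->; by rewrite ltnn.
Qed.

End GenusBound.

Fact cleared_field (k : fieldType) (n d x y : k) : d != 0 ->
  n * x - d * y = - d * (y - n / d * x).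
Proof. by move=> d0; field. Qed.

Fact cleared_coef (A : idomainType) (n d x y : A) : d != 0 ->
  (n * x - d * y)%:F = - d%:F * (y%:F - n%:F / d%:F * x%:F).
Proof.
rewrite -tofrac_eq0 tofracB !tofracM; exact: cleared_field.
Qed.

(** * Components and irreducible factors over C(x) *)

Section Gauss.
Variable R : realType.
Local Notation C := R[i].
Implicit Types (Q S T W : {poly {poly C}}) (d : {poly C}) (P : {poly ratf R}).

Definition xeval (a : C) : {rmorphism {poly {poly C}} -> {poly C}} :=
  map_poly (horner_eval a).

(** Content one in C[x], tested by specialization because the primes of C[x] are the x - a. Products
    cause no trouble since C[y] is a domain. *)
Definition xprim Q := forall a : C, xeval a Q != 0.

Lemma coef_xeval a Q i : (xeval a Q)`_i = (Q`_i).[a].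
Proof. by rewrite coef_map. Qed.

Lemma xeval_eq0 a Q : xeval a Q = 0 -> exists Q', Q = ('X - a%:P)%:P * Q'.
Proof.
move=> Q0; exists (\poly_(i < size Q) (Q`_i %/ ('X - a%:P))).
apply/polyP => i; rewrite coefCM coef_poly.
case: ltnP => [ilt|/(nth_default 0) ->]; last by rewrite mulr0.
have /factor_theorem[q ->] : root Q`_i a by rewrite /root -coef_xeval Q0 coef0.
by rewrite mulpK ?polyXsubC_eq0 // mulrC.
Qed.

Lemma xevalXsub a Q : xeval a (('X - a%:P)%:P * Q) = 0.
Proof.
rewrite rmorphM /= map_polyC /= /horner_eval hornerXsubC subrr mul0r //.
Qed.

Lemma fracp_neq0 Q : (fracp Q != 0) = (Q != 0).
Proof. by rewrite -!size_poly_eq0 size_fracp. Qed.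

Lemma fracpM Q S : fracp (Q * S) = fracp Q * fracp S.
Proof. by rewrite /fracp rmorphM. Qed.

Lemma fracpCM d Q : fracp (d%:P * Q) = d%:F *: fracp Q.
Proof. by rewrite fracpM /fracp map_polyC /= mul_polyC. Qed.

Lemma fracp_inj : injective (@fracp R).
Proof.
move=> Q S E; apply/polyP => i; have := congr1 (coefp i) E.
by rewrite /= !coef_map /= => /eqP; rewrite tofrac_eq => /eqP.
Qed.

Lemma eqp_scaleF d P : d != 0 -> d%:F *: P %= P.
Proof. by move=> d0; apply: eqp_scale; rewrite tofrac_eq0. Qed.

Lemma content_ex Q : Q != 0 -> exists d Q', [/\ d != 0, xprim Q' & Q = d%:P * Q'].
Proof.
have [n] := ubnP (size (lead_coef Q)); elim: n Q => // n IH Q ltn Q0.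
case: (pselect (xprim Q)) => [HQ|nQ]; first by exists 1, Q; rewrite oner_eq0 mul1r.
have [a /eqP a0] : exists a, xeval a Q == 0.
  by apply: contrapT => H; apply: nQ => a; apply/negP => a0; apply: H; exists a.
have [Q' E] := xeval_eq0 a0.
have Q'0 : Q' != 0 by apply: contra_neq Q0 => Q'0; rewrite E Q'0 mulr0.
have [|//|d [S [d0 HS Q'E]]] := IH Q'.
  move: ltn; rewrite E lead_coefM lead_coefC mulrC.
  by rewrite size_Mmonic ?lead_coef_eq0 ?monicXsubC // size_XsubC addn2.
exists (('X - a%:P) * d), S; split=> //; first by rewrite mulf_neq0 ?polyXsubC_eq0.
by rewrite E Q'E polyCM mulrA.
Qed.

Lemma root_ex d : (1 < size d)%N -> exists a : C, root d a.
Proof. by move=> d1; apply/closed_rootP; rewrite neq_ltn d1 orbT. Qed.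

Lemma xprim_const Q d S : xprim Q -> Q = d%:P * S -> bconst d%:P.
Proof.
move=> HQ E; case: (ltnP 1 (size d)) => [/root_ex[a]|/size1_polyC ->]; last by exists d`_0.
case/factor_theorem => q dE; have := HQ a.
have -> : Q = ('X - a%:P)%:P * (q%:P * S) by rewrite E dE mulrC polyCM mulrCA mulrC mulrCA mulrA mulrC mulrCA mulrC.
by rewrite xevalXsub eqxx.
Qed.

Lemma clear_fracp P : exists d T, d != 0 /\ d%:F *: P = fracp T.
Proof.
have [d [d0 Hd]] := clear_denominators P.
pose T := \poly_(i < size P) sval (cid (Hd i i.+1 (ltnSn i))).
exists d, T; split=> //; apply/polyP => i; rewrite coefZ coef_map coef_poly.
case: ltnP => [_|/(nth_default 0) ->]; last by rewrite mulr0; exact/esym/tofrac0.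
by case: cid => p /= <-; rewrite subSnn expr1 mulrC.
Qed.

(** Gauss's lemma: a linear factor of the denominator d divides QT, hence T because Q is primitive,
    so the factors are cancelled one at a time. *)
Lemma xprim_dvd Q W : xprim Q -> fracp Q %| fracp W -> exists S, W = Q * S.
Proof.
move=> HQ /dvdpP[P WE]; have [d [T [d0 TE]]] := clear_fracp P.
have {WE TE} : d%:P * W = Q * T.
  by apply: fracp_inj; rewrite fracpCM fracpM WE scalerAl TE mulrC.
have [n] := ubnP (size d); elim: n d d0 T => // n IH d d0 T ltn E.
case: (ltnP 1 (size d)) => [/root_ex[a /factor_theorem[q dE]]|/size1_polyC dE].
  have q0 : q != 0 by apply: contra_neq d0 => q0; rewrite dE q0 mul0r.
  have /eqP : xeval a (Q * T) = 0.
    by rewrite -E dE mulrC polyCM [_%:P * _]mulrC mulrCA xevalXsub.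
  rewrite rmorphM mulf_eq0 (negPf (HQ a)) /= => /eqP/xeval_eq0[T' TE].
  apply: (IH q q0 T').
    by move: ltn; rewrite dE size_Mmonic ?monicXsubC // size_XsubC addn2.
  have X0 : (('X - a%:P)%:P : {poly {poly C}}) != 0 by rewrite polyC_eq0 polyXsubC_eq0.
  apply: (mulfI X0); rewrite [RHS]mulrCA -TE -E dE polyCM.
  by rewrite mulrA; congr (_ * _); rewrite mulrC.
have c0 : d`_0 != 0 by apply: contra_neq d0 => c0; rewrite dE c0.
exists (((d`_0)^-1)%:P%:P * T); rewrite mulrCA -E {2}dE mulrA -!polyCM mulVf //.
by rewrite !polyC1 mul1r.
Qed.

Lemma bconst_size1 Q : bconst Q -> Q != 0 -> size Q = 1%N.
Proof. by move=> [c ->]; rewrite polyC_eq0 => c0; rewrite size_polyC c0. Qed.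

Lemma fracp_rep P : P != 0 -> exists Q, xprim Q /\ fracp Q %= P.
Proof.
move=> P0; have [d [T [d0 TE]]] := clear_fracp P.
have T0 : T != 0 by rewrite -fracp_neq0 -TE scaler_eq0 negb_or tofrac_eq0 d0.
have [e [Q [e0 HQ QE]]] := content_ex T0; exists Q; split=> //.
apply: (eqp_trans _ (eqp_scaleF P d0)).
by rewrite TE QE fracpCM eqp_sym eqp_scaleF.
Qed.

Lemma fracp_curve F U : fracp (curve F U) %= fibp (@rC R) U F.
Proof.
have dF : (rden F)%:F != 0 by rewrite tofrac_eq0 rden_neq0.
have E : fracp (curve F U) = - (rden F)%:F *: fibp (@rC R) U F.
  apply/polyP => i; rewrite coefZ /fracp coef_map /= /curve /fibp !coefB coefZ !coefCM.
  rewrite !(coef_map (@rC R)) !(coef_map (@polyC C)) {4}[F]ratfE; exact/cleared_coef/rden_neq0.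
by rewrite E; apply: eqp_scale; rewrite oppr_eq0.
Qed.

(** At x = a the curve specializes to a nonzero multiple of a fibre polynomial of U, so it contains
    no vertical line. *)
Lemma curve_xprim F U : nonconst U -> xprim (curve F U).
Proof.
move=> hU a; rewrite /curve rmorphB !rmorphM /= !map_polyC /= -!map_poly_comp /horner_eval.
have e (p : {poly C}) : map_poly (horner_eval a \o polyC) p = p.
  by apply/polyP => i; rewrite coef_map /= /horner_eval hornerC.
rewrite !e !mul_polyC.
have [d0|d0] := eqVneq (rden F).[a] 0.
  rewrite d0 scale0r subr0 scaler_eq0 negb_or rden_neq0 andbT.
  exact: coprimep_root (coprime_rnum_rden F) d0.
have := fib_poly_neq0 (Some ((rnum F).[a] / (rden F).[a])) hU.
apply: contraNneq => H; rewrite /fib_poly mulrC -scalerA.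
apply/eqP; apply: (scalerI d0); rewrite scaler0 scalerBr (scalerA (rden F).[a] (rden F).[a]^-1) mulfV // scale1r.
by rewrite -[RHS]oppr0 -H opprB.
Qed.

(** A factor over C(x) has a primitive representative, which divides already over C[x]; the
    definition of a component then applies to it. *)
Lemma component_irreducible F U Q : nonconst U -> component (curve F U) Q ->
  irreducible_poly (fracp Q) /\ fracp Q %| fibp (@rC R) U F.
Proof.
move=> hU [nQ [[S SE] irrQ]].
have cp := curve_xprim F hU.
have HQ : xprim Q by move=> a; have := cp a; rewrite SE rmorphM mulf_eq0 negb_or => /andP[].
have Q0 : Q != 0 by apply: contra_neq (HQ 0) => ->; rewrite rmorph0.
split; last by rewrite -(eqp_dvdr _ (fracp_curve F U)) SE fracpM dvdp_mulr.
split.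
  rewrite size_fracp ltnNge; apply/negP => /size1_polyC QE; apply: nQ.
  by rewrite QE; apply: (@xprim_const Q Q`_0 1) => //; rewrite mulr1.
move=> q q1 qQ; have q0 : q != 0.
  by apply: contraTneq qQ => ->; rewrite dvd0p fracp_neq0.
have [q' [Hq' q'E]] := fracp_rep q0.
have [T QT] : exists T, Q = q' * T by apply: xprim_dvd => //; rewrite (eqp_dvdl _ q'E).
have q'0 : q' != 0 by apply: contra_neq Q0 => h; rewrite QT h mul0r.
have T0 : T != 0 by apply: contra_neq Q0 => h; rewrite QT h mulr0.
case: (irrQ _ _ QT) => [/bconst_size1/(_ q'0)|/bconst_size1/(_ T0)/eqP/size_poly1P[c c0 TE]].
  by rewrite -size_fracp (eqp_size q'E) => h; rewrite h in q1.
rewrite eqp_sym; apply: eqp_trans q'E; rewrite QT TE mulrC fracpCM.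
exact: eqp_scaleF.
Qed.

Lemma component_ex F U P : irreducible_poly P -> P %| fibp (@rC R) U F ->
  exists Q, component (curve F U) Q /\ fracp Q %= P.
Proof.
move=> [P1 Pirr] Pdvd.
have P0 : P != 0 by rewrite -size_poly_gt0 ltnW.
have [Q [HQ QE]] := fracp_rep P0; exists Q; split=> //.
have sQ : size Q = size P by rewrite -size_fracp (eqp_size QE).
have Q0 : Q != 0 by rewrite -size_poly_gt0 sQ ltnW.
split; first by move=> /bconst_size1/(_ Q0) h; move: P1; rewrite -sQ h.
split; first by apply: xprim_dvd => //; rewrite (eqp_dvdl _ QE) (eqp_dvdr _ (fracp_curve F U)).
move=> S T E.
have S0 : S != 0 by apply: contra_neq Q0 => h; rewrite E h mul0r.
have T0 : T != 0 by apply: contra_neq Q0 => h; rewrite E h mulr0.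
have [S1|S1] := eqVneq (size S) 1%N.
  by left; case/eqP/size_poly1P: S1 E => d _ -> E; apply: xprim_const HQ E.
have : fracp S %= P.
  by apply: Pirr; rewrite ?size_fracp // -(eqp_dvdr _ QE) E fracpM dvdp_mulr.
move/eqp_size; rewrite size_fracp -sQ E size_mul // => h.
have /eqP/size_poly1P[d _ TE] : size T = 1%N.
  move: h S0 T0; rewrite -!size_poly_gt0; move: (size S) (size T) => m k; lia.
by right; rewrite TE; apply: (xprim_const HQ (S := S)); rewrite E TE mulrC.
Qed.

End Gauss.

Lemma pigeonhole_nat (T : finType) (f : nat -> T) : exists i j, (i < j)%N /\ f i = f j.
Proof.
apply: contrapT => H.
suff : injective (fun i : 'I_#|T|.+1 => f i) by move/leq_card; rewrite card_ord ltnn.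
move=> i j /= E; apply: val_inj; case: (ltngtP (val i) (val j)) => // lt; case: H.
  by exists (val i), (val j).
by exists (val j), (val i).
Qed.

Lemma irreducible_dvd_prod (L : fieldType) (P : {poly L}) (s : seq {poly L}) :
  irreducible_poly P -> P %| \prod_(Q <- s) Q -> exists2 Q, Q \in s & P %| Q.
Proof.
move=> irrP; elim: s => [|Q s IH].
  rewrite big_nil dvdp1 => /eqP h; by case: irrP => + _; rewrite h.
rewrite big_cons; case: (boolP (P %| Q)) => [PQ _|nPQ].
  by exists Q; rewrite ?mem_head.
rewrite Gauss_dvdpr; last by rewrite irreducible_poly_coprime.
by move/IH => [S Ss PS]; exists S; rewrite ?inE ?Ss ?orbT.
Qed.

(** Testing the equivalence at k = b / gcd(e, b) and at k = a gives divisibility both ways between a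
    and b / gcd(e, b). *)
Lemma dvdn_fixed_gcd a b e : (0 < a)%N -> (0 < b)%N -> (0 < e)%N ->
  (forall k, (0 < k)%N -> (a %| k)%N <-> (b %| k * e)%N) -> b = (a * gcdn e b)%N.
Proof.
move=> a0 b0 e0 H; have g0 : (0 < gcdn e b)%N by rewrite gcdn_gt0 e0.
have bE : (b %/ gcdn e b * gcdn e b = b)%N by rewrite divnK ?dvdn_gcdr.
have q0 : (0 < b %/ gcdn e b)%N by rewrite divn_gt0 // dvdn_leq ?dvdn_gcdr.
suff -> : a = (b %/ gcdn e b)%N by rewrite bE.
apply/eqP; rewrite eqn_dvd; apply/andP; split.
  by apply/(H _ q0); rewrite -{1}bE dvdn_mul ?dvdn_gcdl.
have /(H _ a0) aeb : (a %| a)%N by [].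
have : (b %/ gcdn e b * gcdn e b %| a * (e %/ gcdn e b) * gcdn e b)%N.
  by rewrite bE -mulnA divnK // dvdn_gcdl.
rewrite dvdn_pmul2r // Gauss_dvdl //.
by rewrite /coprime -(eqn_pmul2r g0) muln_gcdl !divnK ?dvdn_gcdl ?dvdn_gcdr // mul1n gcdnC.
Qed.

(** * Towers of components of bounded genus *)

Section Tower.
Variable R : realType.
Local Notation C := R[i].
Implicit Types (A U F : ratf R) (P Q : {poly ratf R}) (w z : option C) (s : seq (option C)).
Local Notation rC := (rC R).

Lemma spl_mulP P Q w k : spl (P * Q) w k <-> spl P w k /\ spl Q w k.
Proof.
split=> [H|[[phi [Hp sP]] [psi [Hs sQ]]]].
  by split; apply: spl_dvd H; [exact: dvdp_mulr|exact: dvdp_mull].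
exists phi; split=> //; rewrite rmorphM; apply: splits_mul => //.
exact: splits_emb Hs Hp sQ.
Qed.

Lemma spl1 w k : (0 < k)%N -> spl 1 w k.
Proof.
move=> k0; have [phi Hp] := loc_emb_ex w k0; exists phi; split=> //.
by rewrite (rmorph1 (map_poly phi)); exists [::]; rewrite big_nil eqpxx.
Qed.

Lemma spl_prodP (s : seq {poly ratf R}) w k : (0 < k)%N ->
  spl (\prod_(Q <- s) Q) w k <-> (forall Q, Q \in s -> spl Q w k).
Proof.
move=> k0; elim: s => [|Q s IH]; first by rewrite big_nil; split=> // _; exact: spl1.
rewrite big_cons spl_mulP IH; split=> [[HQ Hs] P|H].
  by rewrite inE => /orP[/eqP->|/Hs].
by split=> [|P Ps]; apply: H; rewrite inE ?eqxx ?Ps ?orbT.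
Qed.

Lemma locdeg_le F z : nonconst F -> (locdeg F z <= rdeg F)%N.
Proof.
move=> hF; rewrite -(sum_fiber (evalr F z) hF).
rewrite (big_rem z) /= ?mem_fiber ?eqxx //; exact: leq_addr.
Qed.

(** Every local degree of U divides (deg U)!, so a single exponent serves at all points and all
    levels of the tower. *)
Lemma spl_fibp_fact U F w : nonconst U -> nonconst F -> spl (fibp rC U F) w (rdeg U)`!.
Proof.
move=> hU hF; apply: spl_fibp; rewrite ?fact_gt0 // => y _.
by apply: dvdn_mulr; rewrite dvdn_fact // locdeg_gt0 // locdeg_le.
Qed.

Lemma size_fibp_rC U F : nonconst F -> size (fibp rC U F) = (rdeg U).+1.
Proof. by move=> hF; apply: size_fibp => a; exact: nonconst_neq. Qed.

Lemma size_pcomp F Q : size (pcomp F Q) = size Q.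
Proof. exact: size_map_poly. Qed.

Definition crit_values A := map (evalr A) (ram_points A).

Lemma crit_valuesP A z : nonconst A -> evalr A z \notin crit_values A -> locdeg A z = 1%N.
Proof.
move=> hA h; apply: ram_pointsP => //; apply: contra h; exact: map_f.
Qed.

Lemma size_fiber A w : nonconst A -> w \notin crit_values A -> size (fiber A w) = rdeg A.
Proof.
move=> hA hw; rewrite -(sum_fiber w hA) -sum1_size big_seq [RHS]big_seq.
apply: eq_bigr => z; rewrite mem_fiber // => /eqP zw.
by rewrite crit_valuesP // zw.
Qed.

Definition fibers A s := flatten [seq fiber A w | w <- s].

Lemma mem_fibers A s z : nonconst A -> (z \in fibers A s) = (evalr A z \in s).
Proof.
move=> hA; apply/flatten_mapP/idP => [[w ws]|zs]; first by rewrite mem_fiber // => /eqP ->.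
by exists (evalr A z); rewrite ?mem_fiber.
Qed.

Lemma fibers_uniq A s : nonconst A -> uniq s -> uniq (fibers A s).
Proof.
move=> hA; elim: s => [|w s IH] //= /andP[ws us].
rewrite /fibers /= cat_uniq fiber_uniq IH // andbT; apply/hasPn => z.
rewrite -/(fibers A s) mem_fibers // mem_fiber // => zs.
by apply: contra ws => /eqP <-.
Qed.

Lemma size_fibers A s : nonconst A -> {in s, forall w, w \notin crit_values A} ->
  size (fibers A s) = (rdeg A * size s)%N.
Proof.
move=> hA; elim: s => [|w s IH] H; first by rewrite muln0.
rewrite /fibers /= size_cat -/(fibers A s) IH => [|x xs]; last by rewrite H // inE xs orbT.
by rewrite size_fiber ?H ?mem_head // mulnS.
Qed.

Section Growth.
Variables (A : ratf R) (S : nat -> option C -> Prop).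
Hypothesis degA : (2 <= rdeg A)%N.
Hypothesis S_preim : forall j z, locdeg A z = 1%N -> S j (evalr A z) -> S j.+1 z.

Let hA : nonconst A := ltnW degA.

(** [S j] is to be the set of points ramified at level j of the tower: an unramified preimage of
    such a point is ramified at the next level. *)
Lemma growth_step j s : uniq s -> {in s, forall w, S j w} ->
  {in s, forall w, w \notin crit_values A} ->
  [/\ uniq (fibers A s), {in fibers A s, forall z, S j.+1 z} &
      (2 * size s <= size (fibers A s))%N].
Proof.
move=> us Hs cs; split; first exact: fibers_uniq.
  move=> z; rewrite mem_fibers // => zs; apply: S_preim; last exact: Hs.
  by apply: crit_valuesP => //; exact: cs.
by rewrite size_fibers // leq_mul2r degA orbT.
Qed.

(* A noncritical value has at least two preimages, so more than twice as many points as critical values keep multiplying. *)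
Lemma growth_large j s n : uniq s -> {in s, forall w, S j w} ->
  (2 * size (crit_values A) < size s)%N ->
  exists s', [/\ uniq s', {in s', forall z, S (j + n) z} & (size s + n <= size s')%N].
Proof.
move=> us Hs ls; elim: n => [|n [t [ut Ht lt]]]; first by exists s; rewrite !addn0.
pose t' := filter [predC crit_values A] t.
have sub : {subset t' <= t} by move=> x; rewrite mem_filter => /andP[].
have ct : (size t - size (crit_values A) <= size t')%N.
  rewrite leq_subLR -(count_predC (mem (crit_values A)) t) size_filter leq_add2r.
  rewrite -size_filter; apply: uniq_leq_size; first exact: filter_uniq.
  by move=> x; rewrite mem_filter => /andP[].
have [|x xt|x|u Hu lu] := @growth_step (j + n) t'; first exact: filter_uniq.
- by apply: Ht; exact: sub.
- by rewrite mem_filter => /andP[].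
exists (fibers A t'); rewrite addnS; split=> //.
move: ct lu lt ls; move: (size t') (size (fibers A t')) (size t) (size s) => a b c d.
by move: (size (crit_values A)) => e; lia.
Qed.

Fixpoint forward_crit n : seq (option C) :=
  if n is n'.+1 then crit_values A ++ map (evalr A) (forward_crit n') else [::].

(* Outside the first n forward images of the critical values the backward tree branches n times. *)
Lemma growth_generic n j s : uniq s -> {in s, forall w, S j w} ->
  {in s, forall w, w \notin forward_crit n} ->
  exists s', [/\ uniq s', {in s', forall z, S (j + n) z} & (2 ^ n * size s <= size s')%N].
Proof.
elim: n j s => [|n IH] j s us Hs cs; first by exists s; rewrite addn0 mul1n.
have cs' w : w \in s -> (w \notin crit_values A) && (w \notin map (evalr A) (forward_crit n)).
  by move/cs; rewrite -negb_or -mem_cat.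
have [|u Hu lu] := growth_step us Hs; first by move=> w /cs' /andP[].
have [|t [ut Ht lt]] := IH j.+1 (fibers A s) u Hu.
  by move=> z; rewrite mem_fibers // => /cs'/andP[_]; apply: contra; exact: map_f.
exists t; rewrite addnS -addSn; split=> //; apply: leq_trans lt.
by rewrite expnSr -mulnA leq_mul2l lu orbT.
Qed.

(** More than [B] points at one level would outgrow W at all late levels, and a point outside
    [forward_crit B] would produce at least 2^B > B points at one level. *)
Lemma bounded_support W : (forall J, exists j, (J <= j)%N /\
    forall s, uniq s -> {in s, forall w, S j w} -> (size s <= W)%N) ->
  exists E : seq (option C), forall j w, S j w -> w \in E.
Proof.
move=> HW; pose B := (2 * size (crit_values A))%N.
have HB j s : uniq s -> {in s, forall w, S j w} -> (size s <= B)%N.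
  move=> us Hs; rewrite leqNgt; apply/negP => ls.
  have [j' [jj' Hj']] := HW (j + W)%N.
  have [t [ut Ht lt]] := growth_large (j' - j) us Hs ls.
  have := Hj' t ut; rewrite subnKC ?(leq_trans _ jj') ?leq_addr // in Ht.
  by move=> /(_ Ht); lia.
exists (forward_crit B) => j w Sw; apply: contrapT => /negP nw.
have [||t [ut Ht lt]] := @growth_generic B j [:: w] isT.
- by move=> x; rewrite inE => /eqP->.
- by move=> x; rewrite inE => /eqP->.
have := HB _ _ ut Ht; rewrite leqNgt => /negP; apply.
by apply: leq_trans lt; rewrite muln1 ltn_expl.
Qed.

End Growth.

(* The functions nu_Qj take finitely many values on a finite set and each determines the next, so they are eventually periodic; the product over a period is fixed by A. *)
Lemma periodic_tower A Q N : (2 <= rdeg A)%N -> Q != 0 -> (0 < N)%N ->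
  (forall j w, spl (pcomp (iterc A j) Q) w N) ->
  (exists W, forall J, exists j, (J <= j)%N /\ forall s, uniq s ->
     {in s, forall w, ~ spl (pcomp (iterc A j) Q) w 1} -> (size s <= W)%N) ->
  exists j P, [/\ P != 0, pcomp (iterc A j) Q %| P, forall w, spl P w N,
    forall z k, (0 < k)%N -> spl P z k <-> spl P (evalr A z) (k * locdeg A z) &
    exists E : seq (option C), forall w, w \notin E -> spl P w 1].
Proof.
move=> degA Q0 N0 HN [W HW]; have hA : nonconst A := ltnW degA.
pose Qj j := pcomp (iterc A j) Q.
have QS j : Qj j.+1 = pcomp A (Qj j).
  by rewrite /Qj pcomp_comp ?iterc_nonconst // -addn1 iterc_add // iterc1.
have step j z k : (0 < k)%N -> spl (Qj j.+1) z k <-> spl (Qj j) (evalr A z) (k * locdeg A z).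
  by move=> k0; rewrite QS; exact: spl_pcomp.
have [|E HE] := @bounded_support A (fun j w => ~ spl (Qj j) w 1) degA _ W HW.
  by move=> j z e1 nz /step; rewrite e1 => /(_ isT).
have off j w : w \notin E -> spl (Qj j) w 1.
  by move=> wE; apply: contrapT => /HE; rewrite (negPf wE).
(* As level j splits at exponent N, its splitting at k depends only on gcd(k, N); this finite table
   over [E] therefore records all its ramification. *)
pose sig j : {ffun 'I_(size E) * 'I_N.+1 -> bool} :=
  [ffun p : 'I_(size E) * 'I_N.+1 => `[< spl (Qj j) (nth None E p.1) p.2 >]].
have splN j w k : (0 < k)%N -> spl (Qj j) w k <-> spl (Qj j) w (gcdn k N).
  move=> k0; split=> [H|H]; first exact: spl_gcd (HN j w).
  rewrite -(divnK (dvdn_gcdl k N)); apply: spl_mul => //.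
  by rewrite divn_gt0 ?gcdn_gt0 ?k0 // dvdn_leq ?dvdn_gcdl.
have [a [b [ab sigE]]] := pigeonhole_nat sig.
have per w k : (0 < k)%N -> spl (Qj a) w k <-> spl (Qj b) w k.
  move=> k0; case: (boolP (w \in E)) => wE; last first.
    by split=> _; rewrite -[k]muln1; apply: spl_mul => //; exact: off.
  rewrite (splN a) // (splN b) //.
  have iE : (index w E < size E)%N by rewrite index_mem.
  have gN : (gcdn k N < N.+1)%N by rewrite ltnS dvdn_leq ?dvdn_gcdr.
  have := congr1 (fun f : {ffun _ -> bool} => f (Ordinal iE, Ordinal gN)) sigE.
  by rewrite !ffunE /= nth_index // => ab'; split=> /asboolP; [rewrite ab'|rewrite -ab'] => /asboolP.
exists a, (\prod_(a <= j < b) Qj j).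
have inP w k : (0 < k)%N -> spl (\prod_(a <= j < b) Qj j) w k <->
    forall j, (a <= j < b)%N -> spl (Qj j) w k.
  move=> k0; rewrite -(big_map Qj xpredT id) spl_prodP //; split=> [H j jab|H P].
    by apply: H; apply: map_f; rewrite mem_index_iota.
  by case/mapP => j; rewrite mem_index_iota => /H ? ->.
split.
- rewrite prodf_seq_neq0; apply/allP => j _; apply/implyP => _.
  by rewrite -size_poly_eq0 size_pcomp size_poly_eq0.
- by rewrite big_ltn // dvdp_mulr.
- by move=> w; apply/inP => // j _; exact: HN.
- move=> z k k0; rewrite inP // inP ?muln_gt0 ?k0 ?locdeg_gt0 //; split=> H j /andP[aj jb].
    apply: (step j z k k0).1; case: (ltnP j.+1 b) => [jb'|bj]; first by apply: H; rewrite jb' leqW.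
    have -> : j.+1 = b by apply/eqP; rewrite eqn_leq jb.
    by apply: (per z k k0).1; apply: H; rewrite leqnn.
  case: (ltnP a j) => [|ja].
    case: j aj jb => // j _ jb aj; apply: (step j z k k0).2; apply: H; rewrite -ltnS aj /=.
    exact: ltnW.
  have -> : j = a by apply/eqP; rewrite eqn_leq aj ja.
  have b0 : (0 < b)%N by apply: leq_trans ab.
  apply: (per z k k0).2; rewrite -(prednK b0); apply: (step _ z k k0).2.
  by apply: H; rewrite -ltnS prednK // ab leqnn.
- by exists E => w wE; apply/inP => // j _; exact: off.
Qed.

Lemma frequent_member (T : eqType) (s : seq T) (P : nat -> T -> Prop) J0 :
  (forall j, (J0 <= j)%N -> exists2 x, x \in s & P j x) ->
  exists2 x, x \in s & forall J, exists j, (J <= j)%N /\ P j x.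
Proof.
elim: s J0 => [|x s IH] J0 H; first by have [] := H J0 (leqnn _).
case: (pselect (forall J, exists j, (J <= j)%N /\ P j x)) => [Hx|].
  by exists x; rewrite ?mem_head.
move=> /existsNP[J1 nJ1]; have [|y ys Hy] := IH (maxn J0 J1).
  move=> j; rewrite geq_max => /andP[/H[y + Py] J1j].
  rewrite inE => /orP[/eqP yx|ys]; last by exists y.
  by case: nJ1; exists j; rewrite -yx.
by exists y; rewrite ?inE ?ys ?orbT.
Qed.

(* Factor A^d(x) - U(y) at a level d with the largest number of factors: all further pullbacks of these factors are irreducible. *)
Lemma bounded_tower A U : (2 <= rdeg A)%N -> nonconst U -> gd_bounded A U ->
  exists d Q P N, [/\ (1 < size Q)%N, Q %| fibp rC U (iterc A d), Q %| P /\ P != 0,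
    (0 < N)%N /\ forall w, spl P w N &
    (forall z k, (0 < k)%N -> spl P z k <-> spl P (evalr A z) (k * locdeg A z)) /\
    exists E : seq (option C), forall w, w \notin E -> spl P w 1].
Proof.
move=> degA hU [M HM]; have hA : nonconst A := ltnW degA.
have hAd d : nonconst (iterc A d) by exact: iterc_nonconst.
pose Fac d k := exists s : seq {poly ratf R}, [/\ size s = k,
  (forall Q, Q \in s -> 1 < size Q)%N & fibp rC U (iterc A d) %= \prod_(Q <- s) Q].
have Fac1 : exists k, `[< exists d, Fac d k >].
  exists 1%N; apply/asboolP; exists 0%N, [:: fibp rC U (iterc A 0)].
  split=> // [Q|]; last by rewrite big_seq1 eqpxx.
  by rewrite inE => /eqP ->; rewrite size_fibp_rC.
have Facle k : `[< exists d, Fac d k >] -> (k <= rdeg U)%N.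
  move=> /asboolP[d [s [<- Hs E]]]; rewrite -ltnS -(size_fibp_rC U (hAd d)) (eqp_size E).
  elim: s Hs {E} => [|Q s IH] Hs; first by rewrite big_nil size_poly1.
  have sQ := Hs Q (mem_head _ _).
  have {}IH := IH (fun P Ps => Hs P (mem_behead (s := Q :: s) Ps)).
  rewrite big_cons size_mul -?size_poly_gt0 ?(leq_trans _ IH) // ?(ltnW sQ) //=.
  by move: sQ IH; case: (size Q) => [|[|q]] // _ IH; rewrite !addSn /= ltnS ltn_addl.
case: (ex_maxnP Fac1 Facle) => k /asboolP[d0 [s [sk Hs sE]]] kmax.
have split_at d j : fibp rC U (iterc A (d + j)) = pcomp (iterc A j) (fibp rC U (iterc A d)).
  by rewrite pcomp_fibp // iterc_add.
have prodE j (t : seq {poly ratf R}) :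
    pcomp (iterc A j) (\prod_(Q <- t) Q) = \prod_(Q <- t) pcomp (iterc A j) Q.
  exact: (rmorph_prod (map_poly (compm (iterc A j)))).
have facE j : fibp rC U (iterc A (d0 + j)) %= \prod_(Q <- s) pcomp (iterc A j) Q.
  by rewrite split_at -prodE /pcomp eqp_map.
(* A factorization appearing after j further pullbacks would give k + 1 factors at level d0 + j,
   against the maximality of k. *)
have irr j Q : Q \in s -> irreducible_poly (pcomp (iterc A j) Q).
  move=> Qs; split; first by rewrite size_pcomp Hs.
  move=> q q1 /dvdpP[r rE].
  have Q0 : pcomp (iterc A j) Q != 0 by rewrite -size_poly_gt0 size_pcomp ltnW // Hs.
  have q0 : q != 0 by apply: contra_neq Q0 => h; rewrite rE h mulr0.
  have r0 : r != 0 by apply: contra_neq Q0 => h; rewrite rE h mul0r.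
  case: (leqP (size r) 1) => [r1|r1].
    have [c c0 rc] : exists2 c, c != 0 & r = c%:P.
      by apply/size_poly1P; rewrite eqn_leq r1 size_poly_gt0.
    by rewrite rE rc mul_polyC eqp_sym eqp_scale.
  have : Fac (d0 + j)%N k.+1.
    exists (r :: q :: map (pcomp (iterc A j)) (rem Q s)); split.
    - rewrite /= size_map -sk; have := perm_size (perm_to_rem Qs) => /= ->.
      by [].
    - move=> P; rewrite !inE => /or3P[/eqP->//|/eqP->|/mapP[P' P's ->]].
        by rewrite ltn_neqAle eq_sym q1 size_poly_gt0.
      by rewrite size_pcomp Hs // (mem_rem P's).
    - rewrite !big_cons mulrA -rE big_map.
      by have := facE j; rewrite (perm_big _ (perm_to_rem Qs)) big_cons.
  move=> F; suff : (k.+1 <= k)%N by rewrite ltnn.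
  by apply: kmax; apply/asboolP; exists (d0 + j)%N.
(* The bound of [genus_ramified] for genus at most M and y-degree at most deg U. *)
pose W := (2 * M + 2 * rdeg U)%N.
pose bounded j Q := forall t, uniq t ->
  {in t, forall w, ~ spl (pcomp (iterc A j) Q) w 1} -> (size t <= W)%N.
have [Q Qs HQ] : exists2 Q, Q \in s & forall J, exists j, (J <= j)%N /\ bounded j Q.
  apply: (@frequent_member _ _ _ 1) => j j0.
  have [|Qd [g [cQ [gQ gM]]]] := HM (d0 + j)%N; first by rewrite ltn_addl.
  have [irrQ Qdvd] := component_irreducible hU cQ.
  have [Q Qs QdQ] : exists2 Q, Q \in s & fracp Qd %| pcomp (iterc A j) Q.
    have := irreducible_dvd_prod (s := map (pcomp (iterc A j)) s) irrQ.
    rewrite big_map -(eqp_dvdr _ (facE j)) => /(_ Qdvd)[_ /mapP[Q Qs ->] H].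
    by exists Q.
  have {}QdQ : fracp Qd %= pcomp (iterc A j) Q.
    by apply: (irr j Q Qs).2 => //; rewrite neq_ltn irrQ.1 orbT.
  exists Q => // t ut Ht.
  have sQd : (size Qd <= (rdeg U).+1)%N.
    rewrite -size_fracp -(size_fibp_rC U (hAd (d0 + j)%N)); apply: dvdp_leq => //.
    by rewrite -size_poly_gt0 size_fibp_rC.
  apply: (@leq_trans (2 * g + 2 * (size Qd).-1)%N).
    apply: genus_ramified gQ _ _ ut _.
    - by rewrite -size_fracp irrQ.1.
    - move=> w; exists (rdeg U)`!; rewrite fact_gt0; split=> //.
      exact: spl_dvd Qdvd (spl_fibp_fact w hU (hAd _)).
    - by move=> w wt H; apply: (Ht w wt); apply: spl_eqp H; rewrite eqp_sym.
  have sQ' : ((size Qd).-1 <= rdeg U)%N by move: sQd; case: (size Qd).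
  by rewrite /W leq_add // leq_mul2l /= ?gM ?sQ'.
have Qdvd j : pcomp (iterc A j) Q %| fibp rC U (iterc A (d0 + j)).
  by rewrite (eqp_dvdr _ (facE j)) (big_rem Q) //= dvdp_mulr.
have [||||j [P [P0 QP PN Pfix PE]]] := @periodic_tower A Q (rdeg U)`! degA.
- by rewrite -size_poly_gt0 ltnW // Hs.
- exact: fact_gt0.
- move=> j w; exact: spl_dvd (Qdvd j) (spl_fibp_fact w hU (hAd _)).
- by exists W.
exists (d0 + j)%N, (pcomp (iterc A j) Q), P, (rdeg U)`!; rewrite fact_gt0 size_pcomp.
by split=> //; exact: Hs.
Qed.

Definition orb_fixed A (nu : option C -> nat) :=
  forall z, nu (evalr A z) = (nu z * gcdn (locdeg A z) (nu (evalr A z)))%N.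

(** Goodness holds because of [two_point_ram]: when at most two points carry an index above 1, the
    two indices divide each other, the second being 1 if only one point is ramified. *)
Lemma ram_index_orbifold A P N : nonconst A -> P != 0 -> (0 < N)%N ->
  (forall w, spl P w N) ->
  (forall z k, (0 < k)%N -> spl P z k <-> spl P (evalr A z) (k * locdeg A z)) ->
  (exists E : seq (option C), forall w, w \notin E -> spl P w 1) ->
  good_orbifold (ram_index P) /\ orb_fixed A (ram_index P).
Proof.
move=> hA P0 N0 HN Pfix [E HE].
have nu0 w : (0 < ram_index P w)%N by have [] := ram_indexP N0 (HN w).
have nuP w j : (0 < j)%N -> spl P w j <-> (ram_index P w %| j)%N.
  by move=> j0; have [_ ->] := ram_indexP N0 (HN w).
have nu1 w : spl P w 1 <-> ram_index P w = 1%N.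
  by rewrite nuP // dvdn1; split=> [/eqP|->].
have orb : orbifold (ram_index P) by split=> //; exists E => z /HE/nu1.
have Hex w : exists k, (0 < k)%N /\ spl P w k by exists N.
split; [split=> //|]; last first.
  move=> z; apply: dvdn_fixed_gcd; rewrite ?locdeg_gt0 // => k k0.
  by rewrite -nuP // Pfix // nuP // muln_gt0 k0 locdeg_gt0.
have two a b : a != b -> (forall w, w != a -> w != b -> ram_index P w = 1%N) ->
    (ram_index P b %| ram_index P a)%N.
  move=> ab H; rewrite -nuP //; apply: (two_point_ram P0 ab (nu0 a) Hex).
    by move=> w wa wb; apply/nu1/H.
  by rewrite nuP.
have ngt w : ~ (1 < ram_index P w)%N -> ram_index P w = 1%N.
  by move/negP; rewrite -leqNgt => H; apply/eqP; rewrite eqn_leq H nu0.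
split=> [[z1 H1]|[z1 [z2 [/eqP z12 [H12 ne]]]]].
  have [z2 [z12 _]] := third_point z1 z1.
  have z2n : ram_index P z2 = 1%N by apply: ngt => /H1 E2; rewrite E2 eqxx in z12.
  have := two z2 z1; rewrite eq_sym z12 z2n dvdn1 => /(_ isT) H.
  suff : ram_index P z1 == 1%N by move/eqP => E1; have := (H1 z1).2 erefl; rewrite E1.
  by apply: H => w _ wz; apply: ngt => /H1 E2; rewrite E2 eqxx in wz.
have off w : w != z1 -> w != z2 -> ram_index P w = 1%N.
  by move=> w1 w2; apply: ngt => /H12[] E2; [rewrite E2 eqxx in w1|rewrite E2 eqxx in w2].
apply: ne; apply/eqP; rewrite eqn_dvd two //=; first by apply: two => // w w1 w2; exact: off.
- by rewrite eq_sym.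
- by move=> w w2 w1; exact: off.
Qed.

Lemma bounded_lfactor A U : (2 <= rdeg A)%N -> ~ gen_lattes A -> nonconst U ->
  gd_bounded A U -> exists l, (1 <= l)%N /\ lfactor U (iterc A l).
Proof.
move=> degA nG hU gdb; have hA : nonconst A := ltnW degA.
have [d [Q [P [N [sQ Qdvd [QP P0] [N0 PN] [Pfix PE]]]]]] := bounded_tower degA hU gdb.
have [good fixP] := ram_index_orbifold hA P0 N0 PN Pfix PE.
have tr w : spl P w 1.
  have [nu0 nuP] := ram_indexP N0 (PN w).
  apply/nuP => //; rewrite dvdn1; apply/eqP; apply: contrapT => ne.
  by apply: nG; split=> //; exists (ram_index P); split=> //; split=> //; exists w.
have sP : splits P by apply: unramified_splits P0 N0 _ (PN None).
have [V rV] := splits_root (splits_dvd QP sP) sQ.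
have rV' : root (fibp rC U (iterc A d)) V.
  by move: rV; rewrite -!dvdp_XsubCl => /dvdp_trans; exact.
have [E hV] := root_fibp (iterc_nonconst d hA) rV'.
(* The level d may be 0; one more composition with A gives l >= 1. *)
exists d.+1; split=> //; exists (rcomp V A).
by rewrite -addn1 iterc_add // iterc1 E rcompA.
Qed.

End Tower.

(** The last hypothesis is 1/p + 1/q + 1/r > 1 with denominators cleared. *)
Lemma triple_classification p q r : (1 < p)%N -> (p <= q)%N -> (q <= r)%N ->
  (p * q * r < q * r + p * r + p * q)%N ->
  p = 2 /\ (q = 2 \/ q = 3 /\ (r <= 5)%N).
Proof.
move=> p1 pq qr H.
have pr : (p * r <= q * r)%N by rewrite leq_mul2r pq orbT.
have pq' : (p * q <= q * r)%N by rewrite mulnC leq_mul2l (leq_trans pq qr) orbT.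
have p2 : p = 2%N.
  apply/eqP; rewrite eqn_leq p1 andbT leqNgt; apply/negP => p3.
  have : (3 * (q * r) <= p * (q * r))%N by rewrite leq_mul2r p3 orbT.
  move: H pr pq'; rewrite -mulnA; lia.
subst p; split=> //.
have q3 : (q <= 3)%N.
  rewrite leqNgt; apply/negP => q4; have : (4 * r <= q * r)%N by rewrite leq_mul2r q4 orbT.
  move: H; rewrite -mulnA; lia.
have [q2|q2] : q = 2%N \/ q = 3%N by lia.
  by left.
by right; split=> //; move: H; rewrite q2; lia.
Qed.

Fact recip_sum (x y z : rat) : 0 < x -> 0 < y -> 0 < z ->
  1 - x^-1 + (1 - y^-1 + (1 - z^-1)) < 2 -> x * y * z < y * z + x * z + x * y.
Proof.
move=> x0 y0 z0 H; have xyz : 0 < x * y * z by rewrite !mulr_gt0.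
have : 0 < (x^-1 + y^-1 + z^-1 - 1) * (x * y * z) by rewrite mulr_gt0 //; lra.
have -> : (x^-1 + y^-1 + z^-1 - 1) * (x * y * z) = y * z + x * z + x * y - x * y * z.
  by field; rewrite !gt_eqF.
by rewrite subr_gt0.
Qed.

(** * Fixed orbifolds *)

Section OrbifoldEuler.
Variable R : realType.
Local Notation C := R[i].
Implicit Types (A F : ratf R) (w z a b c : option C) (s : seq (option C)).
Implicit Types nu : option C -> nat.

Local Notation defect n := (1 - (n%:R)^-1 : rat).

Lemma orbifold_support nu : orbifold nu ->
  exists s, uniq s /\ forall w, (w \in s) = (nu w != 1%N).
Proof.
move=> [_ [E HE]]; exists [seq w <- undup E | nu w != 1%N].
rewrite filter_uniq ?undup_uniq //; split=> // w.
rewrite mem_filter mem_undup; case: (boolP (w \in E)) => [_|/HE ->] //.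
by rewrite andbT.
Qed.

Lemma defect_ge0 n : (0 < n)%N -> 0 <= defect n.
Proof. by move=> n0; rewrite subr_ge0 invf_le1 ?ltr0n // ler1n. Qed.

(** Applied with e = deg_z A, n = nu(A(z)), k = nu(z). Setting f = e / gcd(e, n) one has e/n = f/k,
    so the inequality says f >= 1 and equality means f = 1. *)
Lemma defect_step (e n k : nat) : (0 < e)%N -> (0 < n)%N -> (0 < k)%N ->
  n = (k * gcdn e n)%N ->
  e%:R * defect n <= e.-1%:R + defect k /\
  (e%:R * defect n = e.-1%:R + defect k -> gcdn e n = e).
Proof.
move=> e0 n0 k0; move: (gcdn e n) (dvdn_gcdl e n) => g /dvdnP[f fE] nE.
have g0 : (0 < g)%N by move: e0; rewrite fE muln_gt0 => /andP[].
have f0 : (0 < f)%N by case: f fE e0 => // ->.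
have E : e%:R / n%:R = f%:R / k%:R :> rat.
  rewrite fE nE !natrM; field.
  by rewrite !pnatr_eq0 -!lt0n g0 k0.
have -> : e.-1%:R = e%:R - 1 :> rat by rewrite -{2}(prednK e0) -natr1 addrK.
have -> : e%:R * defect n = e%:R - f%:R / k%:R :> rat by rewrite -E; ring.
have kV : 0 < k%:R^-1 :> rat by rewrite invr_gt0 ltr0n.
have f1 : 1 <= f%:R :> rat by rewrite ler1n.
split; first by nra.
move=> H; have : (f%:R - 1) * k%:R^-1 = 0 :> rat by lra.
move/eqP; rewrite mulf_eq0 (gt_eqF kV) orbF subr_eq0 (eqr_nat rat f 1) => /eqP f1'.
by rewrite fE f1' mul1n.
Qed.

Lemma sum_fibers A s (F : option C -> rat) :
  \sum_(z <- fibers A s) F z = \sum_(w <- s) \sum_(z <- fiber A w) F z.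
Proof. by rewrite /fibers big_flatten big_map. Qed.

Lemma ler_sum_subset (T : eqType) (s t : seq T) (F : T -> rat) :
  uniq s -> uniq t -> (forall x, 0 <= F x) -> (forall x, x \in s -> x \notin t -> F x = 0) ->
  \sum_(x <- s) F x <= \sum_(x <- t) F x.
Proof.
move=> us ut F0 Fs; rewrite (bigID (mem t)) /= [X in _ + X]big_seq_cond.
rewrite [X in _ + X]big1 ?addr0; last by move=> x /andP[xs xt]; exact: Fs.
rewrite [leRHS](bigID (mem s)) /= -[leLHS]addr0; apply: lerD; last exact: sumr_ge0.
have p : perm_eq [seq x <- s | x \in t] [seq x <- t | x \in s].
  by apply: uniq_perm; rewrite ?filter_uniq // => x; rewrite !mem_filter andbC.
by rewrite -big_filter (perm_big _ p) big_filter.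
Qed.

(* Riemann-Hurwitz gives deg A * T <= 2 deg A - 2 + T for T = sum (1 - 1/nu), with equality exactly for Lattes maps. *)
Lemma orbifold_euler A nu s : (2 <= rdeg A)%N -> good_orbifold nu -> orb_fixed A nu ->
  ~ lattes A -> uniq s -> (forall w, (w \in s) = (nu w != 1%N)) ->
  \sum_(w <- s) defect (nu w) < 2.
Proof.
move=> degA good fixA nL us Hs; have hA : nonconst A := ltnW degA.
have [[nu0 _] _] := good.
set T := \sum_(w <- s) _.
have step z : _ := defect_step (locdeg_gt0 z hA) (nu0 (evalr A z)) (nu0 z) (fixA z).
pose t := fibers A s.
have ut : uniq t by exact: fibers_uniq.
have mT : (rdeg A)%:R * T = \sum_(z <- t) (locdeg A z)%:R * defect (nu (evalr A z)).
  rewrite sum_fibers /T mulr_sumr; apply: eq_bigr => w _.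
  rewrite -(sum_fiber w hA) natr_sum mulr_suml big_seq [RHS]big_seq; apply: eq_bigr => z.
  by rewrite mem_fiber // => /eqP ->.
pose X : rat := \sum_(z <- t) ((locdeg A z).-1)%:R.
pose Y := \sum_(z <- t) defect (nu z).
have le1 : (rdeg A)%:R * T <= X + Y.
  by rewrite mT /X /Y -big_split /=; apply: ler_sum => z _; have [] := step z.
have XE : X = (\sum_(z <- t) (locdeg A z).-1)%:R by rewrite /X natr_sum.
have m2 : ((rdeg A).*2 - 2)%:R = 2 * (rdeg A)%:R - 2 :> rat.
  by rewrite -mul2n natrB ?natrM // -{1}[2%N]muln1 leq_mul2l (ltnW degA).
have le2 : X <= 2 * (rdeg A)%:R - 2.
  by rewrite XE -m2 ler_nat; exact: riemann_hurwitz_le.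
have le3 : Y <= T.
  apply: ler_sum_subset => // [z|z _]; first exact: defect_ge0.
  by rewrite Hs negbK => /eqP ->; rewrite invr1 subrr.
have m1 : 2 <= (rdeg A)%:R :> rat by rewrite (ler_nat _ 2).
rewrite ltNge; apply/negP => T2; apply: nL; split=> //; exists nu; split=> // z.
have Teq : T = 2 by nra.
have X2 : X = 2 * (rdeg A)%:R - 2 by nra.
have Y2 : (rdeg A)%:R * T = X + Y by nra.
case: (boolP (z \in t)) => zt.
  have : \sum_(z <- t) (((locdeg A z).-1)%:R + defect (nu z) -
      (locdeg A z)%:R * defect (nu (evalr A z))) == 0.
    by rewrite big_split /= big_split /= sumrN -mT Y2 subrr.
  rewrite psumr_eq0; last by move=> x _; rewrite subr_ge0; have [] := step x.
  move=> /allP/(_ z zt); rewrite subr_eq0 => /eqP/esym Hz.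
  by rewrite {1}fixA (step z).2.
(* In the equality case the points of [t] exhaust Riemann-Hurwitz, so A is unramified at every other
   point. *)
have e1 : locdeg A z = 1%N.
  have := @riemann_hurwitz_le _ A (z :: t) hA; rewrite /= zt ut => /(_ isT).
  rewrite big_cons -(ler_nat rat) natrD -XE m2 X2.
  have e0 := locdeg_gt0 z hA; case: (locdeg A z) e0 => [|[|e]] //= _.
  have h : 1 <= (e.+1)%:R :> rat by rewrite ler1n.
  by move=> h'; exfalso; move: h h'; lra.
by rewrite {1}fixA e1 gcd1n.
Qed.

Definition orb3 nu a b c p q r := [/\ a != b, b != c, a != c &
  forall w, nu w = if w == a then p else if w == b then q else if w == c then r else 1%N].

(** The case p = 1 holds the trivial and cyclic orbifolds; then come the dihedral ones and the three
    polyhedral ones. *)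
Definition spherical p q r := (p = 1 /\ q = r) \/ (p = 2 /\ q = 2) \/
  (p = 2 /\ q = 3 /\ (r = 3 \/ r = 4 \/ r = 5))%N.

Lemma orbifold_classification A nu : (2 <= rdeg A)%N -> good_orbifold nu ->
  orb_fixed A nu -> ~ lattes A ->
  exists a b c p q r, orb3 nu a b c p q r /\ spherical p q r.
Proof.
move=> degA good fixA nL.
have [[nu0 nufin] [g1 g2]] := good.
have [s [us Hs]] := orbifold_support good.1.
have T2 := orbifold_euler degA good fixA nL us Hs.
pose t := sort (fun x y => nu x <= nu y)%N s.
have pt : perm_eq t s by rewrite perm_sort.
have ut : uniq t by rewrite (perm_uniq pt).
have Ht w : (w \in t) = (nu w != 1%N) by rewrite (perm_mem pt) Hs.
have st : sorted (fun x y => nu x <= nu y)%N t by apply: sort_sorted => x y; exact: leq_total.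
have {}T2 : \sum_(w <- t) defect (nu w) < 2 by rewrite (perm_big _ pt).
have tgt w : w \in t -> (1 < nu w)%N.
  by rewrite Ht => h; have := nu0 w; case: (nu w) h => [|[]].
clearbody t; clear s us Hs pt.
have half w : w \in t -> 2^-1 <= defect (nu w).
  move=> /tgt h; have : (nu w)%:R^-1 <= 2^-1 :> rat.
    by rewrite lef_pV2 ?posrE ?ltr0n ?(ltnW h) // (ler_nat _ 2).
  lra.
have notin w : w \notin t -> nu w = 1%N by rewrite Ht negbK => /eqP.
case: t T2 ut Ht st tgt half notin => [|a [|b [|c [|d t]]]] T2 ut Ht st tgt half notin.
- have [b [b1 _]] := third_point (None : option C) None.
  have [c [c1 c2]] := third_point (None : option C) b.
  exists None, b, c, 1%N, 1%N, 1%N; split; last by left.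
  by split=> // [|w]; [rewrite eq_sym|rewrite notin //; do !case: eqP].
- case: g1; exists a => w; split=> [w1|->]; last by apply: tgt; rewrite mem_head.
  by apply/eqP; rewrite -mem_seq1 Ht; case: (nu w) w1 => [|[]].
- have nab : a != b by move: ut; rewrite /= inE => /andP[].
  have eab : nu a = nu b.
    apply: contrapT => ne; apply: g2; exists a, b; split; first exact/eqP.
    split=> // w; split=> [w1|wab].
      have : w \in [:: a; b] by rewrite Ht; case: (nu w) w1 => [|[]].
      by rewrite !inE => /orP[/eqP|/eqP]; [left|right].
    by apply: tgt; rewrite !inE; apply/orP; case: wab => ->; rewrite eqxx; [left|right].
  have [c [c1 c2]] := third_point a b.
  exists c, a, b, 1%N, (nu a), (nu b); split; last by left.
  split=> // [|w]; first by rewrite eq_sym.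
  case: eqP => [->|wc]; first by apply: notin; rewrite !inE negb_or eq_sym c1.
  case: eqP => [->//|wa]; case: eqP => [->//|wb].
  by apply: notin; rewrite !inE negb_or; apply/andP; split; apply/eqP.
- move: ut; rewrite /= !inE negb_or => /andP[/andP[nab nac] /andP[nbc _]].
  exists a, b, c, (nu a), (nu b), (nu c); split.
    split=> // w; case: eqP => [->//|wa]; case: eqP => [->//|wb]; case: eqP => [->//|wc].
    by apply: notin; rewrite !inE !negb_or; apply/and3P; split; apply/eqP.
  have a1 : (1 < nu a)%N by apply: tgt; rewrite mem_head.
  move: st; rewrite /= andbT => /andP[ab bc].
  have H : (nu a * nu b * nu c < nu b * nu c + nu a * nu c + nu a * nu b)%N.
    rewrite -(ltr_nat rat) !natrD !natrM.
    move: T2; rewrite !big_cons big_nil addr0.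
    have := nu0 a; have := nu0 b; have := nu0 c.
    by rewrite -!(ltr_nat rat) => c0 b0 a0; exact: recip_sum.
  have [a2 [b2|[b3 r5]]] := triple_classification a1 ab bc H; first by right; left.
  by right; right; do 2!split=> //; rewrite b3 in bc; lia.
- move: T2; rewrite !big_cons.
  have := half a; have := half b; have := half c; have := half d.
  rewrite !inE !eqxx !orbT => /(_ isT) hd /(_ isT) hc /(_ isT) hb /(_ isT) ha.
  suff : 0 <= \sum_(w <- t) defect (nu w) by lra.
  by apply: sumr_ge0 => w _; exact: defect_ge0.
Qed.

End OrbifoldEuler.

(** * Klein's uniformizers *)

Section ThreePoints.
Variable R : realType.
Local Notation C := R[i].
Implicit Types (f g X : ratf R) (P Q S : {poly C}) (w z a b c : option C).

Lemma fiber_power f w p S (k : C) z : nonconst f -> k != 0 -> (p %| rdeg f)%N ->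
  fib_poly f w = k *: S ^+ p -> evalr f z = w -> (p %| locdeg f z)%N.
Proof.
move=> hf k0 pf fE zw; have F0 := fib_poly_neq0 w hf.
case: p fE pf => [|p] fE pf.
  move: pf; rewrite dvd0n => /eqP h; by move: hf; rewrite /nonconst h.
have S0 : S != 0 by apply: contra_neq F0 => h; rewrite fE h expr0n scaler0.
case: z zw => [z|] zw; rewrite /locdeg zw fE.
  have -> : mup z (k *: S ^+ p.+1) = (p.+1 * mup z S)%N.
    rewrite mupZ //; elim: p.+1 => [|n IH]; first by rewrite expr0 mul0n mupNroot // root1.
    by rewrite exprS mupM ?expf_neq0 // IH mulSn.
  exact: dvdn_mulr.
by rewrite size_scale // size_exp dvdn_sub // dvdn_mull.
Qed.

Lemma sum_ge_const (T : eqType) (s : seq T) (F : T -> nat) p x :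
  (forall z : T, z \in s -> (p <= F z)%N) -> \sum_(z <- s) F z = (p * x)%N -> (0 < p)%N ->
  (size s <= x)%N /\ (size s = x -> forall z : T, z \in s -> F z = p).
Proof.
move=> Fp sE p0.
have ge (u : seq T) : (forall z : T, z \in u -> (p <= F z)%N) -> (p * size u <= \sum_(z <- u) F z)%N.
  elim: u => [|y u IH] Fu; first by rewrite muln0.
  rewrite big_cons /= mulnS leq_add ?Fu ?mem_head // IH // => v vu.
  by rewrite Fu // inE vu orbT.
split=> [|sx z zs]; first by rewrite -(leq_pmul2l p0) -sE; exact: ge.
have := Fp z zs; rewrite leq_eqVlt => /orP[/eqP//|lt].
have : (p * size s < \sum_(z <- s) F z)%N.
  rewrite (big_rem z) //= (perm_size (perm_to_rem zs)) /= mulnS -addSn leq_add //.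
  by apply: ge => y /mem_rem/Fp.
by rewrite sE sx ltnn.
Qed.

Definition uniformly_ramified f a b c p q r := nonconst f /\ forall z,
  locdeg f z = if evalr f z == a then p else if evalr f z == b then q
               else if evalr f z == c then r else 1%N.

(** With N = deg f the three fibres have at most x + y + t = N + 2 points, while Riemann-Hurwitz
    demands at least N + 2. Hence every index is exact and nothing is left for ramification
    elsewhere. *)
Lemma three_points f a b c p q r x y t : nonconst f -> a != b -> b != c -> a != c ->
  (forall z, evalr f z = a -> (p %| locdeg f z)%N) ->
  (forall z, evalr f z = b -> (q %| locdeg f z)%N) ->
  (forall z, evalr f z = c -> (r %| locdeg f z)%N) ->
  rdeg f = (p * x)%N -> rdeg f = (q * y)%N -> rdeg f = (r * t)%N ->
  (x + y + t = (rdeg f).+2)%N -> uniformly_ramified f a b c p q r.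
Proof.
move=> hf ab bc ac Ha Hb Hc Ep Eq Er E; split=> //.
have base d p' n : (forall z, evalr f z = d -> (p' %| locdeg f z)%N) -> rdeg f = (p' * n)%N ->
    (size (fiber f d) <= n)%N /\
    (size (fiber f d) = n -> forall z, evalr f z = d -> locdeg f z = p').
  move=> H En; have p0 : (0 < p')%N by move: hf; rewrite /nonconst En muln_gt0 => /andP[].
  have [|//|h1 h2] := @sum_ge_const _ (fiber f d) (locdeg f) p' n _ _ p0.
  - by move=> z; rewrite mem_fiber // => /eqP/H; apply: dvdn_leq; exact: locdeg_gt0.
  - by rewrite sum_fiber.
  by split=> // e z zd; apply: h2 => //; rewrite mem_fiber // zd.
have [a1 a2] := base _ _ _ Ha Ep; have [b1 b2] := base _ _ _ Hb Eq.
have [c1 c2] := base _ _ _ Hc Er.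
pose s := fiber f a ++ fiber f b ++ fiber f c.
have ms z : (z \in s) = [|| evalr f z == a, evalr f z == b | evalr f z == c].
  by rewrite /s mem_cat (mem_fiber _ _ hf) mem_cat !(mem_fiber _ _ hf).
have us : uniq s.
  rewrite cat_uniq fiber_uniq /= cat_uniq !fiber_uniq /= andbT; apply/andP; split; apply/hasPn => z.
    by rewrite mem_cat !(mem_fiber _ _ hf) => /orP[]/eqP ->; rewrite eq_sym.
  by rewrite !mem_fiber // => /eqP ->; rewrite eq_sym.
have sum_pred u : (\sum_(z <- u) (locdeg f z).-1 + size u = \sum_(z <- u) locdeg f z)%N.
  elim: u => [|z u IH]; first by rewrite !big_nil.
  by rewrite !big_cons /= -IH addnS -addSn -addSn prednK ?locdeg_gt0 // addnA.
have sum_s : (\sum_(z <- s) (locdeg f z).-1 + size s = 3 * rdeg f)%N.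
  by rewrite sum_pred /s big_cat /= sum_fiber // big_cat /= !sum_fiber // !mulSn mul0n addn0.
have m0 : (2 <= (rdeg f).*2)%N by rewrite -[2%N]/(1.*2) leq_double.
have RH := riemann_hurwitz_le hf us.
have ss : size s = (rdeg f).+2.
  apply/eqP; rewrite eqn_leq; apply/andP; split.
    by rewrite -E /s size_cat (size_cat (fiber f b)) addnA !leq_add.
  by move: RH sum_s m0; rewrite -mul2n; move: (size s) (rdeg f) (\sum_(z <- s) _)%N; lia.
have [sa sb sc] : [/\ size (fiber f a) = x, size (fiber f b) = y & size (fiber f c) = t].
  move: ss; rewrite /s size_cat (size_cat (fiber f b)) -E; move: a1 b1 c1; clear.
  by move: (size (fiber f a)) (size (fiber f b)) (size (fiber f c)) => i j k; split; lia.
move=> z; case: eqP => [/(a2 sa)//|/eqP za]; case: eqP => [/(b2 sb)//|/eqP zb].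
case: eqP => [/(c2 sc)//|/eqP zc].
have zs : z \notin s by rewrite ms !negb_or za zb.
have := @riemann_hurwitz_le _ f (z :: s) hf; rewrite /= zs us => /(_ isT).
rewrite big_cons; have := locdeg_gt0 z hf; move: sum_s; rewrite ss -mul2n => h1 h2 h3.
have m1 : (0 < rdeg f)%N := hf.
move: h1 h2 h3 m1; move: (locdeg f z) (\sum_(z <- s) _)%N (rdeg f); clear; lia.
Qed.

Lemma uniformly_ramified_mobius f M a b c p q r : rdeg M = 1%N ->
  uniformly_ramified f a b c p q r ->
  uniformly_ramified (rcomp M f) (evalr M a) (evalr M b) (evalr M c) p q r.
Proof.
move=> M1 [hf Hf]; have hM : nonconst M by rewrite /nonconst M1.
have [Ml Minj] := rdeg1_bij M1.
split=> [|z]; first exact: nonconst_comp.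
by rewrite locdeg_comp // evalr_comp // Ml muln1 Hf !(inj_eq Minj).
Qed.

Lemma coprimep_no_root P Q : (forall z : C, Q.[z] = 0 -> P.[z] != 0) -> coprimep P Q.
Proof.
move=> H; apply/coprimepP => d dp dq; rewrite -size_poly_eq1; apply/negPn/negP => sd.
have [z rz] : exists z : C, root d z by apply/closed_rootP.
move: rz; rewrite -dvdp_XsubCl => rz; have := dvdp_trans rz dq; have := dvdp_trans rz dp.
by rewrite !dvdp_XsubCl /root => /eqP p0 /eqP/H; rewrite p0 eqxx.
Qed.

(** The syzygy displays the fibres over 0, 1 and infinity as powers of [S0], [S1], [S3], and x, y, t
    count their points. [S3] may have degree below t, which happens when infinity is itself a
    pole. *)
Lemma klein_form S0 S1 S3 (k l : C) p q r x y t : k != 0 -> l != 0 ->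
  S0 ^+ p - k *: S3 ^+ r = l *: S1 ^+ q -> (forall z : C, S3.[z] = 0 -> S0.[z] != 0) ->
  size S0 = x.+1 -> (0 < size S3 <= t.+1)%N -> (0 < p * x)%N ->
  (p * x = q * y)%N -> (p * x = r * t)%N -> (x + y + t = (p * x).+2)%N ->
  uniformly_ramified ((S0 ^+ p)%:F / (k *: S3 ^+ r)%:F) (Some 0) (Some 1) None p q r.
Proof.
move=> k0 l0 E cop s0 /andP[S30 s3] N0 Nq Nr N2.
have S30' : S3 != 0 by rewrite -size_poly_gt0.
pose Q := k *: S3 ^+ r.
have Q0 : Q != 0 by rewrite scaler_eq0 negb_or k0 expf_neq0.
have PQ : coprimep (S0 ^+ p) Q.
  by rewrite coprimepZr //; apply: coprimep_expl; apply: coprimep_expr; exact: coprimep_no_root.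
have sP : size (S0 ^+ p) = (p * x).+1.
  have S00 : S0 != 0 by rewrite -size_poly_gt0 s0.
  by rewrite -[LHS]prednK ?size_poly_gt0 ?expf_neq0 // size_exp s0 mulnC.
have dE : rdeg ((S0 ^+ p)%:F / Q%:F) = (p * x)%N.
  rewrite rdeg_reduced // sP; have -> // : maxn (p * x).+1 (size Q) = (p * x).+1.
  apply/maxn_idPl; rewrite size_scale // -[size _]prednK ?size_poly_gt0 ?expf_neq0 // ltnS.
  by rewrite size_exp mulnC Nr leq_mul2l -ltnS prednK ?s3 ?orbT.
have hf : nonconst ((S0 ^+ p)%:F / Q%:F) by rewrite /nonconst dE.
apply: (@three_points _ _ _ _ p q r x y t) => //; rewrite ?dE //.
- by rewrite (inj_eq Some_inj) eq_sym oner_eq0.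
- move=> z; have [c c0 fE] := fib_poly_reduced Q0 PQ (Some 0).
  by apply: (fiber_power hf c0 _ (S := S0)); rewrite ?dE ?dvdn_mulr // fE /= scale0r subr0.
- move=> z; have [c c0 fE] := fib_poly_reduced Q0 PQ (Some 1).
  apply: (fiber_power (k := c * l) hf _ _ (S := S1)); rewrite ?dE ?Nq ?dvdn_mulr ?mulf_neq0 //.
  by rewrite fE /= scale1r -scalerA -E.
- move=> z; have [c c0 fE] := fib_poly_reduced Q0 PQ None.
  apply: (fiber_power (k := c * k) hf _ _ (S := S3)); rewrite ?dE ?Nr ?dvdn_mulr ?mulf_neq0 //.
  by rewrite fE /= /Q scalerA.
Qed.

Lemma size_Xn_lower n (S : {poly C}) : (size S <= n)%N -> size ('X^n + S) = n.+1.
Proof. by move=> h; rewrite size_polyDl size_polyXn. Qed.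

Lemma horner_natr n (z : C) : (n%:R : {poly C}).[z] = n%:R.
Proof. by rewrite -polyC_natr hornerC. Qed.

Definition hornerS := (horner_natr, hornerXn, hornerX, hornerC, hornerN, hornerM, hornerD).

Lemma size_natr_monom k n m : (n < m)%N -> (size (k%:R * 'X^n : {poly C})%R <= m)%N.
Proof.
by move=> nm; rewrite -polyC_natr mul_polyC (leq_trans (size_scale_leq _ _)) // size_polyXn.
Qed.

Lemma size_polyD_le (P Q : {poly C}) m :
  (size P <= m)%N -> (size Q <= m)%N -> (size (P + Q)%R <= m)%N.
Proof. by move=> hP hQ; rewrite (leq_trans (size_polyD _ _)) // geq_max hP. Qed.

Lemma cyclic_form n : (0 < n)%N ->
  exists f, uniformly_ramified f (Some 0) (Some 1) None n 1 n.
Proof.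
move=> n0; eexists; apply: (@klein_form 'X ('X^n - 1) 1 1 1 n 1 n 1 n 1); rewrite ?oner_eq0 ?size_polyX ?size_poly1 ?muln1 ?mul1n //.
- by rewrite !scale1r expr1n expr1.
- by move=> z; rewrite hornerC => /eqP; rewrite oner_eq0.
- by rewrite add1n addn1.
Qed.

Lemma dihedral_form n : (0 < n)%N ->
  uniformly_ramified ((('X^n + 1) ^+ 2)%:F / (4 *: 'X ^+ n)%:F) (Some 0) (Some 1) None 2 2 n.
Proof.
move=> n0; apply: (@klein_form ('X^n + 1) ('X^n - 1) 'X 4 1 2 2 n n n 2); rewrite ?oner_eq0 ?size_polyX ?muln_gt0 ?n0 //.
- by rewrite (pnatr_eq0 _ 4).
- by rewrite scale1r scaler_nat; ring.
- by move=> z; rewrite !hornerS => ->; rewrite expr0n gtn_eqF // add0r oner_eq0.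
- by rewrite size_Xn_lower // size_poly1.
- by rewrite mulnC.
- lia.
Qed.

(* Klein's invariant forms; the tetrahedral one is the level 3 form of the j-invariant. *)
Fact tetrahedral_identity (A : comNzRingType) (x : A) :
  (x * (x ^+ 3 + 8)) ^+ 3 - 64 * (x ^+ 3 - 1) ^+ 3 = (x ^+ 6 - 20 * x ^+ 3 - 8) ^+ 2.
Proof. ring. Qed.

Fact octahedral_identity (A : comNzRingType) (x : A) :
  (x ^+ 8 + (14 * x ^+ 4 + 1)) ^+ 3 - 108 * (x * (x ^+ 4 - 1)) ^+ 4 =
  (x ^+ 12 - 33 * x ^+ 8 - 33 * x ^+ 4 + 1) ^+ 2.
Proof. ring. Qed.

Fact icosahedral_identity (A : comNzRingType) (x : A) :
  (x ^+ 20 + (- 228 * x ^+ 15 + 494 * x ^+ 10 + 228 * x ^+ 5 + 1)) ^+ 3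
    + 1728 * (x * (x ^+ 10 + 11 * x ^+ 5 - 1)) ^+ 5 =
  (x ^+ 30 + 522 * x ^+ 25 - 10005 * x ^+ 20 - 10005 * x ^+ 10 - 522 * x ^+ 5 + 1) ^+ 2.
Proof. ring. Qed.

(** Where z^10 + 11 z^5 - 1 vanishes the form of degree 20 equals 5^5 (1 - 11 z^5) = 5^5 z^10, so a
    common zero would be z = 0, which is not a zero of the former. *)
Fact icosahedral_resultant (A : comNzRingType) (z : A) :
  (z ^+ 20 + (- 228 * z ^+ 15 + 494 * z ^+ 10 + 228 * z ^+ 5 + 1)) =
  (z ^+ 10 - 239 * z ^+ 5 + 3124) * (z ^+ 10 + 11 * z ^+ 5 - 1) + 3125 * (1 - 11 * z ^+ 5).
Proof. ring. Qed.

Lemma tetrahedral_form : exists f, uniformly_ramified f (Some 0) (Some 1) None 3 2 3.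
Proof.
have s8 : size ('X^3 + 8 : {poly C}) = 4%N.
  by rewrite size_Xn_lower // -[8]mulr1 -(expr0 'X) size_natr_monom.
eexists; apply: (@klein_form ('X * ('X^3 + 8)) ('X^6 - 20 * 'X^3 - 8) ('X^3 - 1) 64 1 3 2 3 4 6 4); rewrite ?oner_eq0 ?(pnatr_eq0 C 64) //.
- rewrite scale1r -mul_polyC polyC_natr; exact: tetrahedral_identity.
- move=> z; rewrite !hornerS => /eqP; rewrite subr_eq0 => /eqP z3.
  rewrite z3 mulf_neq0 //; last by rewrite nat1r (pnatr_eq0 C 9).
  by apply: contra_eq_neq z3 => ->; rewrite expr0n eq_sym oner_eq0.
- by rewrite mulrC size_mulX ?s8 // -size_poly_gt0 s8.
- by rewrite size_Xn_lower ?size_polyN ?size_poly1.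
Qed.

Lemma octahedral_form : exists f, uniformly_ramified f (Some 0) (Some 1) None 3 2 4.
Proof.
have s4 : size ('X^4 - 1 : {poly C}) = 5%N.
  by rewrite size_Xn_lower ?size_polyN ?size_poly1.
eexists; apply: (@klein_form ('X^8 + (14 * 'X^4 + 1)) ('X^12 - 33 * 'X^8 - 33 * 'X^4 + 1) ('X * ('X^4 - 1)) 108 1 3 2 4 8 12 6); rewrite ?oner_eq0 ?(pnatr_eq0 C 108) //.
- rewrite scale1r -mul_polyC polyC_natr; exact: octahedral_identity.
- move=> z; rewrite !hornerS => /eqP; rewrite mulf_eq0 subr_eq0 => /orP[]/eqP zE.
    by rewrite zE !expr0n /= mulr0 !add0r oner_eq0.
  rewrite (exprM z 4 2) zE expr1n; have -> : 1 + (14 * 1 + 1) = 16 :> C by ring.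
  by rewrite (pnatr_eq0 C 16).
- by rewrite size_Xn_lower // size_polyD_le ?size_natr_monom ?size_poly1.
- by rewrite mulrC size_mulX ?s4 // -size_poly_gt0 s4.
Qed.

Lemma icosahedral_form : exists f, uniformly_ramified f (Some 0) (Some 1) None 3 2 5.
Proof.
have s11 : size ('X^10 + (11 * 'X^5 - 1) : {poly C}) = 11%N.
  by rewrite size_Xn_lower // size_polyD_le ?size_natr_monom ?size_polyN ?size_poly1.
eexists; apply: (@klein_form ('X^20 + (- 228 * 'X^15 + 494 * 'X^10 + 228 * 'X^5 + 1))
  ('X^30 + 522 * 'X^25 - 10005 * 'X^20 - 10005 * 'X^10 - 522 * 'X^5 + 1)
  ('X * ('X^10 + (11 * 'X^5 - 1))) (- 1728) 1 3 2 5 20 30 12);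
  rewrite ?oner_eq0 ?oppr_eq0 ?(pnatr_eq0 C 1728) //.
- rewrite scale1r scaleNr opprK -mul_polyC polyC_natr ['X^10 + _]addrA.
  exact: icosahedral_identity.
- move=> z; rewrite !hornerS => /eqP; rewrite mulf_eq0 addrA => /orP[]/eqP zE.
    by rewrite zE !expr0n /= !mulr0 !add0r oner_eq0.
  rewrite icosahedral_resultant zE mulr0 add0r mulf_neq0 ?(pnatr_eq0 C 3125) //.
  have <- : z ^+ 10 = 1 - 11 * z ^+ 5.
    by apply/eqP; rewrite -subr_eq0 -zE; apply/eqP; ring.
  rewrite expf_neq0 //; apply: contra_eq_neq zE => ->; rewrite !expr0n /= mulr0 !add0r.
  by rewrite oppr_eq0 oner_eq0.
- rewrite size_Xn_lower // !size_polyD_le ?size_natr_monom ?size_poly1 //.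
  by rewrite mulNr size_polyN size_natr_monom.
- by rewrite mulrC size_mulX ?s11 // -size_poly_gt0 s11.
Qed.

Lemma uniformizer_ex nu a b c p q r : orb3 nu a b c p q r -> spherical p q r -> (0 < r)%N ->
  exists X, nonconst X /\ forall z, locdeg X z = nu (evalr X z).
Proof.
move=> [ab bc ac nuE] sph r0.
have perm a' b' c' p' q' r' : a' != b' -> b' != c' -> a' != c' ->
    (forall w, nu w = if w == a' then p' else if w == b' then q' else if w == c' then r' else 1%N) ->
    (exists f, uniformly_ramified f (Some 0) (Some 1) None p' q' r') ->
    exists X, nonconst X /\ forall z, locdeg X z = nu (evalr X z).
  move=> ab' bc' ac' E [f Hf]; have [M [M1 Ma Mb Mc]] := mobius3 ab' bc' ac'.
  have [hX HX] := uniformly_ramified_mobius M1 Hf.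
  by exists (rcomp M f); split=> // z; rewrite E HX Ma Mb Mc.
have ba : b != a by rewrite eq_sym.
have nuE' w : nu w = if w == b then q else if w == a then p else if w == c then r else 1%N.
  by rewrite nuE; case: (eqVneq w a) => [->|//]; rewrite (negPf ab).
case: sph => [[p1 qr]|[[p2 q2]|[p2 [q3 r345]]]].
- by apply: (perm b a c q p r) => //; rewrite p1 qr; exact: cyclic_form.
- by apply: (perm a b c p q r) => //; rewrite p2 q2; eexists; exact: dihedral_form.
- apply: (perm b a c q p r) => //; rewrite p2 q3.
  by case: r345 => [->|[->|->]]; [exact: tetrahedral_form|exact: octahedral_form|exact: icosahedral_form].
Qed.

End ThreePoints.

Fact dihedral_field (k : fieldType) (x : k) : x != 0 -> 4%:R != 0 :> k -> 2%:R != 0 :> k ->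
  (x + 1) ^+ 2 / (4%:R * x) = 2%:R^-1 * (2%:R^-1 * (x + x^-1)) + 2%:R^-1.
Proof. by move=> x0 h4 h2; field; rewrite x0 h2 h4. Qed.

Fact chebyshev_step (k : fieldType) (j x u u1 u2 : k) : j = 2%:R^-1 * (x + x^-1) ->
  u1 = x * u -> u2 = x * u1 -> u != 0 -> x != 0 -> 2%:R != 0 :> k ->
  j * (2%:R^-1 * (u1 + u1^-1)) *+ 2 - 2%:R^-1 * (u + u^-1) = 2%:R^-1 * (u2 + u2^-1).
Proof. by move=> -> -> -> u0 x0 h2; field; rewrite u0 x0 h2. Qed.

Fact symmetric_monomial (k : fieldType) (g u : k) : g != 0 -> u != 0 -> u * u != 1 ->
  g * u + (g * u)^-1 = g / u + (g / u)^-1 -> g * g = 1.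
Proof.
move=> g0 u0 u1 E; have : (g * g - 1) * (u * u - 1) = 0.
  have -> : (g * g - 1) * (u * u - 1) = (g * u + (g * u)^-1 - (g / u + (g / u)^-1)) * (g * u).
    by field; rewrite g0 u0.
  by rewrite E subrr mul0r.
by move/eqP; rewrite mulf_eq0 !subr_eq0 (negPf u1) orbF => /eqP.
Qed.

(** * Powers and Chebyshev polynomials *)

Section Recognition.
Variable R : realType.
Local Notation C := R[i].
Implicit Types (A F G f g : ratf R) (P Q : {poly C}) (w z a b c : option C).
Local Notation rC := (rC R).
Local Notation idr := (idr R).

Lemma rdeg_comp f g : nonconst f -> nonconst g -> rdeg (rcomp f g) = (rdeg f * rdeg g)%N.
Proof.
move=> hf hg; have hfg := nonconst_comp hf hg.
have p : perm_eq (fiber (rcomp f g) None) (fibers g (fiber f None)).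
  apply: uniq_perm; rewrite ?fiber_uniq ?fibers_uniq ?fiber_uniq // => z.
  by rewrite mem_fiber // mem_fibers // mem_fiber // evalr_comp.
rewrite -(sum_fiber None hfg) (perm_big _ p) /fibers big_flatten big_map /=.
rewrite -(sum_fiber None hf) big_distrl; apply: eq_bigr => y _ /=.
rewrite -(sum_fiber y hg) big_distrr /= big_seq [RHS]big_seq; apply: eq_bigr => z.
by rewrite mem_fiber // locdeg_comp // => /eqP ->; rewrite mulnC.
Qed.

Lemma mobius_inverse M : rdeg M = 1%N ->
  exists V : ratf R, [/\ rdeg V = 1%N, rcomp M V = idr & rcomp V M = idr].
Proof.
have right f : rdeg f = 1%N -> exists V : ratf R, rdeg V = 1%N /\ rcomp f V = idr.
  move=> f1; have hf : nonconst f by rewrite /nonconst f1.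
  have [fl _] := rdeg1_bij f1.
  have [|V [E hV]] := unramified_lfactor hf (nonconst_idr R).
    by move=> z y _; rewrite fl dvd1n.
  exists V; split=> //; have := congr1 (@rdeg R) E.
  by rewrite rdeg_comp // f1 mul1n idr_rdeg.
move=> M1; have [V [V1 E]] := right M M1; have [W [W1 E']] := right V V1.
have hM : nonconst M by rewrite /nonconst M1.
have hV : nonconst V by rewrite /nonconst V1.
have hW : nonconst W by rewrite /nonconst W1.
exists V; split=> //; suff -> : M = W by [].
by rewrite -[LHS]rcomp_idr -E' rcompA // E rcomp_idl.
Qed.

Lemma monomial_ratf G : nonconst G ->
  (forall z, evalr G z = Some 0 \/ evalr G z = None -> z = Some 0 \/ z = None) ->
  exists g : C, g != 0 /\ (G = rC g * idr ^+ rdeg G \/ G = rC g / idr ^+ rdeg G).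
Proof.
move=> hG HG.
have only0 P : P != 0 -> (forall x : C, P.[x] = 0 -> x = 0) ->
    P = lead_coef P *: 'X^((size P).-1)%N.
  move=> P0 H; rewrite {1}(poly_prod_roots P) -(size_roots_seq P0) -/(roots_seq P).
  congr (_ *: _); have : forall x, x \in roots_seq P -> x = 0.
    by move=> x; rewrite mem_roots_seq // => /eqP/H.
  elim: (roots_seq P) => [|x s IH] Hs; first by rewrite big_nil.
  rewrite big_cons IH /=; last by move=> y ys; apply: Hs; rewrite inE ys orbT.
  by rewrite (Hs x) ?mem_head // subr0 -exprS.
have n0 : rnum G != 0.
  apply: contraNneq (nonconst_neq 0 hG) => h; rewrite [G]ratfE h tofrac0 mul0r.
  by rewrite rmorph0.
have d0 := rden_neq0 G; have cop := coprime_rnum_rden G.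
have nE : rnum G = lead_coef (rnum G) *: 'X^((size (rnum G)).-1)%N.
  apply: only0 => // x nx.
  have dx : (rden G).[x] != 0 by apply: coprimep_root nx; rewrite coprimep_sym.
  have [|[]|] := HG (Some x) => //.
  by left; rewrite /evalr (negPf dx) nx mul0r.
have dE : rden G = lead_coef (rden G) *: 'X^((size (rden G)).-1)%N.
  apply: only0 => // x dx; have [|[]|] := HG (Some x) => //.
  by right; rewrite /evalr dx eqxx.
pose al := lead_coef (rnum G); pose be := lead_coef (rden G).
have al0 : al != 0 by rewrite lead_coef_eq0.
have be0 : be != 0 by rewrite lead_coef_eq0.
have XnE (x : C) n : (x *: 'X^n)%:F = rC x * idr ^+ n.
  by rewrite -mul_polyC tofracM tofracXn.
have GE : G = rC (al / be) * (idr ^+ (size (rnum G)).-1 / idr ^+ (size (rden G)).-1).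
  rewrite {1}[G]ratfE {1}nE {1}dE !XnE fmorph_div mulf_div //.
exists (al / be); split; first by rewrite mulf_neq0 ?invr_eq0.
have sn : (0 < size (rnum G))%N by rewrite size_poly_gt0.
have sd : (0 < size (rden G))%N by rewrite size_poly_gt0.
have : (size (rnum G)).-1 = 0%N \/ (size (rden G)).-1 = 0%N.
  case: (posnP (size (rnum G)).-1) => [|pn]; first by left.
  case: (posnP (size (rden G)).-1) => [|pd]; first by right.
  have := coprimep_root (a := 0) cop; rewrite dE hornerZ hornerXn expr0n (gtn_eqF pd) mulr0.
  move=> /(_ erefl); rewrite nE hornerZ hornerXn expr0n (gtn_eqF pn) mulr0 eqxx //.
rewrite /rdeg; case=> h; [right|left]; rewrite {1}GE h expr0 ?divr1 ?mul1r.
  congr (_ / idr ^+ _); congr _.-1; apply/esym/maxn_idPr.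
  by apply: leq_trans sd; rewrite -subn_eq0 subn1 h.
congr (_ * idr ^+ _); congr _.-1; apply/esym/maxn_idPl.
by apply: leq_trans sn; rewrite -subn_eq0 subn1 h.
Qed.

Lemma rcomp_monomial (g : C) f n : nonconst f ->
  rcomp (rC g * idr ^+ n) f = rC g * f ^+ n /\ rcomp (rC g / idr ^+ n) f = rC g / f ^+ n.
Proof.
move=> hf; rewrite -!compmE //.
have e : compm f idr = f by rewrite compmE // rcomp_idl.
by split; [rewrite rmorphM|rewrite fmorph_div]; rewrite /= compm_rC rmorphXn /= e.
Qed.

Lemma scaling_mobius (l : C) : l != 0 -> rdeg (rC l * idr) = 1%N.
Proof.
move=> l0; have [] := @mobP R l 0 0 1 _; first by rewrite mul0r subr0 mulr1.
by rewrite /mob polyC0 addr0 scale0r add0r polyC1 tofrac1 divr1 -mul_polyC tofracM.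
Qed.

Lemma special_two_points A a b : (2 <= rdeg A)%N -> a != b ->
  (forall z, evalr A z = a \/ evalr A z = b -> z = a \/ z = b) -> special A.
Proof.
move=> degA ab HA; have hA : nonconst A := ltnW degA.
have [c [ac cb]] := third_point a b.
have [M [M1 Ma _ Mb]] := mobius3 ac cb ab.
have hM : nonconst M by rewrite /nonconst M1.
have [V [V1 MV VM]] := mobius_inverse M1.
have hV : nonconst V by rewrite /nonconst V1.
have [_ Minj] := rdeg1_bij M1.
pose G := rcomp V (rcomp A M).
have hAM := nonconst_comp hA hM.
have hG : nonconst G by exact: nonconst_comp.
have GE : rcomp A M = rcomp M G by rewrite /G rcompA // MV rcomp_idl.
have degG : rdeg G = rdeg A by rewrite /G !rdeg_comp // V1 M1 mul1n muln1.
have ev z : evalr M (evalr G z) = evalr A (evalr M z) by rewrite -!evalr_comp // GE.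
have [|g [g0 Gg]] := monomial_ratf hG.
  move=> z h; have [] := HA (evalr M z).
  - by rewrite -ev; case: h => ->; [left|right].
  - by rewrite -Ma => /Minj; left.
  - by rewrite -Mb => /Minj; right.
have key (l : C) F : l != 0 -> nonconst F -> rcomp G (rC l * idr) = rcomp (rC l * idr) F ->
    conj_to A F.
  move=> l0 hF E; have l1 := scaling_mobius l0.
  have hl : nonconst (rC l * idr) by rewrite /nonconst l1.
  exists (rcomp M (rC l * idr)); split; first by rewrite /mobius rdeg_comp // M1 l1.
  by rewrite rcompA // GE -rcompA // E rcompA.
have XnE n : ('X^n)%:F = idr ^+ n by rewrite tofracXn.
have hX : nonconst (idr ^+ rdeg G).
  by rewrite -XnE /nonconst -/(powr R _); have [-> _] := powrP R hG.
right; exists (rdeg G); rewrite XnE.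
case: Gg => Gg.
  left; have n1 : (0 < (rdeg G).-1)%N by rewrite -subn1 subn_gt0 degG.
  (* The substitution z -> l z turns g z^n into z^n when g l^(n-1) = 1. *)
  pose l := (rdeg G).-1.-root (g^-1).
  have lE : l ^+ (rdeg G).-1 = g^-1 by rewrite rootCK.
  have l0 : l != 0 by rewrite /l rootC_eq0 // invr_eq0.
  have hl : nonconst (rC l * idr) by rewrite /nonconst scaling_mobius.
  apply: (key l) => //; rewrite {1}Gg (rcomp_monomial _ _ hl).1.
  have := (rcomp_monomial l 1 hX).1; rewrite !expr1 => ->.
  rewrite exprMn mulrA -rmorphXn -rmorphM; congr (rC _ * _) => /=.
  by rewrite -{1}(prednK hG) exprS lE mulrCA mulfV // mulr1.
right; left.
have hXV : nonconst (idr ^+ rdeg G)^-1.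
  have e : rcomp (rC 1 / idr ^+ 1) (idr ^+ rdeg G) = (idr ^+ rdeg G)^-1.
    by rewrite (rcomp_monomial _ _ hX).2 rmorph1 div1r.
  rewrite -e; apply: nonconst_comp => //; rewrite expr1 rmorph1 div1r /nonconst.
  have [] := @mobP R 0 1 1 0 _; first by rewrite !mul0r mulr1 sub0r oppr_eq0 oner_eq0.
  by rewrite /mob scale0r add0r polyC1 scale1r polyC0 addr0 tofrac1 div1r => ->.
(* Here g / z^n becomes 1 / z^n when l^(n+1) = g. *)
pose l := (rdeg G).+1.-root g.
have lE : l ^+ (rdeg G).+1 = g by rewrite rootCK.
have l0 : l != 0 by rewrite /l rootC_eq0.
have hl : nonconst (rC l * idr) by rewrite /nonconst scaling_mobius.
apply: (key l) => //; rewrite {1}Gg (rcomp_monomial _ _ hl).2.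
have := (rcomp_monomial l 1 hXV).1; rewrite !expr1 => ->.
rewrite exprMn invfM mulrA -rmorphXn -fmorph_div; congr (rC _ * _) => /=.
by rewrite -{1}lE exprS mulfK ?expf_neq0.
Qed.

Definition joukowski : ratf R := rC 2^-1 * (idr + idr^-1).
(** The map of [dihedral_form] for n = 1: [joukowski] with its critical values -1 and 1 moved to 0
    and 1. *)
Definition joukowski01 : ratf R := (('X^1 + 1) ^+ 2)%:F / (4 *: 'X ^+ 1)%:F.

Lemma two_neq0 : 2%:R != 0 :> ratf R. Proof. exact: (ratf_natr_neq0 R 1). Qed.
Lemma idr_neq0 : idr != 0. Proof. by rewrite tofrac_eq0 polyX_eq0. Qed.

Lemma rC_half : rC 2^-1 = 2%:R^-1. Proof. by rewrite fmorphV rmorph_nat. Qed.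

Lemma joukowski01E : joukowski01 = rC 2^-1 * joukowski + rC 2^-1.
Proof.
rewrite /joukowski01 /joukowski !expr1 tofracXn tofracD tofrac1 -mul_polyC tofracM.
have -> : (4%:P)%:F = 4%:R :> ratf R by rewrite -rCE rmorph_nat.
rewrite rC_half; apply: dihedral_field; first exact: idr_neq0.
  exact: (ratf_natr_neq0 R 3).
exact: two_neq0.
Qed.

Lemma joukowski01_pole z : evalr joukowski01 z = None <-> z = Some 0 \/ z = None.
Proof.
have q0 : (4 *: 'X ^+ 1 : {poly C}) != 0.
  by rewrite scaler_eq0 negb_or (pnatr_eq0 C 4) expf_neq0 // polyX_eq0.
have pq : coprimep (('X^1 + 1) ^+ 2) (4 *: 'X ^+ 1 : {poly C}).
  apply: coprimep_no_root => x; rewrite hornerZ !expr1 hornerX => /eqP.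
  rewrite mulf_eq0 (pnatr_eq0 C 4) /= => /eqP ->.
  by rewrite horner_exp hornerD hornerX hornerC add0r expr1n oner_eq0.
case: z => [x|]; split=> //.
- rewrite /joukowski01 evalr_reduced_fin // hornerZ expr1 hornerX mulf_eq0 (pnatr_eq0 C 4) /=.
  by case: eqP => [->|]; [left|].
- case=> // -[->]; rewrite /joukowski01 evalr_reduced_fin // hornerZ expr1 hornerX mulr0 eqxx //.
- by right.
- move=> _; rewrite /joukowski01 evalr_reduced_inf // expr1.
  rewrite size_scale ?(pnatr_eq0 C 4) // size_polyX.
  have s1 : size ('X + 1 : {poly C}) = 2%N by rewrite size_polyDl ?size_polyX // size_poly1.
  have s0 : 'X + 1 != 0 :> {poly C} by rewrite -size_poly_gt0 s1.
  have s2 : (0 < size (('X + 1) ^+ 2 : {poly C})%R)%N by rewrite size_poly_gt0 expf_neq0.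
  by rewrite -(prednK s2) size_exp s1.
Qed.

Lemma nonconst_joukowski : nonconst joukowski.
Proof.
apply/negP => /negP/nonconstP[a E].
have [h _] := @dihedral_form R 1 isT; move: h; rewrite -/joukowski01 joukowski01E E.
by rewrite -rmorphM -rmorphD (negPf (rC_const _)).
Qed.

Lemma compm_idr g : nonconst g -> compm g idr = g.
Proof. by move=> hg; rewrite compmE // rcomp_idl. Qed.

Lemma compm_joukowski g : nonconst g -> compm g joukowski = rC 2^-1 * (g + g^-1).
Proof.
move=> hg; rewrite /joukowski (rmorphM (compm g)) compm_rC (rmorphD (compm g)).
by rewrite (fmorphV (compm g)) compm_idr.
Qed.

(** This is T_n(cos t) = cos(n t) with z = e^(it). *)
Lemma cheb_joukowski n :
  compm joukowski (cheb R n)%:F = rC 2^-1 * (idr ^+ n + (idr ^+ n)^-1).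
Proof.
have hJ := nonconst_joukowski.
rewrite rC_half.
suff [] : compm joukowski (cheb_pair R n).1%:F = 2%:R^-1 * (idr ^+ n + (idr ^+ n)^-1) /\
    compm joukowski (cheb_pair R n).2%:F = 2%:R^-1 * (idr ^+ n.+1 + (idr ^+ n.+1)^-1) by [].
elim: n => [|n] /=.
  rewrite tofrac1 rmorph1 expr0 invr1 expr1 compm_idr // /joukowski rC_half; split=> //.
  by rewrite -[1 + 1]/(2%:R) mulVf // two_neq0.
case: (cheb_pair R n) => p q /= [pE qE]; split=> //.
rewrite tofracB tofracMn tofracM rmorphB rmorphMn rmorphM /= compm_idr // pE qE.
have jE : joukowski = 2%:R^-1 * (idr + idr^-1) by rewrite -rC_half.
exact: chebyshev_step jE (exprS _ _) (exprS _ _) (expf_neq0 _ idr_neq0) idr_neq0 two_neq0.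
Qed.

Lemma nonconst_idrV : nonconst idr^-1.
Proof.
rewrite /nonconst; have [] := @mobP R 0 1 1 0 _; first by rewrite !mul0r mulr1 sub0r oppr_eq0 oner_eq0.
by rewrite /mob scale0r add0r polyC1 scale1r polyC0 addr0 tofrac1 div1r => ->.
Qed.

(* Invariance of J = (z + 1/z)/2 under z -> 1/z forces g = 1/g. *)
Lemma semiconj_joukowski A (g : C) n : (0 < n)%N -> g != 0 -> nonconst A ->
  compm joukowski A = rC 2^-1 * (rC g * idr ^+ n + (rC g * idr ^+ n)^-1) ->
  A = (cheb R n)%:F \/ A = - (cheb R n)%:F.
Proof.
move=> n0 g0 hA E; have hJ := nonconst_joukowski; have hI := nonconst_idrV.
have sym f : compm idr^-1 (compm joukowski f) = compm joukowski f.
  have JI : rcomp joukowski idr^-1 = joukowski.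
    by rewrite -compmE // compm_joukowski // invrK addrC.
  by rewrite !compmE // -rcompA // JI.
have h2 : rC 2^-1 != 0 by rewrite rC_half invr_eq0 two_neq0.
have g2 : g * g = 1.
  have := sym A; rewrite E rmorphM compm_rC => /(mulfI h2).
  rewrite rmorphD fmorphV rmorphM compm_rC rmorphXn /= compm_idr // exprVn => /esym S.
  apply/eqP; rewrite -(inj_eq (fmorph_inj rC)) rmorphM rmorph1; apply/eqP.
  have gg0 : rC g != 0 by rewrite fmorph_eq0.
  apply: (symmetric_monomial gg0 (expf_neq0 n idr_neq0) _ S).
  have nn : (0 < n + n)%N by rewrite addn_gt0 n0.
  have [d _ _ _ _] := powrP R nn.
  have : nonconst (powr R (n + n)) by rewrite /nonconst d.
  by rewrite -exprD /powr tofracXn => /(nonconst_neq 1); rewrite rmorph1.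
have inj f f' : compm joukowski f = compm joukowski f' -> f = f'.
  by rewrite !compmE // => /(rcomp_inj hJ).
case: (eqVneq g 1) => [g1|gn1]; [left|right]; apply: inj.
  by rewrite E cheb_joukowski g1 rmorph1 mul1r.
have gE : g = -1.
  apply/eqP; rewrite -addr_eq0; have : (g - 1) * (g + 1) == 0.
    by rewrite -subr_sqr expr1n expr2 g2 subrr.
  by rewrite mulf_eq0 subr_eq0 (negPf gn1).
rewrite E gE (rmorphN rC) rmorph1 mulN1r (rmorphN (compm joukowski)) cheb_joukowski.
by rewrite invrN -opprD mulrN.
Qed.

(** Off c the index is at most 2, so a preimage z of c other than c would give n = nu(z) gcd(deg_z
    A, n) <= 2 deg A. Thus c is its own full preimage. The map X ramified to order 2 over a and b
    only has the fibre {0, infinity} over c; A lifts through X to a map G preserving this pair, so G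
    is a monomial and A is conjugate to a Chebyshev polynomial up to sign. *)
Lemma special_dihedral A nu a b c n : (2 <= rdeg A)%N -> orb_fixed A nu ->
  orb3 nu a b c 2 2 n -> (2 * rdeg A < n)%N -> special A.
Proof.
move=> degA fixA [ab bc ac nuE] bign; have hA : nonconst A := ltnW degA.
have [M [M1 Ma Mb Mc]] := mobius3 ab bc ac.
have hM : nonconst M by rewrite /nonconst M1.
have [_ Minj] := rdeg1_bij M1.
have hJ := nonconst_joukowski.
have [hJ01 _] := @dihedral_form R 1 isT.
have [] := uniformly_ramified_mobius M1 (@dihedral_form R 1 isT).
rewrite -/joukowski01 Ma Mb Mc; set X := rcomp M joukowski01 => hX HX.
have nua : nu a = 2%N by rewrite nuE eqxx.
have nub : nu b = 2%N by rewrite nuE eq_sym (negPf ab) eqxx.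
have nuc : nu c = n by rewrite nuE ![c == _]eq_sym (negPf ac) (negPf bc) eqxx.
have le_deg z : (gcdn (locdeg A z) (nu (evalr A z)) <= rdeg A)%N.
  by apply: leq_trans (locdeg_le z hA); rewrite dvdn_leq ?locdeg_gt0 ?dvdn_gcdl.
have preC z : evalr A z = c -> z = c.
  move=> zc; apply: contrapT => /eqP zn.
  have : (nu z <= 2)%N by rewrite nuE (negPf zn); do !case: eqP.
  have := fixA z; rewrite zc nuc; have := le_deg z; rewrite zc nuc => h1 h2 h3.
  by have := leq_mul h3 h1; rewrite -h2 leqNgt bign.
have hAX : nonconst (rcomp A X) by exact: nonconst_comp.
have [|G [GE hG]] := unramified_lfactor hX hAX.
  move=> z y; rewrite evalr_comp // => E; rewrite HX E locdeg_comp // HX.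
  set v := evalr X z; have e0 := locdeg_gt0 v hA.
  have gen : nu (evalr A v) = 2%N -> v != a -> v != b -> (2 %| locdeg A v)%N.
    move=> w2 va vb; have vc : v != c.
      apply/eqP => vc; have := fixA v; rewrite w2 vc nuc => H.
      have : (n %| 2)%N by rewrite H dvdn_mulr.
      move/dvdn_leq => /(_ isT) n2; move: bign.
      by rewrite ltnNge (leq_trans n2) // (leq_trans degA) // leq_pmull.
    have := fixA v; rewrite w2 [nu v]nuE (negPf va) (negPf vb) (negPf vc) mul1n => /esym/gcdn_idPr //.
  case: (eqVneq v a) => [_|va]; first by case: eqP => _; [|case: eqP => _; [|case: eqP]]; rewrite ?dvd1n ?dvdn_mulr.
  case: (eqVneq v b) => [_|vb]; first by case: eqP => _; [|case: eqP => _; [|case: eqP]]; rewrite ?dvd1n ?dvdn_mulr.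
  have -> : (if v == c then 1 else 1) = 1%N by case: eqP.
  rewrite mul1n; case: eqP => [w|_]; first by apply: gen; rewrite // w.
  by case: eqP => [w|_]; [apply: gen; rewrite // w|case: eqP].
have pole z : evalr X z = c <-> z = Some 0 \/ z = None.
  rewrite /X evalr_comp // -Mc -joukowski01_pole; split=> [/Minj//|->//].
have ev z : evalr X (evalr G z) = evalr A (evalr X z) by rewrite -!evalr_comp // GE.
have [z /pole zc|g [g0 Gg]] := monomial_ratf hG.
  by apply/pole/preC; rewrite -ev.
pose L : ratf R := rC 2^-1 * idr + rC 2^-1.
have L1 : rdeg L = 1%N.
  have h2 : 2^-1 != 0 :> C by rewrite invr_eq0 (pnatr_eq0 C 2).
  have [] := @mobP R 2^-1 2^-1 0 1 _; first by rewrite mulr0 subr0 mulr1.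
  by rewrite /mob scale0r add0r polyC1 tofrac1 divr1 -mul_polyC tofracD tofracM.
have hL : nonconst L by rewrite /nonconst L1.
have LJ : rcomp L joukowski = joukowski01.
  rewrite joukowski01E -compmE // /L (rmorphD (compm joukowski)) (rmorphM (compm joukowski)).
  by rewrite compm_idr // !compm_rC.
pose mu := rcomp M L.
have mu1 : rdeg mu = 1%N by rewrite rdeg_comp // M1 L1.
have hmu : nonconst mu by rewrite /nonconst mu1.
have XE : X = rcomp mu joukowski by rewrite /X -LJ rcompA.
have [V [V1 muV Vmu]] := mobius_inverse mu1.
have hV : nonconst V by rewrite /nonconst V1.
have hAmu : nonconst (rcomp A mu) by exact: nonconst_comp.
pose B := rcomp V (rcomp A mu).
have hB : nonconst B by exact: nonconst_comp.
have BE : rcomp A mu = rcomp mu B by rewrite /B rcompA // muV rcomp_idl.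
have BJ : rcomp B joukowski = rcomp joukowski G.
  have hJG : nonconst (rcomp joukowski G) by exact: nonconst_comp.
  rewrite /B -rcompA // -rcompA // -XE GE XE -rcompA // rcompA // Vmu rcomp_idl //.
have conj F : B = F -> conj_to A F by move=> <-; exists mu.
have [g' [g'0 E]] : exists g' : C, g' != 0 /\
    compm joukowski B = rC 2^-1 * (rC g' * idr ^+ rdeg G + (rC g' * idr ^+ rdeg G)^-1).
  rewrite compmE // BJ -compmE // compm_joukowski //.
  case: Gg => Gg; first by exists g; split=> //; rewrite -Gg.
  exists g^-1; rewrite invr_eq0; split=> //; rewrite addrC.
  have H : G^-1 = rC g^-1 * idr ^+ rdeg G by rewrite {1}Gg invf_div fmorphV mulrC.
  by rewrite -H invrK.
by right; exists (rdeg G); case: (semiconj_joukowski hG g'0 hB E) => /conj; tauto.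
Qed.

End Recognition.

Lemma fixed_gcd_dvdn a b e k : (0 < a)%N -> (0 < b)%N -> (0 < e)%N ->
  b = (a * gcdn e b)%N -> (a %| k)%N <-> (b %| k * e)%N.
Proof.
move=> a0 b0 e0 E; have g0 : (0 < gcdn e b)%N by rewrite gcdn_gt0 e0.
have eE : (e = e %/ gcdn e b * gcdn e b)%N by rewrite divnK ?dvdn_gcdl.
have aE : a = (b %/ gcdn e b)%N by rewrite {1}E mulnK.
have cop : coprime a (e %/ gcdn e b).
  rewrite /coprime -(eqn_pmul2r g0) muln_gcdl aE !divnK ?dvdn_gcdl ?dvdn_gcdr //.
  by rewrite mul1n gcdnC.
by rewrite {1}eE mulnA {1}E dvdn_pmul2r // Gauss_dvdl.
Qed.

(** * The largest fixed orbifold *)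

Section MaximalOrbifold.
Variable R : realType.
Local Notation C := R[i].
Implicit Types (A F G f g X : ratf R) (w z a b c : option C) (nu mu : option C -> nat).

(** In divisibility form the equation is manifestly compatible with lcms. *)
Lemma orb_fixed_dvdn A nu : nonconst A -> (forall z, 0 < nu z)%N ->
  orb_fixed A nu <-> (forall z k, (0 < k)%N ->
    (nu z %| k)%N <-> (nu (evalr A z) %| k * locdeg A z)%N).
Proof.
move=> hA nu0; split=> H z; first by move=> k _; apply: fixed_gcd_dvdn; rewrite ?locdeg_gt0.
by apply: dvdn_fixed_gcd; rewrite ?locdeg_gt0 //; exact: H.
Qed.

(** Combines both forbidden shapes of an orbifold, index 1 at [a] or at [b] included, into the
    single form used for lcms. *)
Lemma good_two_points nu a b : good_orbifold nu -> a != b ->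
  (forall w, w != a -> w != b -> nu w = 1%N) -> nu a = nu b.
Proof.
move=> [[nu0 _] [g1 g2]] ab off.
have n1 w : ~ (1 < nu w)%N -> nu w = 1%N.
  by move/negP; rewrite -leqNgt => h; apply/eqP; rewrite eqn_leq h nu0.
have only x y : x != y -> (forall w, w != x -> w != y -> nu w = 1%N) -> nu y = 1%N -> nu x = 1%N.
  move=> xy offx y1; apply: n1 => x1; apply: g1; exists x => w; split=> [w1|->//].
  apply/eqP; apply/negPn/negP => wx; case: (eqVneq w y) => [wy|wy].
    by move: w1; rewrite wy y1.
  by move: w1; rewrite offx.
case: (pselect (1 < nu a)%N) => [a1|/n1 a1]; last first.
  by rewrite a1; apply/esym/(only b a); rewrite 1?eq_sym // => w wb wa; exact: off.
case: (pselect (1 < nu b)%N) => [b1|/n1 b1]; last by rewrite b1; exact: only ab off b1.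
apply: contrapT => ne; apply: g2; exists a, b; split; first exact/eqP.
split=> // w; split=> [w1|[->|->] //].
apply: contrapT => /not_orP[/eqP wa /eqP wb]; by move: w1; rewrite off.
Qed.

Lemma lcm_good nu mu : good_orbifold nu -> good_orbifold mu ->
  good_orbifold (fun z => lcmn (nu z) (mu z)).
Proof.
move=> gn gm; have [[nu0 [S HS]] _] := gn; have [[mu0 [T HT]] _] := gm.
have l1 z : ~ (1 < lcmn (nu z) (mu z))%N -> nu z = 1%N /\ mu z = 1%N.
  move/negP; rewrite -leqNgt => h.
  have : lcmn (nu z) (mu z) = 1%N by apply/eqP; rewrite eqn_leq h lcmn_gt0 nu0 mu0.
  move=> E; have := dvdn_lcml (nu z) (mu z); have := dvdn_lcmr (nu z) (mu z).
  by rewrite E !dvdn1 => /eqP ? /eqP.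
split; [split|split].
- by move=> z; rewrite lcmn_gt0 nu0 mu0.
- exists (S ++ T) => z; rewrite mem_cat negb_or => /andP[/HS -> /HT ->] //.
- move=> [a H]; have [b [ab _]] := third_point a a.
  have off w : w != a -> nu w = 1%N /\ mu w = 1%N by move=> wa; apply: l1 => /H; exact/eqP.
  have na := good_two_points gn ab (fun w wa _ => (off w wa).1).
  have ma := good_two_points gm ab (fun w wa _ => (off w wa).2).
  have [nb mb] : nu b = 1%N /\ mu b = 1%N by apply: off; rewrite eq_sym.
  by have := (H a).2 erefl; rewrite na ma nb mb.
- move=> [a [b [/eqP ab [H ne]]]]; apply: ne.
  have off w : w != a -> w != b -> nu w = 1%N /\ mu w = 1%N.
    by move=> /eqP wa /eqP wb; apply: l1 => /H[].
  by rewrite (good_two_points gn ab (fun w h h' => (off w h h').1))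
             (good_two_points gm ab (fun w h h' => (off w h h').2)).
Qed.

Lemma lcm_fixed A nu mu : nonconst A -> (forall z, 0 < nu z)%N -> (forall z, 0 < mu z)%N ->
  orb_fixed A nu -> orb_fixed A mu -> orb_fixed A (fun z => lcmn (nu z) (mu z)).
Proof.
move=> hA nu0 mu0 /(orb_fixed_dvdn hA nu0) Hn /(orb_fixed_dvdn hA mu0) Hm.
apply/orb_fixed_dvdn => // [z|z k k0]; first by rewrite lcmn_gt0 nu0 mu0.
rewrite !dvdn_lcm; split=> /andP[h1 h2]; apply/andP; split.
- exact: (Hn z k k0).1 h1.
- exact: (Hm z k k0).1 h2.
- exact: (Hn z k k0).2 h1.
- exact: (Hm z k k0).2 h2.
Qed.

(** In the cyclic case an index above 2 deg A would make {b, c} contain its full preimage, so A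
    would be conjugate to a power; in the dihedral case [special_dihedral] applies. The summand 5
    covers the polyhedral indices. *)
Lemma orbifold_bound A nu : (2 <= rdeg A)%N -> ~ special A -> good_orbifold nu ->
  orb_fixed A nu -> exists a b c p q r, [/\ orb3 nu a b c p q r, spherical p q r, (0 < r)%N &
    [/\ p <= 2 * rdeg A + 5, q <= 2 * rdeg A + 5 & r <= 2 * rdeg A + 5]%N].
Proof.
move=> degA nS good fixA; have hA : nonconst A := ltnW degA.
have [|a [b [c [p [q [r [o3 sph]]]]]]] := orbifold_classification degA good fixA.
  by move=> L; apply: nS; left.
have [ab bc ac nuE] := o3.
have nuc : nu c = r by rewrite nuE ![c == _]eq_sym (negPf ac) (negPf bc) eqxx.
have nub : nu b = q by rewrite nuE eq_sym (negPf ab) eqxx.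
have r0 : (0 < r)%N by rewrite -nuc good.1.1.
exists a, b, c, p, q, r; split=> //.
case: sph => [[p1 qr]|[[p2 q2]|[p2 [q3 r345]]]].
- suff h : (r <= 2 * rdeg A)%N by rewrite p1 qr; split; lia.
  rewrite leqNgt; apply/negP => big; apply: nS; apply: (special_two_points degA bc) => z zE.
  have le : (locdeg A z < r)%N by have := locdeg_le z hA; lia.
  have H : r = (nu z * gcdn (locdeg A z) r)%N.
    by have := fixA z; case: zE => ->; rewrite ?nub ?nuc ?qr.
  apply: contrapT => /not_orP[/eqP zb /eqP zc].
  have z1 : nu z = 1%N by rewrite nuE p1 (negPf zb) (negPf zc); case: eqP.
  move: H; rewrite z1 mul1n => /esym/gcdn_idPr/dvdn_leq; rewrite locdeg_gt0 // leqNgt le.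
  by move/(_ isT).
- suff h : (r <= 2 * rdeg A)%N by rewrite p2 q2; split; lia.
  rewrite leqNgt; apply/negP => big; apply: nS; rewrite p2 q2 in o3.
  exact: special_dihedral fixA o3 big.
- have r5 : (r <= 5)%N by case: r345 => [|[]] ->.
  by rewrite p2 q3; split; apply: leq_trans (leq_addl _ _).
Qed.

(** The sum of nu(w) - 1 runs over at most three points, hence is bounded. At a maximum the lcm with
    any other fixed good orbifold, again fixed and good, cannot be larger. *)
Lemma maximal_orbifold A : (2 <= rdeg A)%N -> ~ special A -> exists nu,
  [/\ good_orbifold nu, orb_fixed A nu &
      forall mu, good_orbifold mu -> orb_fixed A mu -> forall z, (mu z %| nu z)%N].
Proof.
move=> degA nS; have hA : nonconst A := ltnW degA.
pose P k := exists nu s, [/\ good_orbifold nu, orb_fixed A nu, uniq s,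
  forall w : option C, (w \in s) = (nu w != 1%N) & \sum_(w <- s) (nu w).-1 = k].
have P0 : exists k, `[< P k >].
  exists 0%N; apply/asboolP; exists (fun=> 1%N), [::]; split=> //; last by rewrite big_nil.
    split; [split|split] => //; first by exists [::].
      by move=> [z /(_ z)[_ /(_ erefl)]].
    by move=> [z1 [z2 [_ [_ /(_ erefl)]]]].
  by move=> z; rewrite gcdn1.
have Ple k : `[< P k >] -> (k <= 3 * (2 * rdeg A + 5))%N.
  move=> /asboolP[nu [s [gn fn us Hs <-]]].
  have [a [b [c [p [q [r [[ab bc ac nuE] _ _ [pB qB rB]]]]]]]] := orbifold_bound degA nS gn fn.
  have uabc : uniq [:: a; b; c] by rewrite /= !inE negb_or ab ac bc.
  apply: (@leq_trans (\sum_(w <- [:: a; b; c]) (nu w).-1)).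
    apply: leq_sum_subset => // w; rewrite Hs nuE !inE.
    by case: (w == a) => //; case: (w == b) => //; case: (w == c).
  have le w : w \in [:: a; b; c] -> ((nu w).-1 <= 2 * rdeg A + 5)%N.
    move=> _; apply: leq_trans (leq_pred _) _; rewrite nuE.
    by do 3!(case: ifP => // _); rewrite addn_gt0 orbT.
  rewrite !big_cons big_nil addn0.
  by have := le a; have := le b; have := le c; rewrite !inE !eqxx ?orbT; lia.
case: (ex_maxnP P0 Ple) => k /asboolP[nu [s [gn fn us Hs sk]]] kmax.
exists nu; split=> // mu gm fm z; apply/negPn/negP => ndvd.
have nu0 := gn.1.1; have mu0 := gm.1.1.
pose la w := lcmn (nu w) (mu w).
have gl : good_orbifold la by exact: lcm_good.
have fl : orb_fixed A la by exact: lcm_fixed.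
have [t [ut Ht]] := orbifold_support gl.1.
have le w : (nu w <= la w)%N by rewrite dvdn_leq ?dvdn_lcml // lcmn_gt0 nu0 mu0.
have lt : (nu z < la z)%N.
  rewrite ltn_neqAle le andbT; apply: contra ndvd => /eqP ->; exact: dvdn_lcmr.
have zt : z \in t by rewrite Ht gtn_eqF // (leq_trans _ lt) // ltnS nu0.
have : (\sum_(w <- t) (la w).-1 <= k)%N by apply: kmax; apply/asboolP; exists la, t.
rewrite -sk leqNgt => /negP; apply.
apply: (@leq_ltn_trans (\sum_(w <- t) (nu w).-1)).
  apply: leq_sum_subset => // w; rewrite Hs Ht; apply: contra => /eqP lw.
  by rewrite eqn_leq nu0 -lw le.
rewrite (big_rem z) //= [X in (_ < X)%N](big_rem z) //= -addSn leq_add //.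
  by rewrite prednK // -ltnS prednK // (leq_ltn_trans _ lt).
by apply: leq_sum => w _; rewrite -!subn1 leq_sub2r.
Qed.

End MaximalOrbifold.

Lemma coprimep_splits (L : fieldType) (p q : {poly L}) : splits q -> q != 0 ->
  (forall x, root q x -> ~~ root p x) -> coprimep p q.
Proof.
move=> sq q0 H; apply/coprimepP => d dp dq; rewrite -size_poly_eq1; apply/negPn/negP => sd.
have d0 : d != 0 by apply: contraTneq dq => ->; rewrite dvd0p.
have [|x rx] := splits_root (splits_dvd dq sq).
  by rewrite ltn_neqAle eq_sym sd size_poly_gt0.
move: rx; rewrite -dvdp_XsubCl => rx.
by have := H x; rewrite -!dvdp_XsubCl (dvdp_trans rx dp) (dvdp_trans rx dq) => /(_ isT).
Qed.

Lemma dvdp_root_trans (L : fieldType) (p q : {poly L}) x : p %| q -> root p x -> root q x.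
Proof. by rewrite -!dvdp_XsubCl => pq xp; exact: dvdp_trans xp pq. Qed.

Lemma monic_scale (L : fieldType) (p : {poly L}) : p != 0 ->
  (lead_coef p)^-1 *: p \is monic /\ (lead_coef p)^-1 *: p %= p.
Proof.
move=> p0; have l0 : lead_coef p != 0 by rewrite lead_coef_eq0.
by rewrite monicE lead_coefZ mulVf // eqp_scale // invr_eq0.
Qed.

Lemma splits_lead (L : fieldType) (p : {poly L}) : splits p ->
  exists rs : seq L, p = lead_coef p *: \prod_(r <- rs) ('X - r%:P).
Proof.
move=> [rs /eqpP[[c1 c2] /= /andP[c10 c20] E]].
exists rs; have := congr1 (fun p => c1^-1 *: p) E; rewrite !scalerA mulVf // scale1r => {}E.
rewrite {1}E; congr (_ *: _); rewrite E lead_coefZ.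
by rewrite (monicP (monic_prod_XsubC _ _ _)) mulr1.
Qed.

Lemma monic_map (k L : fieldType) (phi : {rmorphism k -> L}) (p : {poly k}) :
  p \is monic -> map_poly phi p \is monic.
Proof. by rewrite map_monic. Qed.

Lemma irreducible_common_root (k L : fieldType) (phi : {rmorphism k -> L}) (H E : {poly k}) x :
  irreducible_poly H -> root (map_poly phi H) x -> root (map_poly phi E) x -> H %| E.
Proof.
move=> [H1 Hirr] Hx Ex; suff /eqp_dvdl <- : gcdp H E %= H by exact: dvdp_gcdr.
apply: Hirr; last exact: dvdp_gcdl.
apply/negP => /size_poly1P[c c0 gE].
have : root (map_poly phi (gcdp H E)) x by rewrite gcdp_map root_gcd Hx.
by rewrite gE map_polyC rootC fmorph_eq0 (negPf c0).
Qed.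

(** * Galois coverings *)

Section RationalTransform.
Variable R : realType.
Local Notation C := R[i].
Implicit Types (A F G f g X U : ratf R) (P Q : {poly ratf R}).
Local Notation rC := (rC R).
Local Notation idr := (idr R).

Definition ratev (L : fieldType) (iota : {rmorphism C -> L}) f (t : L) : L :=
  (map_poly iota (rnum f)).[t] / (map_poly iota (rden f)).[t].

Lemma splits_const (L : fieldType) (iota : {rmorphism C -> L}) (p : {poly C}) : p != 0 ->
  map_poly iota p %= \prod_(r <- map iota (roots_seq p)) ('X - r%:P).
Proof.
move=> p0; rewrite {1}(poly_prod_roots p) map_polyZ map_prod_XsubC eqp_scale //.
by rewrite fmorph_eq0 lead_coef_eq0.
Qed.

Lemma fibp_rC_neq0 U f : nonconst f -> fibp rC U f != 0.
Proof. by move=> hf; rewrite -size_poly_gt0 size_fibp_rC. Qed.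

Lemma fibp_no_const_root U f (c : C) : nonconst U -> nonconst f -> ~~ root (fibp rC U f) (rC c).
Proof.
move=> hU hf; rewrite /root /fibp hornerD hornerN hornerZ !horner_map; apply/negP.
case: (eqVneq (rden U).[c] 0) => [d0|d0].
  by rewrite d0 rmorph0 mulr0 subr0 fmorph_eq0 (negPf (coprimep_root (coprime_rnum_rden U) d0)).
rewrite subr_eq0 => /eqP E; have := nonconst_neq ((rnum U).[c] / (rden U).[c]) hf.
by rewrite fmorph_div E mulfK ?eqxx // fmorph_eq0.
Qed.

(** A double root would be a zero of the Wronskian of U, but the roots are nonconstant functions,
    hence transcendental over C. *)
Lemma fibp_separable U f rs : nonconst U -> nonconst f ->
  fibp rC U f %= \prod_(r <- rs) ('X - r%:P) -> uniq rs.
Proof.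
move=> hU hf E; rewrite -separable_prod_XsubC -(eqp_separable E) separable_poly.unlock.
rewrite coprimep_sym; apply: coprimep_splits; [by exists rs|exact: fibp_rC_neq0|] => x rx.
have [fE hx] := root_fibp hf rx.
apply/negP => rx'.
have w0 : wronsk (rnum U) (rden U) != 0 by have [] := wronsk_neq0_locdeg 0 hU.
have := nonconst_transc hx w0; rewrite /wronsk (rmorphB (map_poly rC)) !(rmorphM (map_poly rC)).
rewrite hornerD hornerN !hornerM.
move: rx rx'; rewrite /root /fibp derivB derivZ !(deriv_map rC) !hornerD !hornerN !hornerZ !subr_eq0.
by move=> /eqP -> /eqP ->; rewrite mulrAC eqxx.
Qed.

(* The characteristic polynomial of a(z) over C(X); the denominator of a is inverted modulo X(y) - t. *)
Lemma rational_transform X a : nonconst X -> exists H : {poly ratf R}, H \is monic /\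
  forall (L : fieldType) (iota : {rmorphism C -> L}) (psi : {rmorphism ratf R -> L}) (s : seq L),
    (forall c, psi (rC c) = iota c) -> uniq s ->
    map_poly psi (fibp rC X idr) %= \prod_(t <- s) ('X - t%:P) ->
    map_poly psi H = \prod_(t <- s) ('X - (ratev iota a t)%:P).
Proof.
move=> hX; have hI := nonconst_idr R.
pose P0 := (lead_coef (fibp rC X idr))^-1 *: fibp rC X idr.
have [P0m P0E] : P0 \is monic /\ P0 %= fibp rC X idr by apply: monic_scale; exact: fibp_rC_neq0.
have cop : coprimep P0 (map_poly rC (rden a)).
  apply: coprimep_splits.
  - by exists (map rC (roots_seq (rden a))); apply: splits_const; exact: rden_neq0.
  - by rewrite map_poly_eq0 rden_neq0.
  move=> x; rewrite (eqp_prod_root _ (splits_const rC (rden_neq0 a))) => /mapP[c _ ->].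
  rewrite (eqp_root P0E); exact: fibp_no_const_root.
have /Bezout_eq1_coprimepP[[u v] /= uv] := cop.
pose f := map_poly rC (rnum a) * v.
have [H [Hm HH]] := root_transform f P0m.
exists H; split=> // L iota psi s Hiota us sE.
have P0s : map_poly psi P0 = \prod_(t <- s) ('X - t%:P).
  apply: monic_eqp_prod; first exact: monic_map P0m.
  by apply: eqp_trans sE; rewrite eqp_map.
rewrite (HH L psi s us P0s) big_seq [RHS]big_seq; apply: eq_bigr => t ts.
congr ('X - _%:P).
have mapE (p : {poly C}) : map_poly psi (map_poly rC p) = map_poly iota p.
  by rewrite -map_poly_comp; apply: eq_map_poly => c /=; exact: Hiota.
have h : (map_poly psi v).[t] * (map_poly iota (rden a)).[t] = 1.
  have := congr1 (fun p => (map_poly psi p).[t]) uv.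
  rewrite rmorphD !rmorphM rmorph1 /= mapE P0s hornerD !hornerM hornerC.
  have -> : (\prod_(t0 <- s) ('X - t0%:P)).[t] = 0.
    by apply/eqP; rewrite -/(root _ _) root_prod_XsubC.
  by rewrite mulr0 add0r.
have d0 : (map_poly iota (rden a)).[t] != 0.
  by apply: contra_eq_neq h => ->; rewrite mulr0 eq_sym oner_eq0.
have vE : (map_poly psi v).[t] = ((map_poly iota (rden a)).[t])^-1.
  by apply: (mulIf d0); rewrite h mulVf.
have fE : map_poly psi f = map_poly iota (rnum a) * map_poly psi v.
  rewrite -mapE; exact: (rmorphM (map_poly psi)).
by rewrite fE hornerM vE.
Qed.

Section Uniformizer.
Variables (X : ratf R) (hX : nonconst X).

Lemma conjugates_ex : splits (fibp rC X X) -> exists s : seq (ratf R), [/\ uniq s, idr \in s,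
  map_poly (compm X) (fibp rC X idr) %= \prod_(t <- s) ('X - t%:P) &
  forall t, t \in s -> nonconst t].
Proof.
move=> [s sE]; exists s.
have e : map_poly (compm X) (fibp rC X idr) = fibp rC X X.
  by rewrite -[map_poly _ _]/(pcomp X _) pcomp_fibp // rcomp_idl.
split; rewrite ?e //; first exact: fibp_separable sE.
  rewrite -(eqp_prod_root _ sE); have := fibp_root X (nonconst_idr R).
  by rewrite rcomp_idr.
by move=> t; rewrite -(eqp_prod_root _ sE) => /(root_fibp hX)[].
Qed.

Lemma inKE f : inK X f <-> exists h, f = compm X h.
Proof. by split=> -[h ->]; exists h; rewrite compmE. Qed.

Lemma polyKE P : polyK X P <-> exists Q, P = map_poly (compm X) Q.
Proof.
split=> [H|[Q ->] i]; last by apply/inKE; exists Q`_i; rewrite coef_map.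
pose h i := sval (cid ((inKE P`_i).1 (H i))).
have hE i : P`_i = compm X (h i) by rewrite /h; case: cid.
exists (\poly_(i < size P) h i); apply/polyP => i; rewrite coef_map coef_poly.
by case: ltnP => [_|Pi]; [exact: hE|rewrite nth_default //; exact/esym/rmorph0].
Qed.

(** The conjugates of z over C(X) are functions t with X(t) = X, all in C(z). Every a is a root of
    its characteristic polynomial over C(X), whose roots a(t) then lie in C(z). *)
Lemma galois_cov_splits : splits (fibp rC X X) -> galois_cov X.
Proof.
move=> /conjugates_ex[s [us ids sE hs]].
have root_ex a : exists H, [/\ H \is monic, root (map_poly (compm X) H) a & splits (map_poly (compm X) H)].
  have [H [Hm HH]] := rational_transform a hX.
  have E := HH _ _ _ s (compm_rC X) us sE.
  have E' : map_poly (compm X) H = \prod_(t <- map (ratev rC a) s) ('X - t%:P) by rewrite big_map.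
  exists H; split; [exact: Hm| |by exists (map (ratev rC a) s); rewrite E'; exact: eqpxx].
  rewrite E' root_prod_XsubC; apply/mapP; exists idr; first exact: ids.
  exact/esym/rcomp_idr.
have irr_eq P : irredK X P -> exists Q, P = map_poly (compm X) Q /\ irreducible_poly Q.
  move=> [/polyKE[Q QE] [P1 Pirr]]; exists Q; split=> //.
  have Q1 : (1 < size Q)%N by move: P1; rewrite QE size_map_poly.
  split=> // q q1 qQ; have [r rE] := dvdpP _ _ qQ.
  have Q0 : Q != 0 by rewrite -size_poly_gt0 ltnW.
  have r0 : r != 0 by apply: contra_neq Q0 => h; rewrite rE h mul0r.
  have [|||r1|] := Pirr (map_poly (compm X) r) (map_poly (compm X) q).
  - by apply/polyKE; exists r.
  - by apply/polyKE; exists q.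
  - by rewrite QE rE rmorphM.
  - move: r1; rewrite size_map_poly => /eqP/size_poly1P[c c0 rc].
    by rewrite rE rc mul_polyC eqp_sym eqp_scale.
  - by rewrite size_map_poly => /eqP; rewrite (negPf q1).
split; [|split].
- move=> a; have [H [Hm Ha _]] := root_ex a; exists (map_poly (compm X) H).
  split; [by apply/polyKE; exists H|split; last exact: Ha].
  exact: monic_neq0 (monic_map _ Hm).
- move=> P /irr_eq[Q [QE [Q1 Qirr]]] [a Pa]; have [H [Hm Ha Hs]] := root_ex a.
  have Qa : root (map_poly (compm X) Q) a by rewrite -QE; exact: Pa.
  have QH : Q %| H := irreducible_common_root (conj Q1 Qirr) Qa Ha.
  by apply: splits_lead; apply: splits_dvd Hs; rewrite QE dvdp_map.
- move=> P /irr_eq[Q [-> Qirr]] _; rewrite separable_map separable_poly.unlock.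
  by apply: irreducible_coprime_deriv => // n; exact: ratf_natr_neq0.
Qed.

End Uniformizer.

(** Local degrees are constant along fibres, so X lifts through itself in all possible ways. *)
Lemma uniformizer_galois X nu : nonconst X -> (forall z, locdeg X z = nu (evalr X z)) ->
  galois_cov X.
Proof.
move=> hX HX; apply: galois_cov_splits => //; apply: unramified_lift => // z y E.
by rewrite !HX E.
Qed.

Lemma uniformizer_semiconj A X nu : nonconst A -> nonconst X ->
  (forall z, locdeg X z = nu (evalr X z)) -> orb_fixed A nu ->
  exists B, rcomp A X = rcomp X B /\ nonconst B.
Proof.
move=> hA hX HX fixA; apply: unramified_lfactor => //; first exact: nonconst_comp.
move=> z y; rewrite evalr_comp // => E; rewrite HX E locdeg_comp // HX fixA.
by rewrite dvdn_mul // dvdn_gcdl.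
Qed.

Lemma bounded_uniformizer_lfactor A X nu U : (2 <= rdeg A)%N -> nonconst X -> nonconst U ->
  (forall z, locdeg X z = nu (evalr X z)) ->
  (forall mu, good_orbifold mu -> orb_fixed A mu -> forall z, (mu z %| nu z)%N) ->
  gd_bounded A U -> exists l, lfactor U (rcomp (iterc A l) X).
Proof.
move=> degA hX hU HX numax gdb; have hA : nonconst A := ltnW degA.
have [d [Q [P [N [sQ Qdvd [QP P0] [N0 PN] [Pfix PE]]]]]] := bounded_tower degA hU gdb.
have [good fixP] := ram_index_orbifold hA P0 N0 PN Pfix PE.
have tr w : spl (pcomp X P) w 1.
  apply/spl_pcomp => //; rewrite mul1n.
  have [nu0 nuP] := ram_indexP N0 (PN (evalr X w)).
  by apply/nuP; rewrite ?locdeg_gt0 // HX; exact: numax.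
have sP : splits (pcomp X P).
  by apply: (unramified_splits (N := 1)) => //; rewrite -size_poly_gt0 size_pcomp size_poly_gt0.
have QP' : pcomp X Q %| pcomp X P by rewrite /pcomp dvdp_map.
have [|V rV] := splits_root (splits_dvd QP' sP); first by rewrite size_pcomp.
have hAd := iterc_nonconst d hA.
have hAX : nonconst (rcomp (iterc A d) X) by exact: nonconst_comp.
have rV' : root (fibp rC U (rcomp (iterc A d) X)) V.
  rewrite -(pcomp_fibp U (iterc A d) hX); apply: (dvdp_root_trans _ rV).
  by rewrite /pcomp dvdp_map; exact: Qdvd.
have [E _] := root_fibp hAX rV'.
by exists d, V.
Qed.

End RationalTransform.

Fact frac_cross_field (k : fieldType) (p q n d : k) : q != 0 -> d != 0 ->
  p / q = n / d -> p * d = n * q.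
Proof. by move=> q0 d0 /eqP; rewrite eqr_div // => /eqP. Qed.

Fact frac_cross (A : idomainType) (p q n d : A) : q != 0 -> d != 0 ->
  p%:F / q%:F = n%:F / d%:F -> p * d = n * q.
Proof.
rewrite -[q == 0]tofrac_eq0 -[d == 0]tofrac_eq0 => q0 d0 /(frac_cross_field q0 d0)/eqP.
by rewrite -!tofracM tofrac_eq => /eqP.
Qed.

Fact remainder_identity (k : fieldType) (q1 q2 d r1 r2 : {poly k}) (g : k) :
  r1 - g *: r2 = q1 * d + r1 - g *: (q2 * d + r2) - d * (q1 - g *: q2).
Proof. by rewrite -!mul_polyC; ring. Qed.

Lemma monic_eqp_scale (k : fieldType) (G P : {poly k}) : G \is monic -> P %= G ->
  G = (lead_coef P)^-1 *: P.
Proof.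
move=> Gm /eqpP[[a b] /= /andP[a0 b0] E].
have P0 : lead_coef P != 0.
  apply: contra_neq b0 => P0; have := congr1 lead_coef E.
  by rewrite !lead_coefZ P0 mulr0 (monicP Gm) mulr1.
have := congr1 lead_coef E; rewrite !lead_coefZ (monicP Gm) mulr1 => lE.
apply: (scalerI b0); rewrite -E scalerA -lE mulfK //.
Qed.

(** * Lueroth's theorem *)

Section Luroth.
Variable R : realType.
Local Notation C := R[i].
Local Notation K := (lau C).
Local Notation lC := (lC C).
Implicit Types (f g h X V W U F : ratf R) (t s : K) (P : {poly ratf R}).
Local Notation rC := (rC R).
Local Notation idr := (idr R).

Lemma rdeg_frac_le (p q : {poly C}) : q != 0 ->
  (rdeg (p%:F / q%:F) <= (maxn (size p) (size q)).-1)%N.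
Proof.
move=> q0; set f := p%:F / q%:F.
have E : p * rden f = rnum f * q by apply: frac_cross; rewrite ?rden_neq0 //; exact: ratfE.
have sd : (size (rden f) <= size q)%N.
  apply: dvdp_leq => //; have : rden f %| rnum f * q by rewrite -E dvdp_mull.
  by rewrite Gauss_dvdpr // coprimep_sym coprime_rnum_rden.
have sn : (size (rnum f) <= size p)%N.
  have [p0|p0] := eqVneq p 0.
    have := E; rewrite p0 mul0r => /esym/eqP; rewrite mulf_eq0 (negPf q0) orbF => /eqP ->.
    by rewrite size_poly0.
  apply: dvdp_leq => //; have : rnum f %| p * rden f by rewrite E dvdp_mulr.
  by rewrite Gauss_dvdpl // coprime_rnum_rden.
rewrite /rdeg -!subn1 leq_sub2r // geq_max !leq_max sn sd orbT //.
Qed.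

Lemma leval_rmorph t : transc lC t -> exists chi, emb lC chi t /\ forall g, leval g t = chi g.
Proof.
move=> Ht; have [chi Hc] := emb_ex Ht; exists chi; split=> // g.
by rewrite (lev_emb _ Hc).
Qed.

Section Coupled.
Variables X V : ratf R.

Definition coupled t s :=
  [/\ transc lC t, transc lC s, leval X t = leval X s & leval V t = leval V s].

(* The subfield C(X, V), described by its values on pairs of points that X and V do not distinguish. *)
Definition separated f := forall t s, coupled t s -> leval f t = leval f s.

(** A coupled pair gives two embeddings of C(z) that agree on both polynomials, and gcd and
    normalization commute with field embeddings. *)
Lemma separated_gcd f g : separated f -> separated g -> forall i,
  separated ((lead_coef (gcdp (fibp rC f f) (fibp rC g g)))^-1 *:
             gcdp (fibp rC f f) (fibp rC g g))`_i.
Proof.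
move=> sf sg i t s cts; have [Ht Hs _ _] := cts.
have [chi [Hc cE]] := leval_rmorph Ht; have [psi [Hp pE]] := leval_rmorph Hs.
have fE h : separated h -> map_poly chi (fibp rC h h) = map_poly psi (fibp rC h h).
  by move=> sh; rewrite (map_fibp _ _ Hc.1) (map_fibp _ _ Hp.1) -cE -pE (sh t s cts).
have gE : map_poly chi (gcdp (fibp rC f f) (fibp rC g g)) = map_poly psi (gcdp (fibp rC f f) (fibp rC g g)).
  by rewrite !gcdp_map !fE.
rewrite cE pE !coefZ !rmorphM !fmorphV -!lead_coef_map gE -!coef_map gE //.
Qed.

(* The coefficients of the gcd are separated, so of degree at least deg W when nonconstant; comparing x-degrees, the gcd is the whole of W(y) - W(x). *)
Lemma luroth_gcd W g : nonconst W -> nonconst g -> separated W -> separated g ->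
  (forall f, nonconst f -> separated f -> (rdeg W <= rdeg f)%N) ->
  fibp rC W W %| fibp rC g g.
Proof.
move=> hW hg sW sg Wmin.
set D := fibp rC W W; set E := fibp rC g g.
have D0 : D != 0 by exact: fibp_rC_neq0.
have g0 : gcdp D E != 0 by rewrite gcdp_eq0 negb_and D0.
pose G := (lead_coef (gcdp D E))^-1 *: gcdp D E.
have [Gm GE] : G \is monic /\ G %= gcdp D E by exact: monic_scale.
have GD : G %| D by rewrite (eqp_dvdl _ GE) dvdp_gcdl.
have Gr : root G idr.
  rewrite (eqp_root GE) root_gcd; have := fibp_root W (nonconst_idr R).
  by have := fibp_root g (nonconst_idr R); rewrite !rcomp_idr => -> ->.
have [i Gi] : exists i, nonconst G`_i.
  apply: contrapT => H; have cst j : exists a, G`_j = rC a.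
    by apply/nonconstP/negP => Gj; apply: H; exists j.
  pose p : {poly C} := \poly_(j < size G) sval (cid (cst j)).
  have pE : G = map_poly rC p.
    apply/polyP => j; rewrite coef_map coef_poly; case: ltnP => [_|Gj].
      by case: cid.
    by rewrite nth_default //; exact/esym/rmorph0.
  have p0 : p != 0.
    apply: contraTneq Gm => p0; rewrite pE p0 rmorph0 monicE lead_coef0.
    by rewrite eq_sym oner_eq0.
  by have := nonconst_transc (nonconst_idr R) p0; rewrite -pE (rootP Gr) eqxx.
have degi : (rdeg W <= rdeg (G`_i)%R)%N by apply: Wmin => //; exact: separated_gcd.
have [Q [HQ QE]] := fracp_rep (monic_neq0 Gm).
have [S SE] : exists S, curve W W = Q * S.
  apply: xprim_dvd => //.
  by rewrite (eqp_dvdl _ QE) (eqp_dvdr _ (fracp_curve W W)).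
have c0 : curve W W != 0 by have := curve_xprim W hW 0; apply: contra_neq => ->; rewrite rmorph0.
have Q0 : Q != 0 by apply: contra_neq c0 => h; rewrite SE h mul0r.
have S0 : S != 0 by apply: contra_neq c0 => h; rewrite SE h mulr0.
have l0 : lead_coef Q != 0 by rewrite lead_coef_eq0.
have Gcoef : G`_i = (Q`_i)%:F / (lead_coef Q)%:F.
  have lE : lead_coef (fracp Q) = (lead_coef Q)%:F.
    by rewrite lead_coefE size_fracp /fracp coef_map -lead_coefE.
  by rewrite (monic_eqp_scale Gm QE) coefZ lE /fracp coef_map mulrC.
have sYQ : (rdeg W < sizeY Q)%N.
  have le1 := rdeg_frac_le Q`_i l0; rewrite -Gcoef in le1.
  have := leq_trans degi le1.
  have M0 : (0 < maxn (size (Q`_i)%R) (size (lead_coef Q)))%N.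
    by rewrite leq_max !size_poly_gt0 l0 orbT.
  rewrite -ltnS (prednK M0) => /leq_trans; apply.
  by rewrite geq_max max_size_coefXY max_size_lead_coefXY.
have sYc : (sizeY (curve W W) <= (rdeg W).+1)%N.
  have sM : maxn (size (rnum W)) (size (rden W)) = (rdeg W).+1.
    by rewrite prednK // leq_max (size_poly_gt0 (rden W)) rden_neq0 orbT.
  have szM (p : {poly C}) c : (size (p * c%:P)%R <= size p)%N.
    by rewrite mulrC mul_polyC size_scale_leq.
  apply/bigmax_leqP => j _; rewrite /curve coefB !coefCM !coef_map /= -sM.
  apply: leq_trans (size_polyD _ _) _; rewrite size_polyN.
  by rewrite geq_max !leq_max !szM orbT.
have sYS : (size (swapXY S) <= 1)%N.
  have : sizeY (curve W W) = (sizeY Q + size (swapXY S)).-1.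
    by rewrite SE !sizeYE rmorphM size_mul // swapXY_eq0.
  move: sYQ sYc; move: (sizeY (curve W W)) (size (swapXY S)) (sizeY Q) (rdeg W).
  clear; lia.
have SE' : S = ((swapXY S)`_0)^:P by rewrite -swapXY_polyC -size1_polyC // swapXYK.
have fS : fracp S = map_poly rC (swapXY S)`_0 by rewrite {1}SE' /fracp -map_poly_comp.
have Wc : fracp Q * fracp S %= D by rewrite -fracpM -SE; exact: fracp_curve.
have D_G : D %| G.
  rewrite -(eqp_dvdr _ QE) -(eqp_dvdl _ Wc) fS.
  case: (leqP (size (swapXY S)`_0) 1) => [s1|/root_ex[c rc]].
    have c0' : (swapXY S)`_0`_0 != 0.
      apply: contra_neq S0 => h; rewrite SE' (size1_polyC s1) h map_polyC /=.
      by rewrite polyC0.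
    rewrite (size1_polyC s1) map_polyC /= mulrC mul_polyC dvdpZl //.
    by rewrite -[_%:P%:F]/(rC _) fmorph_eq0.
  have := fibp_no_const_root c hW hW; rewrite -(eqp_root Wc) fS rootM.
  suff -> : root (map_poly rC (swapXY S)`_0) (rC c) by rewrite orbT.
  by rewrite (fmorph_root rC).
by apply: dvdp_trans D_G _; rewrite (eqp_dvdl _ GE) dvdp_gcdr.
Qed.

(** Numerator and denominator of g are reduced modulo W(y) - x, with remainders r1 and r2. After x
    := W, the difference r1 - g r2 is divisible by W(y) - W(x) and of smaller degree, hence zero,
    and comparing one coefficient gives g as a quotient of functions of W. *)
Lemma luroth_dvd W g : nonconst W -> nonconst g -> fibp rC W W %| fibp rC g g ->
  exists h, g = compm W h.
Proof.
move=> hW hg Dg.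
have hI := nonconst_idr R.
pose D0 := fibp rC W idr.
have D0n : D0 != 0 by exact: fibp_rC_neq0.
have DE : map_poly (compm W) D0 = fibp rC W W.
  by rewrite -[LHS]/(pcomp W D0) pcomp_fibp // rcomp_idl.
have cE (p : {poly C}) : map_poly (compm W) (map_poly rC p) = map_poly rC p.
  by rewrite -map_poly_comp; apply: eq_map_poly => c /=; exact: compm_rC.
pose r1 := map_poly rC (rnum g) %% D0; pose r2 := map_poly rC (rden g) %% D0.
pose r := map_poly (compm W) r1 - g *: map_poly (compm W) r2.
have Dr : fibp rC W W %| r.
  have -> : r = fibp rC g g - map_poly (compm W) D0 * (map_poly (compm W) (map_poly rC (rnum g) %/ D0)
       - g *: map_poly (compm W) (map_poly rC (rden g) %/ D0)).
    have e (p : {poly C}) : map_poly rC p = map_poly (compm W) (map_poly rC p %/ D0) * map_poly (compm W) D0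
        + map_poly (compm W) (map_poly rC p %% D0).
      rewrite -[LHS]cE {1}(divp_eq (map_poly rC p) D0).
      by rewrite (rmorphD (map_poly (compm W))) (rmorphM (map_poly (compm W))).
    rewrite /fibp {1}(e (rnum g)) {1}(e (rden g)) /r -/r1 -/r2; exact: remainder_identity.
  by rewrite DE; apply: dvdp_sub => //; exact: dvdp_mulr.
have sr : (size r < size (fibp rC W W))%N.
  rewrite -DE size_map_poly; apply: leq_ltn_trans (size_polyD _ _) _.
  rewrite size_polyN gtn_max size_map_poly ltn_modp D0n /=.
  by apply: leq_ltn_trans (size_scale_leq _ _) _; rewrite size_map_poly ltn_modp.
have r0 : r = 0.
  by apply/eqP; apply: contraLR Dr => r0; rewrite gtNdvdp.
have r2n : r2 != 0.
  apply/negP => /eqP r20.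
  have D0d : D0 %| map_poly rC (rden g) by rewrite /dvdp -/r2 r20.
  have sD : splits D0.
    apply: splits_dvd D0d _; exists (map rC (roots_seq (rden g))).
    by apply: splits_const; exact: rden_neq0.
  have [|x rx] := splits_root sD; first by rewrite size_fibp_rC // ltnS.
  have := dvdp_root_trans D0d rx; rewrite (eqp_prod_root _ (splits_const rC (rden_neq0 g))).
  by move=> /mapP[c _ xc]; have := fibp_no_const_root c hW hI; rewrite -xc rx.
have [i ri] : exists i, r2`_i != 0 by exists (size r2).-1; rewrite -lead_coefE lead_coef_eq0.
exists (r1`_i / r2`_i).
have E : compm W r1`_i = g * compm W r2`_i.
  have := congr1 (fun p : {poly ratf R} => p`_i) r0; rewrite coef0 /r coefB coefZ !coef_map => /eqP.
  by rewrite subr_eq0 => /eqP.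
rewrite (fmorph_div (compm W)) E; apply/esym; apply: mulfK.
by rewrite fmorph_eq0.
Qed.

Lemma luroth : nonconst X -> exists W, [/\ nonconst W, separated W &
  forall g, separated g -> exists h, g = compm W h].
Proof.
move=> hX; pose P n := `[< exists W, [/\ nonconst W, separated W & rdeg W = n] >].
have P0 : exists n, P n.
  by exists (rdeg X); apply/asboolP; exists X; split=> // t s [].
case: (ex_minnP P0) => n /asboolP[W [hW sW Wn]] nmin; exists W; split=> // g sg.
case: (boolP (nonconst g)) => [hg|/nonconstP[a ->]]; last by exists (rC a); rewrite compm_rC.
apply: luroth_dvd => //; apply: luroth_gcd => // f hf sf.
by rewrite Wn; apply: nmin; apply/asboolP; exists f.
Qed.

End Coupled.
End Luroth.

Lemma uniq_map_inj (T S : eqType) (f : T -> S) (s : seq T) : uniq (map f s) ->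
  {in s &, injective f}.
Proof.
elim: s => [|x s IH] //= /andP[fx us] y z; rewrite !inE => /orP[/eqP->|ys] /orP[/eqP->|zs] // E.
- by case/negP: fx; rewrite E map_f.
- by case/negP: fx; rewrite -E map_f.
- exact: IH.
Qed.

Lemma eqp_dvd_size (k : fieldType) (p q : {poly k}) :
  p %| q -> q != 0 -> (size q <= size p)%N -> p %= q.
Proof. by move=> pq q0 sqp; rewrite -dvdp_size_eqp // eqn_leq sqp dvdp_leq. Qed.

(** * Birational parametrizations of components and their genus *)

Section Decomposition.
Variable R : realType.
Local Notation C := R[i].
Local Notation K := (lau C).
Local Notation lC := (lC C).
Implicit Types (f g h X V W U F : ratf R) (t s x y : K) (P : {poly ratf R}).
Implicit Types (c w z : option C).
Local Notation rC := (rC R).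
Local Notation idr := (idr R).

Lemma leval_comp f g t : transc lC t -> nonconst g -> leval (rcomp f g) t = leval f (leval g t).
Proof.
move=> Ht hg; have [chi [Hc cE]] := leval_rmorph Ht.
have [psi [Hp pE]] := emb_comp f Hc hg.
by rewrite cE pE (lev_emb _ Hp) cE.
Qed.

Definition place s := exists w k, (0 < k)%N /\ ltype w k s.

Lemma place_transc s : place s -> transc lC s.
Proof. by move=> [w [k [k0 Hs]]]; apply: ltype_transc_emb Hs. Qed.

Lemma place_subd d s : (0 < d)%N -> place s -> place (subd d s).
Proof.
move=> d0 [w [k [k0 Hs]]]; exists w, (d * k)%N; rewrite muln_gt0 d0 k0.
by split=> //; apply: ltype_subd.
Qed.

Lemma lift_place W s : nonconst W -> place s ->
  exists d t, [/\ (0 < d)%N, place t & leval W t = subd d s].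
Proof.
move=> hW [w [k [k0 Hs]]].
have [z zw] : exists z, evalr W z = w.
  have := sum_fiber w hW; case E : (fiber W w) => [|z f].
    by rewrite big_nil => h; move: hW; rewrite /nonconst -h.
  by exists z; apply/eqP; rewrite -mem_fiber // E mem_head.
have [eta [Heta Weta]] := uniformizer_lift z hW.
have e0 := locdeg_gt0 z hW; set e := locdeg W z in Weta e0.
have ek0 : (0 < e * k)%N by rewrite muln_gt0 e0.
have [tau [tau' [[_ _ [tC _] tl _] tauE]]] := ltype_auto ek0 (ltype_subd e0 Hs).
exists e, (tau (subd k eta)); split=> //.
  exists z, (k * 1)%N; rewrite muln1 k0; split=> //; apply: tl.
  by have := ltype_subd k0 Heta; rewrite muln1.
by rewrite -leval_map // -leval_map ?Weta ?subd_loc // ?zw 1?mulnC ?tauE // => a; exact: subd_lC.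
Qed.

(** Birationality of z -> (X(z), V(z)) onto its image, stated on points over C((s)) because Puiseux
    roots are compared there. *)
Definition jointly_injective X V := forall s s', place s -> place s' ->
  leval X s = leval X s' -> leval V s = leval V s' -> s = s'.

(** Two points not distinguished by X' and V' lift through W, after s is replaced by a power, to a
    coupled pair; W is separated, so they coincide. *)
Lemma luroth_decomposition X V : nonconst X -> nonconst V -> exists W X' V',
  [/\ nonconst W, X = rcomp X' W, V = rcomp V' W, nonconst X' /\ nonconst V' &
      jointly_injective X' V'].
Proof.
move=> hX hV; have [W [hW sW Wgen]] := luroth V hX.
have [X' XE] : exists h, X = compm W h by apply: Wgen => t s [].
have [V' VE] : exists h, V = compm W h by apply: Wgen => t s [].
rewrite compmE // in XE; rewrite compmE // in VE.
have nc f g : nonconst g -> g = rcomp f W -> nonconst f.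
  move=> hg gE; apply/negP => /negP/nonconstP[a fa].
  by have := nonconst_neq a hg; rewrite gE fa rcomp_rC // eqxx.
exists W, X', V'; split=> //; first by split; [exact: nc XE|exact: nc VE].
move=> s s' ps ps' XX VV.
have [d [t [d0 pt tE]]] := lift_place hW ps.
have [d' [t' [d'0 pt' t'E]]] := lift_place hW ps'.
have pt1 := place_subd d'0 pt; have pt1' := place_subd d0 pt'.
have lC_subd n a : subd n (lC a) = lC a by exact: subd_lC.
have WtE : leval W (subd d' t) = subd (d' * d) s.
  by rewrite -leval_map // tE subdM.
have Wt'E : leval W (subd d t') = subd (d' * d) s'.
  by rewrite -leval_map // t'E subdM // mulnC.
have cpl : coupled X V (subd d' t) (subd d t').
  split; try exact: place_transc.
    rewrite XE !leval_comp ?WtE ?Wt'E -?leval_map ?XX //; exact: place_transc.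
  rewrite VE !leval_comp ?WtE ?Wt'E -?leval_map ?VV //; exact: place_transc.
by have := sW _ _ cpl; rewrite WtE Wt'E => /fmorph_inj.
Qed.

(** The common value is a series in s^lcm(N/e, N/e'); primitivity of x forces this lcm to be N/e,
    and by symmetry N/e'. *)
Lemma lprim_index N e e' x x' : (0 < N)%N -> (e %| N)%N -> (e' %| N)%N ->
  lprim e x -> lprim e' x' -> subd (N %/ e) x = subd (N %/ e') x' -> e = e' /\ x = x'.
Proof.
move=> N0 eN e'N Px Px' E.
have pos a : (a %| N)%N -> (0 < a)%N /\ (0 < N %/ a)%N.
  move=> aN; have a0 : (0 < a)%N by apply: dvdn_gt0 aN.
  by split=> //; rewrite divn_gt0 // dvdn_leq.
have half a a' (u u' : K) : (a %| N)%N -> (a' %| N)%N -> lprim a u ->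
    subd (N %/ a) u = subd (N %/ a') u' -> (N %/ a' %| N %/ a)%N.
  move=> aN a'N Pu E'; have [a0 d0] := pos a aN; have [a'0 d'0] := pos a' a'N.
  have [v vE] : in_subd (lcmn (N %/ a) (N %/ a')) (subd (N %/ a) u).
    by apply: in_subd_lcm => //; [exists u|rewrite E'; exists u'].
  have [k kE] := dvdnP (dvdn_lcml (N %/ a) (N %/ a')).
  have k0 : (0 < k)%N.
    by have : (0 < lcmn (N %/ a) (N %/ a'))%N by [rewrite lcmn_gt0 d0]; rewrite kE muln_gt0 => /andP[].
  have ka : (k %| a)%N.
    have dvN b : (b %| N)%N -> (N %/ b %| N)%N by move=> bN; rewrite -{2}(divnK bN) dvdn_mulr.
    by rewrite -(dvdn_pmul2r d0) -kE dvdn_lcm mulnC divnK // !dvN.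
  have uE : u = subd k v.
    by apply: (fmorph_inj (subd (N %/ a))); rewrite subdM // mulnC -kE.
  have k1 : k = 1%N.
    by case: (ltnP 1 k) => [k1|]; [case: (Pu k k1 ka); exists v|case: (k) k0 => [|[]]].
  by rewrite k1 mul1n in kE; rewrite -kE dvdn_lcmr.
have dd : (N %/ e = N %/ e')%N.
  apply/eqP; rewrite eqn_dvd (half e' e x' x) //.
  by rewrite (half e e' x x').
have ee : e = e'.
  have [e0 d0] := pos e eN; apply/eqP; rewrite -(eqn_pmul2l d0) divnK // dd divnK //.
split=> //; apply: (fmorph_inj (subd (N %/ e))); by rewrite E dd.
Qed.

Lemma rot_subd_exp N e zt k (y : K) : (0 < N)%N -> (e %| N)%N -> zt ^+ N = 1 -> (k %| e)%N ->
  (0 < k)%N -> (0 < e)%N -> rot (zt ^+ (e %/ k)) (subd (N %/ e) (subd k y)) = subd (N %/ e) (subd k y).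
Proof.
move=> N0 eN zN ke k0 e0; have d0 : (0 < N %/ e)%N by rewrite divn_gt0 // dvdn_leq.
rewrite subdM //; apply: rot_subd; first by rewrite muln_gt0 d0.
by rewrite -exprM mulnCA divnK // divnK.
Qed.

(** * Parametrized components *)

Section GenusZero.
Variables X V : ratf R.
Hypotheses (hX : nonconst X) (hV : nonconst V) (inj : jointly_injective X V).

(** A common multiple of all local degrees of X, so that all sheets live at one exponent. *)
Let N := (rdeg X)`!.
Let N0 : (0 < N)%N := fact_gt0 _.
Let zt : C := sval (cid (prim_root_ex R N0)).
Let ztP : N.-primitive_root zt := svalP (cid (prim_root_ex R N0)).
Let eta : option C -> K := sval (cid (eta_ex hX)).
Let etaP := svalP (cid (eta_ex hX)) : forall z, ltype z 1 (eta z) /\ leval X (eta z) = loc (evalr X z) (locdeg X z).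
Let zN : zt ^+ N = 1 := prim_expr_order ztP.

Let eN z : (locdeg X z %| N)%N.
Proof. by rewrite dvdn_fact // locdeg_gt0 // locdeg_le. Qed.

Let e0 z : (0 < locdeg X z)%N. Proof. exact: locdeg_gt0. Qed.

Let d0 z : (0 < N %/ locdeg X z)%N.
Proof. by rewrite divn_gt0 // dvdn_leq. Qed.

Let zt0 : zt != 0.
Proof.
apply/eqP => z0; have := zN; rewrite z0 expr0n gtn_eqF // => /eqP.
by rewrite eq_sym oner_eq0.
Qed.

(* The solutions t of X(t) = c + s^N are indexed by pairs (z, i) with z over c and i < locdeg X z; sheet (z, i) is the Puiseux root V(t) written with its own ramification e = locdeg X z. *)
Let liftp (p : option C * nat) := rot (zt ^+ p.2) (subd (N %/ locdeg X p.1) (eta p.1)).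
Let sheet (p : option C * nat) :=
  rot (zt ^+ (N %/ locdeg X p.1) ^+ p.2) (leval V (eta p.1)).
Let sheets c := [seq (z, i) | z <- fiber X c, i <- iota 0 (locdeg X z)].

Let mem_sheets c p : (p \in sheets c) = (evalr X p.1 == c) && (p.2 < locdeg X p.1)%N.
Proof.
apply/allpairsPdep/andP => [[z [i [zf ii ->]]]|[pc pi]].
  by move: zf ii; rewrite mem_fiber // mem_iota.
by exists p.1, p.2; rewrite mem_fiber // mem_iota; case: p pc pi => z i /= -> ->.
Qed.

Let sheetE p : leval V (liftp p) = subd (N %/ locdeg X p.1) (sheet p).
Proof.
rewrite /liftp -leval_map; last by move=> a; exact: rot_lC.
rewrite -leval_map; last by move=> a; exact: subd_lC.
by rewrite (rot_subd_comm _ (d0 p.1) (expf_neq0 _ zt0)) /sheet (exprAC zt p.2).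
Qed.

Let place_liftp p : place (liftp p).
Proof.
exists p.1, (N %/ locdeg X p.1)%N; rewrite d0; split=> //.
apply: ltype_rot; first by rewrite expf_neq0.
by have := ltype_subd (d0 p.1) (etaP p.1).1; rewrite muln1.
Qed.

Let leval_liftp p : leval X (liftp p) = loc (evalr X p.1) N.
Proof.
rewrite /liftp -leval_map; last by move=> a; exact: rot_lC.
rewrite -leval_map; last by move=> a; exact: subd_lC.
rewrite (etaP p.1).2 subd_loc // divnK // rot_loc //.
by rewrite exprAC zN expr1n.
Qed.

Let lifts_split c : uniq (map liftp (sheets c)) /\
  fibp lC X (loc c N) %= \prod_(t <- map liftp (sheets c)) ('X - t%:P).
Proof.
have := fiber_lifts hX N0 ztP (fun z (_ : evalr X z = c) => eN z) etaP.
by rewrite /sheets map_allpairs.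
Qed.

Let leval_inj c : {in sheets c &, injective (leval V \o liftp)}.
Proof.
move=> p q; rewrite !mem_sheets => pc qc /= E.
have [u _] := lifts_split c; apply: (uniq_map_inj u); rewrite ?mem_sheets //.
apply: inj => //; rewrite !leval_liftp.
by case/andP: pc => /eqP ->; case/andP: qc => /eqP ->.
Qed.

Let sheets_uniq c : uniq (sheets c).
Proof. by have [u _] := lifts_split c; apply: map_uniq u. Qed.

Let size_sheets c : size (sheets c) = rdeg X.
Proof.
rewrite size_allpairs_dep -(sum_fiber c hX) sumnE big_map.
by apply: eq_bigr => z _; rewrite size_iota.
Qed.

(** If a sheet were a series in s^k, rotating it by e/k steps would give the value of V at another
    sheet over the same point, against joint injectivity. *)
Let sheet_primitive c p : p \in sheets c -> lprim (locdeg X p.1) (sheet p).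
Proof.
move=> pc k k1 ke [y yE]; set e := locdeg X p.1 in ke.
have k0 : (0 < k)%N := ltnW k1.
pose q := (p.1, (p.2 + e %/ k) %% e)%N.
have qc : q \in sheets c by move: pc; rewrite !mem_sheets /= ltn_mod e0 => /andP[->].
have : q = p.
  apply: (leval_inj qc pc); rewrite /= !sheetE /= -/e.
  rewrite [in RHS]yE -(rot_subd_exp y N0 (eN p.1) zN ke k0 (e0 p.1)) -yE -/e.
  rewrite (rot_subd_comm (sheet p) (d0 p.1) (expf_neq0 _ zt0)); congr (subd _ _).
  rewrite /sheet /= -/e rotM; [|exact/expf_neq0/expf_neq0/zt0..]; congr (rot _ _).
  have ze : (zt ^+ (N %/ e)) ^+ e = 1 by rewrite -exprM (divnK (eN p.1)) zN.
  by rewrite (expr_mod _ ze) (exprAC zt (e %/ k)) -exprD addnC.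
move/(congr1 snd) => /= h; have := pc; rewrite mem_sheets => /andP[_ lt].
have ek0 : (0 < e %/ k)%N by rewrite divn_gt0 // dvdn_leq ?e0.
have ek1 : (e %/ k < e)%N by apply: ltn_Pdiv => //; exact: e0.
have : p.2 + e %/ k == p.2 + 0 %[mod e] by rewrite h addn0 modn_small.
by rewrite eqn_modDl mod0n modn_small // gtn_eqF.
Qed.

Let H : {poly ratf R} := sval (cid (rational_transform V hX)).

Let H_split c phi : emb lC phi (loc c N) ->
  map_poly phi H = \prod_(y <- map (leval V \o liftp) (sheets c)) ('X - y%:P).
Proof.
move=> Hp; rewrite /H; case: cid => P /= [_ HP].
have [u E] := lifts_split c.
rewrite (HP _ lC phi _ Hp.1 u) ?big_map //.
by rewrite (map_fibp _ _ Hp.1) Hp.2 big_map in E *.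
Qed.

Let H_monic : H \is monic. Proof. by rewrite /H; case: cid => P /= []. Qed.

Let emb_N c : exists phi, emb lC phi (loc c N) := loc_emb_ex c N0.

Let size_H : size H = (rdeg X).+1.
Proof.
have [phi Hp] := emb_N None.
by rewrite -(size_map_poly phi) (H_split Hp) size_prod_XsubC size_map size_sheets.
Qed.

(** Evaluation at [liftp p] is a field embedding of C(z) sending X to c + s^N. Hence a polynomial
    over C(x) vanishing at one value V(t) vanishes at V, and so at all the V(t). *)
Let root_lift c phi p (P : {poly ratf R}) : emb lC phi (loc c N) -> p \in sheets c ->
  root (map_poly phi P) (leval V (liftp p)) <-> root (map_poly (compm X) P) V.
Proof.
move=> Hp pc; have Ht := place_transc (place_liftp p).
have [chi [Hc cE]] := leval_rmorph Ht.
have pE : map_poly phi P = map_poly chi (map_poly (compm X) P).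
  rewrite -map_poly_comp; apply: eq_map_poly => f /=.
  have [psi [Hs sE]] := emb_comp f Hc hX.
  rewrite compmE // sE; apply: (emb_uniq Hp).
  have := leval_liftp p; rewrite cE; move: pc; rewrite mem_sheets => /andP[/eqP -> _] <-.
  exact: Hs.
by rewrite pE cE fmorph_root.
Qed.

Let root_H_V : root (map_poly (compm X) H) V.
Proof.
have [phi Hp] := emb_N None.
have [p pc] : exists p, p \in sheets None.
  by move: hX (size_sheets None); rewrite /nonconst; case: (sheets None) => [|p s]; [move=> + h; rewrite -h|exists p; rewrite mem_head].
apply/(root_lift H Hp pc); rewrite (H_split Hp) root_prod_XsubC; apply/mapP.
by exists p.
Qed.

(** An irreducible factor has one of the V(t) as a root, therefore all deg X of them, and these are
    distinct by joint injectivity. *)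
Let H_irreducible : irreducible_poly H.
Proof.
have [P [Pm irrP PH]] : exists P, [/\ P \is monic, irreducible_poly P & P %| H].
  by apply: irreducible_factor; rewrite size_H ltnS.
have [phi Hp] := emb_N None.
have [y yP] : exists y, root (map_poly phi P) y.
  apply: splits_root; last by rewrite size_map_poly irrP.1.
  apply: (splits_dvd (q := map_poly phi H)); first by rewrite dvdp_map.
  by rewrite (H_split Hp); exists (map (leval V \o liftp) (sheets None)); exact: eqpxx.
have := dvdp_root_trans (_ : map_poly phi P %| map_poly phi H) yP.
rewrite dvdp_map => /(_ PH); rewrite (H_split Hp) root_prod_XsubC => /mapP[p pc yE].
have rV : root (map_poly (compm X) P) V by apply/(root_lift P Hp pc); rewrite -[leval _ _]yE.
have sP : (size H <= size P)%N.
  have := @max_poly_roots _ (map_poly phi P) (map (leval V \o liftp) (sheets None)).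
  rewrite size_map_poly size_map size_sheets size_H; apply.
  - exact: monic_neq0 (monic_map _ Pm).
  - apply/allP => x /mapP[q qc ->]; exact/(root_lift P Hp qc).
  - rewrite (map_inj_in_uniq (@leval_inj None)); exact: sheets_uniq.
have PHe : P %= H.
  exact: eqp_dvd_size PH (monic_neq0 H_monic) sP.
split; first by rewrite size_H ltnS.
move=> q q1 qH; apply: (eqp_trans _ PHe); apply: irrP.2 => //.
by rewrite (eqp_dvdr _ PHe).
Qed.

Let count_sheets c e : size [seq p <- sheets c | locdeg X p.1 == e] =
  (e * count (fun z => locdeg X z == e) (fiber X c))%N.
Proof.
rewrite /sheets; elim: (fiber X c) => [|z s IH] /=; first by rewrite muln0.
rewrite filter_cat size_cat IH mulnDr; congr addn.
rewrite filter_map size_map /=; case: eqP => [<-|ne] /=.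
  rewrite muln1 -[RHS](size_iota 0); congr size; apply/all_filterP/allP => i _ /=.
  exact: eqxx.
rewrite muln0; apply/eqP; rewrite size_eq0 -[_ == _]negbK -has_filter; apply/hasPn => i _ /=.
exact/eqP.
Qed.

Lemma primitive_roots c e phi : (0 < e <= rdeg X)%N -> emb lC phi (loc c e) ->
  exists s : seq K, [/\ uniq s, size s = (e * count (fun z => locdeg X z == e) (fiber X c))%N &
    forall x, x \in s <-> root (map_poly phi H) x /\ lprim e x].
Proof.
move=> /andP[e1 en] Hp; have eNN : (e %| N)%N by rewrite dvdn_fact // e1.
have d1 : (0 < N %/ e)%N by rewrite divn_gt0 // dvdn_leq.
have [psi Hs] := emb_N c.
have sub x : root (map_poly phi H) x <-> root (map_poly psi H) (subd (N %/ e) x).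
  have := emb_subd d1 Hp; rewrite (divnK eNN) => Hk.
  by rewrite -(eq_map_poly (emb_uniq Hk Hs)) map_poly_comp fmorph_root.
exists (map sheet [seq p <- sheets c | locdeg X p.1 == e]); split.
- rewrite map_inj_in_uniq ?filter_uniq // => p q; rewrite !mem_filter.
  move=> /andP[/eqP pe pc] /andP[/eqP qe qc] E; apply: (leval_inj pc qc).
  by rewrite /= !sheetE pe qe E.
- by rewrite size_map count_sheets.
- move=> x; split=> [/mapP[p]|[/sub rx px]].
    rewrite mem_filter => /andP[/eqP pe pc] ->; rewrite -pe; split; last exact: sheet_primitive pc.
    apply/sub; rewrite -pe -sheetE (H_split Hs) root_prod_XsubC; exact: (map_f (leval V \o liftp) pc).
  move: rx; rewrite (H_split Hs) root_prod_XsubC => /mapP[p pc] /=; rewrite sheetE => E.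
  have [ee xE] := lprim_index N0 eNN (eN p.1) px (sheet_primitive pc) E.
  by apply/mapP; exists p => //; rewrite mem_filter -ee eqxx.
Qed.

Lemma sum_defects c n : (rdeg X <= n)%N ->
  (\sum_(e < n.+1) e.-1 * count (fun z => locdeg X z == e) (fiber X c))%N =
  (\sum_(z <- fiber X c) (locdeg X z).-1)%N.
Proof.
move=> Xn; elim: (fiber X c) => [|z s IH].
  by rewrite big_nil big1 // => e _; rewrite muln0.
rewrite big_cons -IH /=; under eq_bigr do rewrite mulnDr.
rewrite big_split /=; congr addn.
have lt : (locdeg X z < n.+1)%N by rewrite ltnS (leq_trans _ Xn) // locdeg_le.
rewrite (bigD1 (Ordinal lt)) //= eqxx muln1 big1 ?addn0 // => i.
by rewrite -val_eqE /= eq_sym => /negPf ->; rewrite muln0.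
Qed.

(** The places over x = c correspond to the points of the fibre of X over c, with their local
    degrees. The Riemann-Hurwitz sum of the component is thus that of X, namely 2 deg X - 2, and its
    y-degree is deg X. *)
Lemma genus_zero_component F U : nonconst F -> nonconst U -> rcomp F X = rcomp U V ->
  exists Q, component (curve F U) Q /\ has_genus Q 0.
Proof.
move=> hF hU FXUV.
have HF : H %| fibp rC U F.
  apply: (irreducible_common_root (phi := compm X) H_irreducible root_H_V).
  by rewrite -[map_poly _ _]/(pcomp X _) (pcomp_fibp U F hX) FXUV; exact: fibp_root.
have [Q [cQ QH]] := component_ex H_irreducible HF.
exists Q; split=> //.
have sQ : size Q = (rdeg X).+1 by rewrite -size_fracp (eqp_size QH) size_H.
rewrite /has_genus sQ /= gtn_eqF; last exact: hX.
exists (fun c e => e * count (fun z => locdeg X z == e) (fiber X c))%N; split.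
  move=> c e /andP[e1 en]; have [phi Hp] := loc_emb_ex c e1.
  have [|s [us ss Hs]] := @primitive_roots c e phi _ Hp; first by rewrite e1.
  apply/(prim_countP _ e1 Hp); first by rewrite sQ.
  have qe : map_poly phi (fracp Q) %= map_poly phi H by rewrite eqp_map; exact: QH.
  exists s; split; [exact: us|exact: ss|] => x.
  have := eqp_root qe x; rewrite /fracp => ->; exact: Hs.
have defE c : loc_defect (fun c e => e * count (fun z => locdeg X z == e) (fiber X c))%N c (rdeg X)
    = (\sum_(z <- fiber X c) (locdeg X z).-1)%N.
  rewrite -(sum_defects c (leqnn (rdeg X))) /loc_defect; apply: eq_bigr => e _.
  by case: (val e) => [|i] //=; rewrite mulKn.
exists (undup (crit_values X)); split; [exact: undup_uniq|split].
  move=> c; rewrite mem_undup => cS; rewrite defE big_seq big1 // => z.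
  by rewrite mem_fiber // => /eqP zc; rewrite crit_valuesP // zc.
under eq_bigr do rewrite defE.
have -> : (\sum_(c <- undup (crit_values X)) \sum_(z <- fiber X c) (locdeg X z).-1)%N
    = (\sum_(z <- fibers X (undup (crit_values X))) (locdeg X z).-1)%N.
  by rewrite /fibers big_flatten big_map.
have -> : (\sum_(z <- fibers X (undup (crit_values X))) (locdeg X z).-1)%N = ((rdeg X).*2 - 2)%N.
  have uf : uniq (fibers X (undup (crit_values X))) by rewrite fibers_uniq ?undup_uniq.
  apply/eqP; rewrite eqn_leq riemann_hurwitz_le //= -(riemann_hurwitz hX).
  apply: leq_sum_subset => //; first exact: ram_points_uniq.
  by move=> z zr; rewrite (mem_fibers _ _ hX) (mem_undup (crit_values X)); exact: map_f.
by move: hX; rewrite /nonconst -mul2n; clear; lia.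
Qed.

End GenusZero.

Lemma nonconst_right U V : nonconst (rcomp U V) -> nonconst V.
Proof.
apply: contraLR => /nonconstP[a ->]; apply/nonconstP.
exists ((rnum U).[a] / (rden U).[a]); rewrite fmorph_div -!horner_map //.
Qed.

Lemma genus_zero F U X V : nonconst F -> nonconst U -> nonconst X ->
  rcomp F X = rcomp U V -> exists Q, component (curve F U) Q /\ has_genus Q 0.
Proof.
move=> hF hU hX E.
have hV : nonconst V by apply: (@nonconst_right U); rewrite -E; exact: nonconst_comp.
have [W [X' [V' [hW XE VE [hX' hV'] inj]]]] := luroth_decomposition hX hV.
apply: (genus_zero_component hX' hV' inj hF hU).
by apply: (rcomp_inj hW); rewrite -!rcompA // -XE -VE.
Qed.

(** At levels d >= l the second coordinate V is composed with an iterate of B; at levels d < l the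
    missing iterate of A is moved into the first coordinate. Either way some component has genus
    0. *)
Lemma lfactor_bounded A X B U l : nonconst A -> nonconst X -> nonconst B -> nonconst U ->
  rcomp A X = rcomp X B -> lfactor U (rcomp (iterc A l) X) -> gd_bounded A U.
Proof.
move=> hA hX hB hU AXXB [V E]; exists 0%N => d d0.
have hAd k : nonconst (iterc A k) by exact: iterc_nonconst.
have hBd k : nonconst (iterc B k) by exact: iterc_nonconst.
have hV : nonconst V by apply: (@nonconst_right U); rewrite -E; exact: nonconst_comp.
have AB k : rcomp (iterc A k) X = rcomp X (iterc B k).
  elim: k => [|k IH]; first by rewrite rcomp_idl // rcomp_idr.
  rewrite -addn1 !iterc_add // !iterc1 -rcompA // AXXB rcompA // IH -rcompA //.
have [Q [cQ gQ]] : exists Q, component (curve (iterc A d) U) Q /\ has_genus Q 0.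
  case: (leqP l d) => ld.
    apply: (@genus_zero _ _ X (rcomp V (iterc B (d - l)))) => //.
    by rewrite -{1}(subnKC ld) iterc_add // -rcompA // AB rcompA // E -rcompA.
  apply: (@genus_zero _ _ (rcomp (iterc A (l - d)) X) V) => //; first exact: nonconst_comp.
  by rewrite rcompA // -iterc_add // subnKC ?E // ltnW.
by exists Q, 0%N.
Qed.

End Decomposition.

Theorem theorem1p1 (R : realType) (A : ratf R) :
  (2 <= rdeg A)%N -> ~ special A ->
  (exists XA B : ratf R,
     galois_cov XA /\ rcomp A XA = rcomp XA B /\
     forall U : ratf R, (2 <= rdeg U)%N ->
       (gd_bounded A U <-> exists l : nat, lfactor U (rcomp (iterc A l) XA)))
  /\
  (~ gen_lattes A ->
     forall U : ratf R, (2 <= rdeg U)%N ->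
       (gd_bounded A U <-> exists l : nat, (1 <= l)%N /\ lfactor U (iterc A l))).
Proof.
move=> degA nS; have hA : nonconst A := ltnW degA.
have [nu [good fixA numax]] := maximal_orbifold degA nS.
have [a [b [c [p [q [r [o3 sph r0 _]]]]]]] := orbifold_bound degA nS good fixA.
have [X [hX HX]] := uniformizer_ex o3 sph r0.
have [B [AB hB]] := uniformizer_semiconj hA hX HX fixA.
split.
  exists X, B; split; first exact: uniformizer_galois HX.
  split=> // U degU; have hU : nonconst U := ltnW degU.
  split; first exact: bounded_uniformizer_lfactor HX numax.
  by case=> l; exact: lfactor_bounded AB.
move=> nG U degU; have hU : nonconst U := ltnW degU.
split; first exact: bounded_lfactor.
(* The same argument applies with X the identity and B = A. *)
case=> l [_ lf]; apply: (@lfactor_bounded _ A (idr R) A U l) => //.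
- exact: nonconst_idr.
- by rewrite rcomp_idr rcomp_idl.
- by rewrite rcomp_idr.
Qed.
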